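(* Let $n\in\mathbb{N}_0$ and let $\mathcal{T}$ be a collection of ordered simplices such that (i) for every $T\in\mathcal{T}$ and every subsimplex $F\subseteq T$ we have $F\in\mathcal{T}$, (ii) for every two $T,T'\in\mathcal{T}$ we have either $T\cap T'=\emptyset$ or $T\cap T'\in\mathcal{T}$, (iii) $\dim T\le n$ for every $T\in\mathcal{T}$. Let $r\in\mathbb{N}_0$ and $k\in[0:n]$. For $F\in\mathcal{T}$ of dimension $m\ge k$ define the spaces of functionals $$W_{k,r}(F) := \left\{ \phi \in \mathcal{P}_{r}\Lambda^{k}(\mathcal{T})^{\ast} \;\middle|\; \exists\, \eta \in \mathcal{P}_{r+k-m}^{-}\Lambda^{m-k}(F):\ \phi(\omega) = \int_{F} \operatorname{Tr}_{\mathcal{T},F}\omega \wedge \eta \ \text{ for all } \omega \in \mathcal{P}_r\Lambda^k(\mathcal{T})\right\},$$ $$W_{k,r}^{-}(F) := \left\{ \phi \in \mathcal{P}_{r}^{-}\Lambda^{k}(\mathcal{T})^{\ast} \;\middle|\; \exists\, \eta \in \mathcal{P}_{r+k-m-1}\Lambda^{m-k}(F):\ \phi(\omega) = \int_{F} \operatorname{Tr}_{\mathcal{T},F}\omega \wedge \eta \ \text{ for all } \omega \in \mathcal{P}_r^-\Lambda^k(\mathcal{T})\right\}.$$ Then the sums $$W_{k,r}(\mathcal{T}) := \sum_{F \in \mathcal{T},\ \dim F \geq k} W_{k,r}(F), \qquad W_{k,r}^{-}(\mathcal{T}) := \sum_{F \in \mathcal{T},\ \dim F \geq k} W_{k,r}^{-}(F)$$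 are direct, and $$\mathcal{P}_{r}\Lambda^{k}(\mathcal{T})^{\ast} = W_{k,r}(\mathcal{T}), \qquad \mathcal{P}_{r}^{-}\Lambda^{k}(\mathcal{T})^{\ast} = W_{k,r}^{-}(\mathcal{T}).$$
   Context: All vector spaces are over $\mathbb{C}$, and $V^*$ denotes the dual space of $V$. For integers $a,b$, $[a:b]=\{a,\dots,b\}$ (empty if $a>b$). An $m$-dimensional simplex $F$ is the convex hull of $m+1$ affinely independent points $v_0,\dots,v_m$ (its vertices) in Euclidean space; it is ordered if its set of vertices is ordered. A subsimplex of a simplex is a simplex whose vertices form a subset of the vertices of the given simplex, with vertices ordered as in the parent simplex. $\Lambda^k(F)$ is the space of smooth differential $k$-forms on $F$ with coefficients bounded together with all their derivatives. For $F\subseteq T$, the trace $\operatorname{tr}_{T,F}:\Lambda^k(T)\to\Lambda^k(F)$ is the pullback along the inclusion $F\to T$. Integrals over $F$ are with respect to an orientation of $F$. Local spaces. For an $m$-dimensional simplex $F$, let $\lambda_0,\dots,\lambda_m$ be its barycentric coordinates (affine, $\lambda_i(v_j)=\delta_{ij}$). $A(s,m)$ is the set of maps $\alpha:[0:m]\to\mathbb{N}_0$ with $\sum_i\alpha(i)=s$ (empty for $s<0$), and $\lambda^\alpha=\prod_i\lambda_i^{\alpha(i)}$. $\Sigma(l,m)$ is the set of strictly increasing maps $[1:l]\to[0:m]$ ($\Sigma(0,m)=\{\emptyset\}$), and $\Sigma_0(l,m)$ is the set of strictly increasing maps $[0:l]\to[0:m]$; $[\sigma]$ is the image of $\sigma$;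 $\mathrm{d}\lambda_\sigma$ is the wedge product of the $\mathrm{d}\lambda_{\sigma(i)}$ in increasing order of $i$ ($\mathrm{d}\lambda_\emptyset=1$); for $p\in[\rho]$, $\rho-p$ is the strictly increasing map with image $[\rho]\setminus\{p\}$, and $\epsilon(p,\rho-p)$ is the sign of the permutation sorting the sequence $p$ followed by the values of $\rho-p$ into ascending order; the Whitney forms are $\phi_\rho=\sum_{p\in[\rho]}\epsilon(p,\rho-p)\lambda_p\,\mathrm{d}\lambda_{\rho-p}$ for $\rho\in\Sigma_0(l,m)$. Define $\mathcal{P}_s\Lambda^l(F)=\operatorname{span}\{\lambda^\alpha\,\mathrm{d}\lambda_\sigma:\alpha\in A(s,m),\sigma\in\Sigma(l,m)\}$ and $\mathcal{P}^-_s\Lambda^l(F)=\operatorname{span}\{\lambda^\alpha\phi_\rho:\alpha\in A(s-1,m),\rho\in\Sigma_0(l,m)\}$. Global spaces. Let $X^k(T)$ stand for $\mathcal{P}_r\Lambda^k(T)$ for all $T\in\mathcal{T}$ (respectively, $\mathcal{P}_r^-\Lambda^k(T)$ for all $T\in\mathcal{T}$). An element $\omega=(\omega_T)\in\bigoplus_{T\in\mathcal{T},\dim T=n}X^k(T)$ is single-valued if for all $n$-dimensional $T,T'\in\mathcal{T}$ with non-empty intersection $F=T\cap T'$ one has $\operatorname{tr}_{T,F}\omega_T=\operatorname{tr}_{T',F}\omega_{T'}$. The space of single-valued elements is denoted $\mathcal{P}_r\Lambda^k(\mathcal{T})$ (respectively $\mathcal{P}_r^-\Lambda^k(\mathcal{T})$).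 For $F\in\mathcal{T}$, the global trace $\operatorname{Tr}_{\mathcal{T},F}$ from this space to $X^k(F)$ is defined in the obvious way, by $\operatorname{Tr}_{\mathcal{T},F}\omega:=\operatorname{tr}_{T,F}\omega_T$ for $n$-dimensional $T\in\mathcal{T}$ containing $F$.
   Formalization: The collection is taken finite; in (ii) a non-empty intersection must be a common ordered subsimplex of T and T'; the equality for P_r is claimed only for r ≥ 1; the global trace is 0 on F lying in no n-dimensional simplex. The statement fails without the first three. *)

(* Defs.v *)
From HB Require Import structures.
From mathcomp Require Import all_boot all_order all_fingroup all_algebra.
From mathcomp Require Import finmap complex.
From mathcomp Require Import all_classical all_reals all_analysis.
Set Implicit Arguments.
Unset Strict Implicit.
Unset Printing Implicit Defensive.
Import Order.TTheory GRing.Theory Num.Theory.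
Local Open Scope classical_set_scope.
Local Open Scope ring_scope.

Section LinearSpan.
Context {K : pzRingType} {V : lmodType K}.

Definition lspan (G : set V) : {pred V} := fun v =>
  `[< exists (p : nat) (c : 'I_p -> K) (g : 'I_p -> V),
        (forall i, G (g i)) /\ v = \sum_(i < p) c i *: g i >].

Lemma lspan_submod_closed (G : set V) : submod_closed (lspan G).
Proof.
split.
  apply/asboolP; exists 0%N, (fun=> 0), (fun=> 0).
  by split=> [[]//|]; rewrite big_ord0.
move=> a u v /asboolP[p [c [g [Gg ->]]]] /asboolP[q [d [h [Gh ->]]]].
apply/asboolP; exists (p + q)%N.
exists (fun i => match fintype.split (i : 'I_(p + q)) with inl i => a * c i | inr j => d j end).
exists (fun i => match fintype.split (i : 'I_(p + q)) with inl i => g i | inr j => h j end).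
split=> [i|]; first by case: fintype.split.
rewrite big_split_ord scaler_sumr /=; congr (_ + _); apply: eq_bigr => i _.
  by rewrite (unsplitK (inl i : 'I_p + 'I_q)%type) scalerA.
by rewrite (unsplitK (inr i : 'I_p + 'I_q)%type).
Qed.

HB.instance Definition _ (G : set V) :=
  GRing.isSubmodClosed.Build K V (lspan G) (lspan_submod_closed G).

End LinearSpan.

Section Simplices.
Context {R : realType} {N : nat}.
Local Notation E := 'rV[R]_N.

(* Row i is v_(i+1) - v_0, for s = [:: v_0; ...; v_m]. *)
Definition edge_mx (s : seq E) : 'M[R]_((size s).-1, N) :=
  \matrix_i (s`_i.+1 - s`_0).

Definition is_osimplex (s : seq E) : bool :=
  (0 < size s)%N && row_free (edge_mx s).

Record osimplex := OSimplex { vertices :> seq E; _ : is_osimplex vertices }.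

HB.instance Definition _ := [isSub for vertices].
HB.instance Definition _ := [Choice of osimplex by <:].

Definition sdim (F : osimplex) : nat := (size F).-1.

(* The vertices of a simplex are distinct, so that being a subsequence means
   being a subset with the inherited order. *)
Definition subsimplex (F T : osimplex) : bool := subseq F T.

Definition hull (F : osimplex) : set E := [set x |
  exists t : 'I_(sdim F).+1 -> R,
    [/\ forall i, 0 <= t i, \sum_i t i = 1 & x = \sum_i t i *: F`_i]].

(* Direction space of the affine hull. *)
Definition tangent (F : osimplex) (v : E) : bool := (v <= edge_mx F)%MS.

(* Barycentric coordinates: on the affine hull of F, the row of coordinates t
   of x is the solution of t *m hvertex_mx F = (x, 1), that is
   \sum_i t_i v_i = x and \sum_i t_i = 1. *)
Definition hvertex_mx (F : osimplex) : 'M[R]_((sdim F).+1, N + 1) :=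
  \matrix_i row_mx F`_i (1 : 'M[R]_1).

Definition bary (F : osimplex) (i : 'I_(sdim F).+1) (x : E) : R :=
  (row_mx x (1 : 'M[R]_1) *m pinvmx (hvertex_mx F)) 0 i.

(* Linear part of bary F i. *)
Definition dbary (F : osimplex) (i : 'I_(sdim F).+1) (v : E) : R :=
  (row_mx v (0 : 'M[R]_1) *m pinvmx (hvertex_mx F)) 0 i.
Arguments bary F i x : clear implicits.
Arguments dbary F i v : clear implicits.

Lemma baryD F i x v : bary F i (x + v) = bary F i x + dbary F i v.
Proof.
rewrite /bary; have -> : row_mx (x + v) (1 : 'M[R]_1) = row_mx x 1 + row_mx v 0.
  by rewrite add_row_mx addr0.
by rewrite mulmxDl mxE.
Qed.

Lemma hvertex_mx_free F : row_free (hvertex_mx F).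
Proof.
apply: inj_row_free => u; rewrite mulmx_sum_row.
under eq_bigr do rewrite rowK scale_row_mx; rewrite big_ord_recl /=.
have -> : \sum_(i < sdim F)
    row_mx (u 0 (lift ord0 i) *: F`_i.+1) (u 0 (lift ord0 i) *: (1 : 'M[R]_1)) =
    row_mx (\sum_(i < sdim F) u 0 (lift ord0 i) *: F`_i.+1)
           ((\sum_(i < sdim F) u 0 (lift ord0 i)) *: 1).
  rewrite scaler_suml; elim/big_rec3: _ => [|i ? ? ? _ ->]; first by rewrite row_mx0.
  by rewrite add_row_mx.
rewrite add_row_mx -scalerDl -[RHS]row_mx0 => /eq_row_mx[uF /matrixP/(_ 0 0)].
rewrite !mxE eqxx mulr1 => /eqP; rewrite addr_eq0 => /eqP u0.
have /andP[_ /row_free_inj free_edge] := valP F.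
pose u' : 'rV_(sdim F) := \row_i u 0 (lift ord0 i).
have u'0 : u' = 0.
  apply: free_edge; rewrite mul0mx mulmx_sum_row.
  under eq_bigr do rewrite rowK mxE scalerBr.
  by rewrite sumrB -scaler_suml -[RHS]uF u0 scaleNr [RHS]addrC.
apply/rowP => i; rewrite [RHS]mxE.
have uS j : u 0 (lift ord0 j) = 0 by move/rowP/(_ j): u'0; rewrite !mxE.
by case: (unliftP ord0 i) => [j|] ->; rewrite ?uS // u0 big1 ?oppr0.
Qed.

Lemma bary_vertex F (i j : 'I_(sdim F).+1) : bary F i F`_j = (i == j)%:R.
Proof.
rewrite /bary -[row_mx _ _](rowK (fun i : 'I__ => row_mx F`_i 1) j) -row_mul.
by rewrite mulmxVp ?hvertex_mx_free // !mxE eq_sym.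
Qed.

End Simplices.
Arguments osimplex : clear implicits.
Arguments bary {R N} F i x.
Arguments dbary {R N} F i v.

Section Forms.
Context {R : realType} {N : nat}.
Local Notation E := 'rV[R]_N.
Local Notation C := R[i].
Local Notation simplex := (osimplex R N).

(* A k-form on a simplex F assigns a complex number to a point of F and k
   tangent vectors of F; it is extended by zero to all other arguments (see
   trace), so that equality of forms on F is Leibniz equality. *)
Definition dform (k : nat) := E -> ('I_k -> E) -> C.
HB.instance Definition _ k :=
  GRing.Lmodule.copy (dform k) (E -> ('I_k -> E) -> C).

(* Pullback to F along an inclusion: restriction of the base point to F and of
   the arguments to the tangent space of F. *)
Definition trace k (F : simplex) (w : dform k) : dform k := fun x v =>
  if `[< hull F x /\ forall i, tangent F (v i) >] then w x v else 0.

Lemma trace_is_linear k (F : simplex) : linear (@trace k F).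
Proof.
move=> a u v; apply/funext => x; apply/funext => y.
have E (f g : dform k) : (a *: f + g) x y = a * f x y + g x y by [].
by rewrite E /trace E; case: ifP => // _; rewrite mulr0 addr0.
Qed.

HB.instance Definition _ k (F : simplex) :=
  GRing.isLinear.Build C (dform k) (dform k) *:%R (trace F) (trace_is_linear F).

Definition form_wedge k l (w : dform k) (h : dform l) : dform (k + l) := fun x v =>
  ((k`! * l`!)%N%:R)^-1 * \sum_(s : 'S_(k + l)) (-1) ^+ s *
    (w x (fun i => v (s (lshift l i))) * h x (fun j => v (s (rshift k j)))).

Definition oneform (f : E -> R) : dform 1 := fun _ v => (f (v ord0))%:C%C.

(* The wedge product of the forms dlambda_(sigma i), in increasing order of i. *)
Fixpoint dlambda (F : simplex) l : ('I_l -> 'I_(sdim F).+1) -> dform l :=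
  match l with
  | 0 => fun _ _ _ => 1
  | l'.+1 => fun sigma => form_wedge (oneform (dbary F (sigma ord0)))
                            (dlambda (fun i => sigma (lift ord0 i)))
  end.
Arguments dlambda F {l} sigma.

Definition scale_form k (f : E -> R) (w : dform k) : dform k := fun x v =>
  (f x)%:C%C * w x v.

Definition monomial (F : simplex) (alpha : 'I_(sdim F).+1 -> nat) (x : E) : R :=
  \prod_i bary F i x ^+ alpha i.
Arguments monomial F alpha x : clear implicits.

(* The term for p = rho i: the sequence p followed by the values of rho - p is
   rho composed with lift_perm ord0 i 1, which sends 0 to i and is increasing
   on the other indices, so epsilon(p, rho - p) is the sign of that
   permutation. *)
Definition whitney (F : simplex) l (rho : 'I_l.+1 -> 'I_(sdim F).+1) : dform l :=
  \sum_(i < l.+1) (-1) ^+ (lift_perm ord0 i 1%g : 'S_l.+1) *: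
    scale_form (bary F (rho i)) (dlambda F (fun j => rho (lift i j))).
Arguments whitney F {l} rho.

Definition multi_index (s : int) m (alpha : 'I_m -> nat) : Prop :=
  (\sum_i alpha i)%N%:Z = s.

Definition strict_inc l m (sigma : 'I_l -> 'I_m) : Prop :=
  forall i j : 'I_l, (i < j)%N -> (sigma i < sigma j)%N.

Definition PLambda (s : int) l (F : simplex) : submodClosed (dform l) :=
  lspan [set w | exists alpha sigma,
    [/\ multi_index s alpha, strict_inc sigma &
        w = trace F (scale_form (monomial F alpha) (dlambda F sigma))]].

Definition PminusLambda (s : int) l (F : simplex) : submodClosed (dform l) :=
  lspan [set w | exists alpha rho,
    [/\ multi_index (s - 1) alpha, strict_inc rho &
        w = trace F (scale_form (monomial F alpha) (whitney F rho))]].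

(* Iterated integral of f over the u : R^m with u_i >= 0 and \sum_i u_i <= s. *)
Fixpoint corner_integral m (s : R) (f : seq R -> R) : R :=
  match m with
  | 0 => f [::]
  | m'.+1 => \int[lebesgue_measure]_(t in `[0, s])
               corner_integral m' (s - t) (fun u => f (t :: u))
  end.

(* Integral of a form of degree d = sdim F, through the affine parametrization
   u |-> v_0 + \sum_i u_i (v_(i+1) - v_0). The orientation of F is that of
   (v_1 - v_0, ..., v_m - v_0) if o is false, and the opposite one otherwise. *)
Definition integral_form (F : simplex) (o : bool) d (w : dform d) : C :=
  let g u := w (F`_0 + \sum_(i < sdim F) u`_i *: (F`_i.+1 - F`_0))
               (fun j => F`_j.+1 - F`_0) in
  (-1) ^+ o * (corner_integral (sdim F) 1 (fun u => complex.Re (g u)) +i*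
               corner_integral (sdim F) 1 (fun u => complex.Im (g u)))%C.

End Forms.
Arguments dform R N k : clear implicits.

Section GlobalForms.
Context {R : realType} {N : nat}.
Local Notation C := R[i].
Local Notation simplex := (osimplex R N).
Variables (Tri : {fset simplex}) (n k : nat).
Variable X : simplex -> submodClosed (dform R N k).

Definition single_valued (w : simplex -> dform R N k) : Prop :=
  forall T T' F : simplex, T \in Tri -> T' \in Tri -> sdim T = n -> sdim T' = n ->
    hull F = hull T `&` hull T' -> trace F (w T) = trace F (w T').

(* Families indexed by the n-dimensional T \in Tri, extended by zero to all
   other simplices. *)
Definition global_form_pred : {pred simplex -> dform R N k} := fun w =>
  `[< [/\ forall T, T \in Tri -> sdim T = n -> w T \in X T,
          forall T, ~~ ((T \in Tri) && (sdim T == n)) -> w T = 0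
        & single_valued w] >].

Lemma global_form_submod_closed : submod_closed global_form_pred.
Proof.
split.
  apply/asboolP; split=> // T _ _; exact: rpred0.
move=> a u v.
have E T : (a *: u + v) T = a *: u T + v T by [].
move=> /asboolP[uX u0 us] /asboolP[vX v0 vs]; apply/asboolP; split.
- by move=> T TT dT; apply: rpredD; [apply: rpredZ; exact: uX|exact: vX].
- by move=> T TN; rewrite E (u0 _ TN) (v0 _ TN) scaler0 addr0.
- move=> T T' F TT TT' dT dT' FE; rewrite !E.
  by rewrite !trace_is_linear (us _ _ _ TT TT' dT dT' FE) (vs _ _ _ TT TT' dT dT' FE).
Qed.

HB.instance Definition _ := GRing.isSubmodClosed.Build C (simplex -> dform R N k)
  global_form_pred global_form_submod_closed.

Record global_form := GlobalForm {
  global_val :> simplex -> dform R N k; _ : global_val \in global_form_pred }.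

HB.instance Definition _ := [isSub for global_val].
HB.instance Definition _ := [Choice of global_form by <:].
HB.instance Definition _ := [SubChoice_isSubLmodule of global_form by <:].

(* By single-valuedness the choice of T is irrelevant. The value is 0 if F is
   contained in no n-dimensional simplex of Tri. *)
Definition global_trace (F : simplex) (w : global_form) : dform R N k :=
  if ohead [seq T <- Tri | (sdim T == n) && subsimplex F T] is Some T
  then trace F (w T) else 0.

Definition dual_space := {linear global_form -> C}.

Definition local_functionals (o : bool) (F : simplex)
    (Y : submodClosed (dform R N (sdim F - k))) : set dual_space :=
  [set phi | exists2 eta, eta \in Y & forall w : global_form,
     phi w = integral_form F o (form_wedge (global_trace F w) eta)].

Definition functional_sum (W : simplex -> set dual_space) : set dual_space :=
  [set phi | exists2 psi : simplex -> dual_space,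
     forall F, F \in Tri -> (k <= sdim F)%N -> W F (psi F) &
     forall w, phi w = \sum_(F <- Tri | (k <= sdim F)%N) psi F w].

Definition functional_sum_direct (W : simplex -> set dual_space) : Prop :=
  forall psi : simplex -> dual_space,
    (forall F, F \in Tri -> (k <= sdim F)%N -> W F (psi F)) ->
    (forall w, \sum_(F <- Tri | (k <= sdim F)%N) psi F w = 0) ->
    forall F, F \in Tri -> (k <= sdim F)%N -> forall w, psi F w = 0.

End GlobalForms.

(* The spaces P_r Lambda^k(Tri), P_r^- Lambda^k(Tri) are global_form Tri n X for
   X := PLambda r k and X := PminusLambda r k. *)
Definition W_local (R : realType) (N : nat) (Tri : {fset osimplex R N})
    (n k r : nat) (o : osimplex R N -> bool) (F : osimplex R N) :
    set (dual_space Tri n (PLambda r%:Z k)) :=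
  local_functionals (o F)
    (PminusLambda (r%:Z + k%:Z - (sdim F)%:Z) (sdim F - k) F).

Definition Wminus_local (R : realType) (N : nat) (Tri : {fset osimplex R N})
    (n k r : nat) (o : osimplex R N -> bool) (F : osimplex R N) :
    set (dual_space Tri n (PminusLambda r%:Z k)) :=
  local_functionals (o F)
    (PLambda (r%:Z + k%:Z - (sdim F)%:Z - 1) (sdim F - k) F).

(* Main.v *)
(** On one simplex with barycentric coordinates t_0, ..., t_m, lift forms to
    alternating forms on the space of the t_i, with homogeneous polynomial
    coefficients. Let S = dt_0 + ... + dt_m and let kappa be the contraction
    with t. A form omega in P_r Lambda^k is recorded by S /\ omega, whose
    coefficients are the values of omega on the edges of the (k+1)-faces, and
    P_r^- Lambda^k is the image of kappa. For the metric with
    |dt_i|^2 = t_i on the interior of the simplex, S /\ _ and kappa are adjoint,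
    and the Hodge star exchanges them. Hence kappa c is tested against star of
    the conjugate of c, and a form a against kappa (star (conj a)): the integrals
    are, up to sign, those of |kappa c|^2 and |S /\ a|^2. The test forms vanish on
    every face not containing the simplex and extend to the whole triangulation by
    the same formula; testing by descending dimension shows that the sums are
    direct. Conversely, a form whose traces on the facets vanish has a
    representative of the form star q (every coefficient is divisible by the
    missing coordinates), and then kappa q = 0, so q = kappa c by exactness of the
    Koszul complex (respectively S /\ q = 0, so q = S /\ a); testing with the
    conjugate of q gives the integral of |q|^2. By ascending dimension no
    nonzero global form is killed by all the functionals. They span a
    finite-dimensional space, which is therefore the full dual. *)

Require Import Defs.
From HB Require Import structures.
From mathcomp Require Import all_boot all_order all_fingroup all_algebra.
From mathcomp Require Import finmap complex.
From mathcomp Require Import all_classical all_reals all_analysis.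
From mathcomp Require Import ring lra zify.
Set Implicit Arguments.
Unset Strict Implicit.
Unset Printing Implicit Defensive.
Import Order.TTheory GRing.Theory Num.Theory.
Local Open Scope ring_scope.

(** * Exterior algebra and homogeneous polynomials *)

(** Since sum lambda_i = 1 and sum dlambda_i = 0, an element has many expressions in the lambda_i
    and dlambda_i. Exact homogeneity of the coefficients removes the first ambiguity and S /\ _ the
    second, as two lifts of one form differ by a multiple of S. The weights |dt_i|^2 = t_i are
    chosen because t_i vanishes on the facet opposite vertex i: every term of star q contains t_i or
    dt_i for each i, which is what extension by zero requires. They also account for the degrees in
    the theorem, since star multiplies the coefficients of an l-form by l coordinates. Behind kappa
    c in P_{r+k-m}^- stands an (m-k+1)-form c of degree r+k-m-1, whose star has degree r; an
    (m-k)-form a of degree r+k-m-1 has a star of degree r-1, and kappa restores r. Two obstacles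
    shape the rest. The integral is an iterated one-dimensional Lebesgue integral, so its linearity
    and definiteness are proved for polynomials, through antiderivatives. And the space of global
    forms is not known in advance to be finite-dimensional; but finitely many functionals with zero
    common kernel span the dual of any space. *)

Module ExteriorAlgebra.
Import mathcomp.boot.finset.

Section Exterior.
Variables (K : numFieldType) (M : nat).
Local Notation I := 'I_M.
Local Notation fam := ({set I} -> K^o).

Implicit Types (A B C : {set I}) (a b : I -> K) (w h : fam).

(* An alternating form in M variables is the family of its coefficients:
   w A is that of e_(a_1) /\ ... /\ e_(a_l) for A = {a_1 < ... < a_l}.
   ext b is the exterior product by the covector b, on the left, and ctr a is
   the contraction with the vector a. *)
Definition sg (i : I) A : K := \prod_(j in A) (-1) ^+ (j < i)%N.

Lemma sgU1 i j A : j \notin A -> sg i (j |: A) = (-1) ^+ (j < i)%N * sg i A.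
Proof. by move=> jA; rewrite /sg big_setU1. Qed.

Lemma sgD1 i j A : j \in A -> sg i A = (-1) ^+ (j < i)%N * sg i (A :\ j).
Proof. by move=> jA; rewrite /sg (big_setD1 j). Qed.

Lemma sgU1i i A : sg i (i |: A) = sg i A.
Proof.
have [iA|iA] := boolP (i \in A); last by rewrite sgU1 // ltnn mul1r.
by rewrite (setUidPr _) // sub1set.
Qed.

Lemma sgD1i i A : sg i (A :\ i) = sg i A.
Proof.
have [iA|iA] := boolP (i \in A); first by rewrite [RHS](sgD1 _ iA) ltnn mul1r.
by congr (sg _ _); apply/setDidPl; rewrite disjoint_sym disjoints1.
Qed.

Lemma sg2 i A : sg i A * sg i A = 1.
Proof. by rewrite -big_split big1 // => j _ /=; rewrite -expr2 sqrr_sign. Qed.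

Definition ext1 (i : I) w : fam := fun A => if i \in A then sg i A * w (A :\ i) else 0.
Definition ctr1 (i : I) w : fam := fun A => if i \in A then 0 else sg i A * w (i |: A).
Definition ext b w : fam := \sum_i b i *: ext1 i w.
Definition ctr a w : fam := \sum_i a i *: ctr1 i w.

Lemma ltn_sign (i j : I) : i != j ->
  (-1) ^+ (i < j)%N = - (-1) ^+ (j < i)%N :> K.
Proof.
move=> ij; case: (ltngtP i j) => [_|_|/val_inj e]; rewrite ?opprK //.
by rewrite e eqxx in ij.
Qed.

(** The canonical anticommutation relations: for i != j the two orders of insertion and removal
    differ by the single sign comparing i with j, which is what [ltn_sign] flips. *)
Lemma ctr1_ext1 i j w : ctr1 i (ext1 j w) + ext1 j (ctr1 i w) = (i == j)%:R *: w.
Proof.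
apply/funext => A; rewrite /ctr1 /ext1 !fctE /= /GRing.scale /=.
have [<-|ij] := eqVneq i j.
  rewrite setD11 setU11 mul1r; case: ifP => iA.
    by rewrite add0r setD1K // sgD1i mulrA sg2 mul1r.
  by rewrite addr0 sgU1i setU1K ?iA // mulrA sg2 mul1r.
rewrite mul0r !inE (negbTE ij) [j == i]eq_sym (negbTE ij) /=.
case: ifP => iA; case: ifP => jA; rewrite ?mulr0 ?addr0 //.
rewrite sgU1 ?iA // (sgD1 i jA) !mulrA.
have -> : (i |: A) :\ j = i |: A :\ j.
  by rewrite setDUl; congr (_ :|: _); apply/setDidPl; rewrite disjoints1 inE.
by rewrite (ltn_sign ij); case: (j < i)%N; rewrite ?expr1 ?expr0; ring.
Qed.

Lemma ctr1_ctr1 i j w : ctr1 i (ctr1 j w) = - ctr1 j (ctr1 i w).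
Proof.
apply/funext => A; rewrite /ctr1 !fctE /= !inE [j == i]eq_sym.
have [<-|ij] := eqVneq i j; first by case: ifP; rewrite ?mulr0 oppr0.
rewrite /=; case: ifP => iA; case: ifP => jA; rewrite ?mulr0 ?oppr0 //.
by rewrite !sgU1 ?iA ?jA // setUCA (ltn_sign ij); ring.
Qed.

Lemma ext1_ext1 i j w : ext1 i (ext1 j w) = - ext1 j (ext1 i w).
Proof.
apply/funext => A; rewrite /ext1 !fctE /= !inE [j == i]eq_sym.
have [<-|ij] := eqVneq i j; first by case: ifP; rewrite ?mulr0 oppr0.
rewrite /=; case: ifP => iA; case: ifP => jA; rewrite ?mulr0 ?oppr0 //.
by rewrite (sgD1 j iA) (sgD1 i jA) (ltn_sign ij) setDDl setUC -setDDl; ring.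
Qed.

Fact ext1_linear i : linear (ext1 i).
Proof.
move=> c w h; apply/funext => A; rewrite /ext1 !fctE /GRing.scale /=.
by case: ifP => _; ring.
Qed.

Fact ctr1_linear i : linear (ctr1 i).
Proof.
move=> c w h; apply/funext => A; rewrite /ctr1 !fctE /GRing.scale /=.
by case: ifP => _; ring.
Qed.

HB.instance Definition _ i :=
  GRing.isLinear.Build K fam fam *:%R (ext1 i) (ext1_linear i).
HB.instance Definition _ i :=
  GRing.isLinear.Build K fam fam *:%R (ctr1 i) (ctr1_linear i).

Fact ext_linear b : linear (ext b).
Proof.
move=> c w h; rewrite /ext scaler_sumr -big_split; apply: eq_bigr => i _ /=.
by rewrite linearP scalerDr !scalerA mulrC.
Qed.

Fact ctr_linear a : linear (ctr a).
Proof.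
move=> c w h; rewrite /ctr scaler_sumr -big_split; apply: eq_bigr => i _ /=.
by rewrite linearP scalerDr !scalerA mulrC.
Qed.

HB.instance Definition _ b :=
  GRing.isLinear.Build K fam fam *:%R (ext b) (ext_linear b).
HB.instance Definition _ a :=
  GRing.isLinear.Build K fam fam *:%R (ctr a) (ctr_linear a).

(** Contraction is an antiderivation. The inductions on values and products of covectors below all
    rest on this rule. *)
Lemma ctr_ext a b w :
  ctr a (ext b w) = (\sum_i a i * b i) *: w - ext b (ctr a w).
Proof.
apply/eqP; rewrite -subr_eq opprK; apply/eqP.
rewrite /ctr /ext; under eq_bigr do rewrite linear_sum scaler_sumr.
under [X in _ + X]eq_bigr do rewrite linear_sum scaler_sumr.
rewrite [X in _ + X]exchange_big /= -big_split scaler_suml; apply: eq_bigr => i _.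
rewrite -big_split (bigD1 i) //= big1 ?addr0 => [|j ji].
  rewrite !linearZ /= !scalerA [b i * a i]mulrC -scalerDr ctr1_ext1 eqxx.
  by rewrite scale1r.
rewrite !linearZ /= !scalerA [b j * a i]mulrC -scalerDr ctr1_ext1.
by rewrite eq_sym (negbTE ji) scale0r scaler0.
Qed.

Lemma ctr_ctr a b w : ctr a (ctr b w) = - ctr b (ctr a w).
Proof.
rewrite /ctr -sumrN; under eq_bigr do rewrite linear_sum scaler_sumr.
rewrite exchange_big; apply: eq_bigr => i _ /=; rewrite linear_sum scaler_sumr -sumrN.
apply: eq_bigr => j _; rewrite !linearZ /= !scalerA ctr1_ctr1.
by rewrite scalerN mulrC.
Qed.

Lemma ext_ext a b w : ext a (ext b w) = - ext b (ext a w).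
Proof.
rewrite /ext -sumrN; under eq_bigr do rewrite linear_sum scaler_sumr.
rewrite exchange_big; apply: eq_bigr => i _ /=; rewrite linear_sum scaler_sumr -sumrN.
apply: eq_bigr => j _; rewrite !linearZ /= !scalerA ext1_ext1.
by rewrite scalerN mulrC.
Qed.

Lemma eq_oppr0 w : w = - w -> w = 0.
Proof.
move=> e; apply/funext => A; have : w A *+ 2 = 0 :> K by rewrite mulr2n {1}e /= addNr.
by move/eqP; rewrite mulrn_eq0 => /eqP.
Qed.

Lemma ctrK a w : ctr a (ctr a w) = 0.
Proof. exact/eq_oppr0/ctr_ctr. Qed.

Lemma extK b w : ext b (ext b w) = 0.
Proof. exact/eq_oppr0/ext_ext. Qed.

Definition ebasis (i : I) : I -> K := fun j => (i == j)%:R.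

Lemma ebasis_ctr i w : ctr (ebasis i) w = ctr1 i w.
Proof.
rewrite /ctr (bigD1 i) //= /ebasis eqxx scale1r big1 ?addr0 // => j ji.
by rewrite eq_sym (negbTE ji) scale0r.
Qed.

Lemma ebasis_ext i w : ext (ebasis i) w = ext1 i w.
Proof.
rewrite /ext (bigD1 i) //= /ebasis eqxx scale1r big1 ?addr0 // => j ji.
by rewrite eq_sym (negbTE ji) scale0r.
Qed.

Lemma ebasis_pair i b : \sum_j ebasis i j * b j = b i.
Proof.
rewrite (bigD1 i) //= /ebasis eqxx mul1r big1 ?addr0 // => j ji.
by rewrite eq_sym (negbTE ji) mul0r.
Qed.

Lemma ebasis_pairr i b : \sum_j b j * ebasis i j = b i.
Proof. by rewrite -[RHS](ebasis_pair i); apply: eq_bigr => j _; rewrite mulrC. Qed.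

Lemma ext0 b w : ext b w set0 = 0.
Proof. by rewrite /ext fct_sumE big1 // => i _; rewrite /ext1 !fctE inE scaler0. Qed.

Definition homog (l : nat) w := forall A, #|A| != l -> w A = 0.

Lemma homogD l w h : homog l w -> homog l h -> homog l (w + h).
Proof. by move=> ww wh A Al; rewrite !fctE ww // wh // addr0. Qed.

Lemma homogZ l c w : homog l w -> homog l (c *: w).
Proof. by move=> ww A Al; rewrite !fctE ww // scaler0. Qed.

Lemma homog_sum (J : finType) l (F : J -> fam) :
  (forall k, homog l (F k)) -> homog l (\sum_k F k).
Proof. by move=> hF A Al; rewrite fct_sumE big1 // => k _; exact: hF. Qed.

Lemma homog_ext1 l i w : homog l w -> homog l.+1 (ext1 i w).
Proof.
move=> ww A Al; rewrite /ext1; case: ifP => // iA; rewrite ww ?mulr0 //.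
by apply: contra Al => /eqP <-; rewrite (cardsD1 i A) iA.
Qed.

Lemma homog_ctr1 l i w : homog l.+1 w -> homog l (ctr1 i w).
Proof.
move=> ww A Al; rewrite /ctr1; case: ifP => // iA; rewrite ww ?mulr0 //.
by rewrite cardsU1 iA eqSS.
Qed.

Lemma homog_ext l b w : homog l w -> homog l.+1 (ext b w).
Proof. by move=> ww; apply: homog_sum => i; apply: homogZ; exact: homog_ext1. Qed.

Lemma homog_ctr l a w : homog l.+1 w -> homog l (ctr a w).
Proof. by move=> ww; apply: homog_sum => i; apply: homogZ; exact: homog_ctr1. Qed.

Lemma homog0_ctr a w : homog 0%N w -> ctr a w = 0.
Proof.
move=> w0; apply/funext => A; rewrite /ctr fct_sumE big1 // => i _.
rewrite !fctE /ctr1; case: ifP => iA; rewrite ?scaler0 // w0 ?mulr0 ?scaler0 //.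
by rewrite cardsU1 iA.
Qed.

(** The coefficient at A is reproduced once for each element of A. This is the contribution l of the
    form degree to the total degree in the Koszul homotopy. *)
Lemma sum_ext1_ctr1 l w : homog l w -> \sum_i ext1 i (ctr1 i w) = l%:R *: w.
Proof.
move=> wl; apply/funext => A; rewrite fct_sumE !fctE.
have [Al|Al] := eqVneq #|A| l; last first.
  rewrite wl // scaler0 big1 // => i _; rewrite /ext1 /ctr1 setD11.
  by case: ifP => // iA; rewrite setD1K // wl ?mulr0.
rewrite -Al -sum1_card natr_sum /GRing.scale /= mulr_suml [RHS]big_mkcond /=.
apply: eq_bigr => i _; rewrite /ext1 /ctr1 setD11.
by case: ifP => // iA; rewrite setD1K // sgD1i mulrA sg2.
Qed.

(* The value of w on the vectors u_0, ..., u_(l-1). *)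
Fixpoint ev l : ('I_l -> I -> K) -> fam -> K :=
  match l with
  | 0 => fun _ w => w set0
  | l'.+1 => fun u w => ev (fun i => u (lift ord0 i)) (ctr (u ord0) w)
  end.

Arguments ev l u w : simpl never.

Lemma ev0 (u : 'I_0 -> I -> K) w : ev u w = w set0.
Proof. by []. Qed.

Lemma evS l (u : 'I_l.+1 -> I -> K) w :
  ev u w = ev (fun i => u (lift ord0 i)) (ctr (u ord0) w).
Proof. by []. Qed.

Fact ev_linear l (u : 'I_l -> I -> K) : linear_for *%R (ev u).
Proof.
elim: l u => [|l IH] u c w h; first by rewrite !ev0 !fctE.
by rewrite !evS linearP IH.
Qed.

HB.instance Definition _ l (u : 'I_l -> I -> K) :=
  GRing.isLinear.Build K fam K *%R (ev u) (@ev_linear l u).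

Lemma eq_ev l (u v : 'I_l -> I -> K) w : (forall i, u i =1 v i) -> ev u w = ev v w.
Proof.
move=> uv; suff -> : u = v by [].
by apply/funext => i; apply/funext => j; exact: uv.
Qed.

(** Laplace expansion along the covector b: contracting with u_0 either pairs it with b or, at the
    cost of a sign, passes it on to w. *)
Lemma ev_ext l (u : 'I_l.+1 -> I -> K) b w :
  ev u (ext b w) =
  \sum_(j < l.+1) (-1) ^+ j * (\sum_i u j i * b i) * ev (fun k => u (lift j k)) w.
Proof.
elim: l u b w => [|l IH] u b w.
  by rewrite big_ord_recl big_ord0 addr0 evS !ev0 mul1r ctr_ext !fctE ext0 subr0.
rewrite big_ord_recl evS ctr_ext linearB linearZ /= expr0 mul1r IH; congr (_ + _).
rewrite -sumrN; apply: eq_bigr => j _; rewrite exprS !mulN1r !mulNr.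
congr (- (_ * _)); rewrite [RHS]evS.
have -> : u (lift (lift ord0 j) ord0) = u ord0 by congr u; apply: val_inj.
apply: eq_ev => k i; congr (u _ _); apply: val_inj => /=.
by rewrite /bump !leq0n /= !add1n ltnS addnS.
Qed.

Lemma ev_ext0 l (u : 'I_l -> I -> K) b w :
  (forall j, \sum_i u j i * b i = 0) -> ev u (ext b w) = 0.
Proof.
case: l u => [|l] u ub; first by rewrite ev0 ext0.
by rewrite ev_ext big1 // => j _; rewrite ub mulr0 mul0r.
Qed.

Lemma ctrDl a a' w : ctr (fun i => a i + a' i) w = ctr a w + ctr a' w.
Proof. by rewrite /ctr -big_split; apply: eq_bigr => i _; rewrite scalerDl. Qed.

Lemma ctrZl c a w : ctr (fun i => c * a i) w = c *: ctr a w.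
Proof. by rewrite /ctr scaler_sumr; apply: eq_bigr => i _; rewrite scalerA. Qed.

(** A form annihilated by contraction with a depends on its arguments only modulo a; further
    contractions preserve this, since contractions anticommute. *)
Lemma ev_shear l (u : 'I_l -> I -> K) (c : 'I_l -> K) a w :
  ctr a w = 0 -> ev (fun j i => u j i + c j * a i) w = ev u w.
Proof.
elim: l u c w => [//|l IH] u c w aw.
rewrite !evS ctrDl ctrZl aw scaler0 addr0 IH //.
by rewrite ctr_ctr aw linear0 oppr0.
Qed.

(* For b = \sum_i dt_i: the coefficients of b /\ w at vertices are the values
   of w on edges. *)
Lemma ev_edges l (u : 'I_l.+1 -> I -> K) b w :
  (forall j, \sum_i u j i * b i = 1) ->
  ev u (ext b w) = ev (fun j i => u (lift ord0 j) i - u ord0 i) w.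
Proof.
move=> ub.
(* After contraction with u_0 the other arguments matter only modulo u_0 and may be replaced by the
   edges u_j - u_0, on which b vanishes. *)
rewrite evS -(@ev_shear _ _ (fun=> -1) (u ord0)) ?ctrK // ctr_ext ub scale1r linearB /=.
rewrite [X in _ - X]ev_ext0 ?subr0.
  by apply: eq_ev => j i; rewrite mulN1r.
move=> j; under eq_bigr do rewrite mulrDl mulN1r mulNr.
by rewrite sumrB !ub subrr.
Qed.

Lemma ev_ebasis l (s : 'I_l -> I) w :
  (forall i j : 'I_l, (i < j)%N -> (s i < s j)%N) ->
  ev (fun j => ebasis (s j)) w = w [set s j | j in 'I_l].
Proof.
elim: l s w => [|l IH] s w sinc.
  rewrite ev0.
  by congr (w _); apply/setP => i; rewrite inE; apply/esym/imsetP => -[[]].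
rewrite evS (IH (fun i => s (lift ord0 i))) => [|i j ij]; last by apply: sinc; rewrite /= /bump /= !add1n.
rewrite ebasis_ctr /ctr1; case: ifP => [/imsetP[j _ e]|_].
  by have := sinc ord0 (lift ord0 j) isT; rewrite e ltnn.
rewrite /sg big1 ?mul1r => [|k /imsetP[j _ ->]].
  congr (w _); apply/setP => k; rewrite !inE; apply/orP/imsetP.
    by case=> [/eqP ->|/imsetP[j _ ->]]; [exists ord0|exists (lift ord0 j)].
  case=> j _ ->; case: (unliftP ord0 j) => [j'|] ->; last by left.
  by right; apply/imsetP; exists j'.
by rewrite ltnNge ltnW // (sinc ord0 (lift ord0 j)).
Qed.

Definition delta0 : fam := fun A => (A == set0)%:R.

Fixpoint extprod l : ('I_l -> I -> K) -> fam :=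
  match l with
  | 0 => fun _ => delta0
  | l'.+1 => fun g => ext (g ord0) (extprod (fun i => g (lift ord0 i)))
  end.

Arguments extprod l g : simpl never.

Lemma extprodS l (g : 'I_l.+1 -> I -> K) :
  extprod g = ext (g ord0) (extprod (fun i => g (lift ord0 i))).
Proof. by []. Qed.

Lemma homog_extprod l (g : 'I_l -> I -> K) : homog l (extprod g).
Proof.
elim: l g => [|l IH] g; last exact: homog_ext.
by move=> A; rewrite cards_eq0 /extprod /delta0 => /negbTE ->.
Qed.

(** Both sides obey the same expansion along the first covector. Determinants are the bridge from
    the recursive [dlambda] to values of products of basis covectors. *)
Lemma det_ev l (g u : 'I_l -> I -> K) :
  \det (\matrix_(i, j) \sum_k u j k * g i k) = ev u (extprod g).
Proof.
elim: l g u => [|l IH] g u; first by rewrite det_mx00 ev0 /extprod /delta0 eqxx.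
rewrite (expand_det_row _ ord0) extprodS ev_ext; apply: eq_bigr => j _.
rewrite mxE [(-1) ^+ j * _]mulrC -mulrA; congr (_ * (_ * _)).
rewrite -IH; congr (\det _).
by apply/matrixP => a b; rewrite !mxE.
Qed.

(** For a = t and basis covectors the right-hand side is the alternating sum defining a Whitney
    form; hence Whitney forms are the images under kappa of products of the dt_i. *)
Lemma ctr_extprod l (g : 'I_l.+1 -> I -> K) a :
  ctr a (extprod g) =
  \sum_(j < l.+1) ((-1) ^+ j * (\sum_i a i * g j i)) *: extprod (fun k => g (lift j k)).
Proof.
elim: l g => [|l IH] g.
  rewrite big_ord_recl big_ord0 addr0 extprodS expr0 mul1r ctr_ext.
  rewrite homog0_ctr; first by rewrite linear0 subr0.
  exact: homog_extprod.
rewrite big_ord_recl extprodS ctr_ext IH expr0 mul1r; congr (_ + _).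
rewrite (linear_sum (ext (g ord0))) -sumrN; apply: eq_bigr => j _.
rewrite linearZ /= exprS mulN1r mulNr scaleNr; congr (- (_ *: _)).
rewrite [RHS]extprodS.
have -> : g (lift (lift ord0 j) ord0) = g ord0 by congr g; apply: val_inj.
congr (ext _ (extprod _)); apply/funext => k; congr g; apply: val_inj => /=.
by rewrite /bump !leq0n /= !add1n ltnS addnS.
Qed.

Definition set_delta A : fam := fun B => (B == A)%:R.

Lemma extprod_ebasis l (s : 'I_l -> I) :
  (forall i j : 'I_l, (i < j)%N -> (s i < s j)%N) ->
  extprod (fun j => ebasis (s j)) = set_delta [set s j | j in 'I_l].
Proof.
elim: l s => [|l IH] s sinc; apply/funext => A.
  rewrite /extprod /delta0 /set_delta; congr (_ == _)%:R; apply/setP => i; rewrite inE.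
  by apply/esym/imsetP => -[[]].
rewrite extprodS (IH (fun i => s (lift ord0 i))) => [|i j ij]; last by apply: sinc; rewrite /= /bump /= !add1n.
rewrite ebasis_ext /ext1 /set_delta.
set B := [set s (lift ord0 _) | _ in _].
have sB : s ord0 \notin B.
  by apply/imsetP => -[j _ e]; have := sinc ord0 (lift ord0 j) isT; rewrite e ltnn.
have -> : [set s j | j in 'I_l.+1] = s ord0 |: B.
  apply/setP => k; rewrite !inE; apply/imsetP/orP.
    case=> j _ ->; case: (unliftP ord0 j) => [j'|] ->; last by left.
    by right; apply/imsetP; exists j'.
  by case=> [/eqP ->|/imsetP[j _ ->]]; [exists ord0|exists (lift ord0 j)].
case: ifP => sA; last first.
  by case: eqP => // e; rewrite e setU11 in sA.
have -> : (A :\ s ord0 == B) = (A == s ord0 |: B).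
  apply/eqP/eqP => [<-|->]; first by rewrite setD1K.
  by rewrite setU1K.
have [->|_] := eqVneq A (s ord0 |: B); last by rewrite mulr0.
rewrite mulr1 sgU1i /sg big1 // => k /imsetP[j _ ->].
by rewrite ltnNge ltnW // (sinc ord0 (lift ord0 j)).
Qed.

Lemma fam_sum_delta w : w = \sum_A w A *: set_delta A.
Proof.
apply/funext => B; rewrite fct_sumE (bigD1 B) //= !fctE /set_delta eqxx.
rewrite [_ *: _]mulr1 big1 ?addr0 // => A AB.
by rewrite !fctE eq_sym (negbTE AB) scaler0.
Qed.

(** The sign of the shuffle sorting A followed by B: one factor -1 for each pair of an element of A
    and a smaller element of B. *)
Definition sgn A B : K := \prod_(i in A) sg i B.
Definition wdg w h : fam := fun C =>
  \sum_(A : {set I} | A \subset C) sgn A (C :\: A) * w A * h (C :\: A).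

Fact wdg_linearl h : linear (wdg^~ h).
Proof.
move=> c w w'; apply/funext => C; rewrite /wdg !fctE scaler_sumr -big_split.
by apply: eq_bigr => A _ /=; rewrite ?fctE /GRing.scale /=; ring.
Qed.

Lemma sg_setU (i : I) A B : [disjoint A & B] -> sg i (A :|: B) = sg i A * sg i B.
Proof. by move=> AB; rewrite /sg -bigU //; apply: eq_bigl => j; rewrite !inE. Qed.

Lemma ext1_wdg (i : I) w h : ext1 i (wdg w h) = wdg (ext1 i w) h.
Proof.
apply/funext => C; rewrite /wdg /ext1; case: ifP => iC; last first.
  rewrite big1 // => A AC; rewrite ifN ?mulr0 ?mul0r //.
  by apply: contraFN iC; apply: (fintype.subsetP AC).
rewrite [RHS](bigID (fun A : {set I} => i \in A)) /= [X in _ = _ + X]big1 ?addr0; last first.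
  by move=> A /andP[_ /negbTE ->]; rewrite mulr0 mul0r.
rewrite [RHS](reindex_onto (fun A => i |: A) (fun A => A :\ i)) /=; last first.
  by move=> A /andP[_ iA]; rewrite setD1K.
rewrite mulr_sumr; apply: eq_big => [A|A AC].
  rewrite subUset sub1set iC setU11 andbT /=.
  apply/idP/andP => [/subsetD1P[AC iA]|[AC /eqP e]].
    by split=> //; rewrite setU1K.
  by rewrite subsetD1 AC -e setD11.
have /subsetD1P[AC' iA] := AC.
rewrite setU11 setU1K // -setDDl; set B := _ :\: A.
rewrite /sgn big_setU1 //= sgU1i.
have -> : sg i C = sg i A * sg i B.
  rewrite -(sgD1i i C) -sg_setU; first by congr sg; rewrite /B -{1}(setIidPr AC) setID.
  by rewrite -setI_eq0 /B setDE setICA setICr setI0.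
ring.
Qed.

Lemma ext_wdg b w h : ext b (wdg w h) = wdg (ext b w) h.
Proof.
rewrite /ext -[RHS]/((wdg^~ h) (\sum_i b i *: ext1 i w)).
pose L := GRing.isLinear.Build K fam fam *:%R (wdg^~ h) (wdg_linearl h).
pose f : {linear fam -> fam} := HB.pack (wdg^~ h) L.
rewrite -[RHS]/(f _) linear_sum; apply: eq_bigr => i _.
by rewrite linearZ /= ext1_wdg.
Qed.

Lemma wdg_delta0 h : wdg delta0 h = h.
Proof.
apply/funext => C; rewrite /wdg (bigD1 set0) ?sub0set //= big1 ?addr0 => [|A /andP[_ A0]].
  by rewrite /sgn big_set0 /delta0 eqxx !mul1r setD0.
by rewrite /delta0 (negbTE A0) mulr0 mul0r.
Qed.

Definition stack (T : Type) k l (g : 'I_k -> T) (g' : 'I_l -> T) (i : 'I_(k + l)) : T :=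
  match fintype.split i with inl a => g a | inr b => g' b end.

Lemma stack_lshift T k l (g : 'I_k -> T) (g' : 'I_l -> T) i :
  stack g g' (lshift l i) = g i.
Proof. by rewrite /stack (unsplitK (inl i : 'I_k + 'I_l)%type). Qed.

Lemma stack_rshift T k l (g : 'I_k -> T) (g' : 'I_l -> T) i :
  stack g g' (rshift k i) = g' i.
Proof. by rewrite /stack (unsplitK (inr i : 'I_k + 'I_l)%type). Qed.

Lemma extprod_stack k l (g : 'I_k -> I -> K) (g' : 'I_l -> I -> K) :
  extprod (stack g g') = wdg (extprod g) (extprod g').
Proof.
elim: k g => [|k IH] g.
  rewrite /extprod -/extprod wdg_delta0; congr extprod; apply/funext => i.
  by rewrite -[RHS](stack_rshift g); congr stack; apply: val_inj.
rewrite [extprod g]extprodS -ext_wdg -IH.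
have gE : g ord0 = stack g g' ord0 by rewrite -(stack_lshift g g'); congr stack; apply: val_inj.
rewrite gE -[LHS]/(@extprod (k + l).+1 (stack g g')) extprodS.
congr (ext _ (extprod _)); apply/funext => i; rewrite -(splitK i).
case: (fintype.split i) => j /=.
  by rewrite stack_lshift -(stack_lshift g g'); congr stack; apply: val_inj.
by rewrite stack_rshift -(stack_rshift g g'); congr stack; apply: val_inj.
Qed.

(* top w h is the coefficient of maximal degree of w /\ h, and star t is the
   Hodge star for the metric that makes the e_i orthogonal with |e_i|^2 = t_i. *)
Definition eps A : K := sgn A (~: A).
Definition top w h : K := \sum_A eps A * w A * h (~: A).
Definition star (t : I -> K) w : fam := fun A =>
  eps A * \prod_(i in ~: A) t i * w (~: A).

Lemma wdg_setT w h : wdg w h [set: I]%SET = top w h.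
Proof.
by rewrite /wdg /top; apply: eq_big => [A|A _]; rewrite ?subsetT // setTD.
Qed.

Lemma eps2 A : eps A * eps A = 1.
Proof. by rewrite -big_split big1 // => i _; apply: sg2. Qed.

(** When i moves from the complement into A, its comparisons with A reverse direction. Since (-1)^(i
    < j) = - (-1)^(j < i), each element of A contributes an additional sign, whence (-1)^|A|. *)
Lemma epsU1 (i : I) A : i \notin A ->
  eps (i |: A) = (-1) ^+ #|A| * eps A * sg i A * sg i (~: A).
Proof.
move=> iA; rewrite /eps /sgn big_setU1 //=.
set X := \prod_(j in A) _.
have CE : ~: A = i |: ~: (i |: A).
  by apply/setP => j; rewrite !inE; case: eqVneq => [->|]; rewrite ?iA.
have -> : \prod_(j in A) sg j (~: A) = (-1) ^+ #|A| * sg i A * X.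
  rewrite -prodr_const /sg -2!big_split; apply: eq_bigr => j jA /=.
  rewrite CE big_setU1 /=; last by rewrite !inE eqxx.
  congr (_ * _); have ij : i != j by apply: contraNneq iA => ->.
  by rewrite (ltn_sign ij) mulN1r.
have sE : sg i (~: A) = sg i (~: (i |: A)) by rewrite CE sgU1i.
rewrite sE; set n := (-1) ^+ _; set S := sg i (~: _); set s := sg i A.
have -> : n * (n * s * X) * s * S = (n * n) * (s * s) * (S * X) by ring.
by rewrite sg2 -expr2 sqrr_sign !mul1r.
Qed.

Lemma top_ext1 (i : I) w h :
  top (ext1 i w) h = \sum_(A : {set I}) (-1) ^+ #|A| * eps A * w A * ext1 i h (~: A).
Proof.
rewrite /top (bigID (fun A : {set I} => i \in A)) /= [X in _ + X]big1 ?addr0; last first.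
  by move=> A /negbTE iA; rewrite /ext1 iA mulr0 mul0r.
rewrite [RHS](bigID (fun A : {set I} => i \in A)) /= [X in _ = X + _]big1 ?add0r; last first.
  by move=> A iA; rewrite /ext1 inE iA mulr0.
rewrite (reindex_onto (fun A => i |: A) (fun A => A :\ i)) /=; last first.
  by move=> A iA; rewrite setD1K.
apply: eq_big => [A|A /andP[_ /eqP e]].
  rewrite setU11 /=; apply/eqP/idP => [<-|iA]; last by rewrite setU1K.
  by rewrite setD11.
have iA : i \notin A by rewrite -e setD11.
rewrite /ext1 setU11 setU1K // inE iA sgU1i epsU1 //.
have -> : ~: (i |: A) = ~: A :\ i by rewrite setCU setDE setIC.
have -> : (-1) ^+ #|A| * eps A * sg i A * sg i (~: A) * (sg i A * w A) * h (~: A :\ i) =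
  (sg i A * sg i A) * ((-1) ^+ #|A| * eps A * w A * (sg i (~: A) * h (~: A :\ i))) by ring.
by rewrite sg2 mul1r.
Qed.

(** The covector b is carried across the k factors of w; this is how S /\ _ passes from one side of
    the pairing to the other. *)
Lemma top_ext b w h k : homog k w ->
  top (ext b w) h = (-1) ^+ k * top w (ext b h).
Proof.
move=> wk; rewrite /top mulr_sumr.
under eq_bigr do rewrite /ext fct_sumE mulr_sumr mulr_suml.
rewrite exchange_big /=.
under [RHS]eq_bigr do rewrite /ext fct_sumE mulr_sumr mulr_sumr.
rewrite [RHS]exchange_big; apply: eq_bigr => i _ /=.
transitivity (b i * top (ext1 i w) h).
  by rewrite /top mulr_sumr; apply: eq_bigr => A _; rewrite !fctE /GRing.scale /=; ring.
rewrite top_ext1 mulr_sumr; apply: eq_bigr => A _.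
rewrite !fctE /GRing.scale /=.
by have [<-|Ak] := eqVneq #|A| k; [ring|rewrite wk //; ring].
Qed.

(** The signs [eps] cancel in pairs, so the pairing with a star is diagonal. With h the conjugate of
    q and t in the open orthant it is positive definite. *)
Lemma top_star t q h : top (star t q) h = \sum_(B : {set I}) (\prod_(i in B) t i) * (q B * h B).
Proof.
rewrite /top (reindex_inj (@setC_inj _)); apply: eq_bigr => B _ /=.
rewrite /star setCK.
transitivity ((eps (~: B) * eps (~: B)) * (\prod_(i in B) t i * (q B * h B))); first by ring.
by rewrite eps2 mul1r.
Qed.

Lemma homog_star t q k l : (k + l)%N = M -> homog l q -> homog k (star t q).
Proof.
move=> klM ql A Ak; rewrite /star ql ?mulr0 //.
have := cardsC A; rewrite card_ord => e.
by apply: contra Ak => /eqP cl; rewrite cl in e; rewrite -(eqn_add2r l) e klM.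
Qed.

(** Removing i from A adds i to the complement and so a factor t_i to the weight of the star; this
    factor is the coefficient with which kappa contracts by e_i. *)
Lemma ext_star t q A :
  (-1) ^+ #|A| * ext (fun=> 1) (star t q) A = - star t (ctr t q) A.
Proof.
rewrite /ext /star /ctr !fct_sumE !mulr_sumr -sumrN; apply: eq_bigr => i _.
rewrite !fctE /GRing.scale /= mul1r /ext1 /ctr1 inE.
have [iA|iA] := boolP (i \in A); last by rewrite !mulr0 oppr0.
have iB : i \notin A :\ i by rewrite setD11.
have e : eps A = (-1) ^+ #|A :\ i| * eps (A :\ i) * sg i A * sg i (~: A).
  rewrite -[in LHS](setD1K iA) epsU1 // sgD1i; congr (_ * _).
  have -> : ~: (A :\ i) = i |: ~: A by rewrite setCD setUC.
  by rewrite sgU1i.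
have -> : ~: (A :\ i) = i |: ~: A by rewrite setCD setUC.
rewrite big_setU1 ?inE ?iA //= (cardsD1 i A) iA exprS mulN1r e.
set n := (-1) ^+ _; set s := sg i A; set s' := sg i (~: A).
set T := \prod_(j in _) _.
transitivity (- (n * eps (A :\ i) * s * (t i * T) * q (i |: ~: A))); first by ring.
congr (- _); transitivity ((s' * s') * (n * eps (A :\ i) * s * (t i * T) * q (i |: ~: A))).
  by rewrite sg2 mul1r.
ring.
Qed.

Lemma ctr_star t q A :
  ctr t (star t q) A = (-1) ^+ #|A| * star t (ext (fun=> 1) q) A.
Proof.
rewrite /ext /star /ctr !fct_sumE !mulr_sumr; apply: eq_bigr => i _.
rewrite !fctE /GRing.scale /= mul1r /ext1 /ctr1 inE.
have [iA|iA] := boolP (i \in A); first by rewrite !mulr0.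
rewrite epsU1 //.
have -> : ~: (i |: A) = ~: A :\ i by rewrite setCU setDE setIC.
rewrite [in RHS](big_setD1 i) ?inE //=.
set T := \prod_(j in _) _.
transitivity ((sg i A * sg i A) * ((-1) ^+ #|A| * eps A * sg i (~: A) * (t i * T) * q (~: A :\ i))).
  ring.
rewrite sg2 mul1r; ring.
Qed.

Lemma map_sg (f : {rmorphism K -> K}) (i : I) A : f (sg i A) = sg i A.
Proof. by rewrite rmorph_prod; apply: eq_bigr => j _; rewrite rmorph_sign. Qed.

Lemma map_ctr (f : {rmorphism K -> K}) a w A :
  f (ctr a w A) = ctr (f \o a) (f \o w) A.
Proof.
rewrite /ctr !fct_sumE rmorph_sum; apply: eq_bigr => i _.
rewrite !fctE /GRing.scale /= rmorphM /ctr1; congr (_ * _).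
by case: ifP; rewrite ?rmorph0 // rmorphM map_sg.
Qed.

Lemma map_ext (f : {rmorphism K -> K}) b w A :
  f (ext b w A) = ext (f \o b) (f \o w) A.
Proof.
rewrite /ext !fct_sumE rmorph_sum; apply: eq_bigr => i _.
rewrite !fctE /GRing.scale /= rmorphM /ext1; congr (_ * _).
by case: ifP; rewrite ?rmorph0 // rmorphM map_sg.
Qed.

End Exterior.

(** * Wedge products as sums over permutations *)

Section BlockPerm.
Variables (k l : nat).

Definition same_block (i j : 'I_(k + l)) := (i < k)%N == (j < k)%N.

Definition block_perm_fun (pq : 'S_k * 'S_l) : 'I_(k + l) -> 'I_(k + l) :=
  stack (fun i => lshift l (pq.1 i)) (fun j => rshift k (pq.2 j)).

Lemma block_perm_inj pq : injective (block_perm_fun pq).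
Proof.
move=> i j; rewrite /block_perm_fun -(splitK i) -(splitK j).
case: (fintype.split i) => a; case: (fintype.split j) => b /=;
  rewrite ?stack_lshift ?stack_rshift.
- by move/lshift_inj/perm_inj ->.
- by move/eqP; rewrite eq_lrshift.
- by move/eqP; rewrite eq_rlshift.
- by move/rshift_inj/perm_inj ->.
Qed.

Definition block_perm pq := perm (@block_perm_inj pq).

(** The permutations preserving both blocks form S_k x S_l; their number is the normalising factor
    of [form_wedge]. *)
Lemma card_block_perm :
  #|[set s : 'S_(k + l) | [forall i, same_block i (s i)]]| = (k`! * l`!)%N.
Proof.
rewrite -(card_Sn k) -(card_Sn l) -card_prod.
have inj : injective block_perm.
  move=> [p q] [p' q'] /permP e; congr (_, _); apply/permP => i.
    by have := e (lshift l i); rewrite !permE /block_perm_fun !stack_lshift => /lshift_inj.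
  by have := e (rshift k i); rewrite !permE /block_perm_fun !stack_rshift => /rshift_inj.
rewrite -(card_imset _ inj); congr #|pred_of_set _|; apply/setP => s; rewrite inE.
apply/forallP/imsetP => [sb|[[p q] _ ->] i]; last first.
  rewrite /same_block permE /block_perm_fun -(splitK i).
  case: (fintype.split i) => a /=; rewrite ?stack_lshift ?stack_rshift /=.
    by rewrite !ltn_ord.
  by rewrite !ltnNge !leq_addr.
have sl i : exists a, s (lshift l i) = lshift l a.
  have := sb (lshift l i); rewrite /same_block /= ltn_ord eq_sym eqb_id.
  rewrite -{1}(splitK (s _)); case: (fintype.split _) (splitK (s (lshift l i))) => a /= <- h.
    by exists a.
  by rewrite ltnNge leq_addr in h.
have sr j : exists b, s (rshift k j) = rshift k b.
  have := sb (rshift k j); rewrite /same_block /= [X in X == _]ltnNge leq_addr /=.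
  rewrite -{1}(splitK (s _)); case: (fintype.split _) (splitK (s (rshift k j))) => a /= <- h.
    by rewrite ltn_ord in h.
  by exists a.
have [p Hp] := choice sl; have [q Hq] := choice sr.
have p_inj : injective p.
  by move=> i j e; apply/(@lshift_inj k l)/(@perm_inj _ s); rewrite !Hp e.
have q_inj : injective q.
  by move=> i j e; apply/(@rshift_inj k l)/(@perm_inj _ s); rewrite !Hq e.
exists (perm p_inj, perm q_inj) => //; apply/permP => i.
rewrite permE /block_perm_fun -(splitK i); case: (fintype.split i) => a /=.
  by rewrite stack_lshift permE Hp.
by rewrite stack_rshift permE Hq.
Qed.

End BlockPerm.

Section DetWedge.
Variables (K : numFieldType) (k l : nat) (m : 'I_(k + l) -> 'I_(k + l) -> K).

(** A product of two complementary minors is the determinant of a block diagonal matrix. In its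
    Leibniz expansion only block preserving permutations survive, and each of these yields one copy
    of the full determinant. *)
Lemma sum_det_blocks :
  \sum_(s : 'S_(k + l)) (-1) ^+ s *
    (\det (\matrix_(i, j) m (lshift l i) (s (lshift l j))) *
     \det (\matrix_(i, j) m (rshift k i) (s (rshift k j)))) =
  (k`! * l`!)%:R * \det (\matrix_(i, j) m i j).
Proof.
pose b (s : 'S_(k + l)) := \matrix_(i < k + l, j < k + l)
  if same_block i j then m i (s j) else 0.
transitivity (\sum_(s : 'S_(k + l)) (-1) ^+ s * \det (b s)).
  apply: eq_bigr => s _; congr (_ * _).
  have -> : b s = block_mx (\matrix_(i, j) m (lshift l i) (s (lshift l j))) 0 0
     (\matrix_(i, j) m (rshift k i) (s (rshift k j))).
    apply/matrixP => i j; rewrite -(splitK i) -(splitK j).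
    case: (fintype.split i) => i'; case: (fintype.split j) => j' /=.
    - by rewrite block_mxEul !mxE /same_block /= !ltn_ord.
    - by rewrite block_mxEur !mxE /same_block /= ltn_ord ltnNge leq_addr.
    - by rewrite block_mxEdl !mxE /same_block /= ltn_ord ltnNge leq_addr.
    - by rewrite block_mxEdr !mxE /same_block /= !ltnNge !leq_addr.
  by rewrite det_ublock.
rewrite /determinant.
under eq_bigr do rewrite mulr_sumr; rewrite exchange_big /=.
pose P (s : 'S_(k + l)) := [forall i, same_block i (s i)].
rewrite (bigID P) /= [X in _ + X]big1 ?addr0 => [|s /forallPn[i ni]]; last first.
  by apply: big1 => s' _; rewrite (bigD1 i) //= mxE (negbTE ni) mul0r !mulr0.
rewrite -card_block_perm -sumr_const mulr_suml; under [RHS]eq_bigl do rewrite inE.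
apply: eq_bigr => s /forallP Ps; rewrite mul1r.
(* For fixed s the product of s and s' runs over all permutations, which turns the inner sum into
   the full determinant. *)
rewrite [RHS](reindex_inj (mulgI s)) /=; apply: eq_bigr => s' _.
rewrite odd_permM signr_addb mulrA [_ * (-1) ^+ s]mulrC; congr (_ * _).
by apply: eq_bigr => i _; rewrite !mxE Ps permM.
Qed.

End DetWedge.

Section EvWedge.
Variables (K : numFieldType) (M : nat).
Local Notation I := 'I_M.
Local Notation fam := ({set I} -> K^o).
Implicit Types (w h : fam) (A B : {set I}).

Lemma set_increasing_enum l A : #|A| = l -> exists2 s : 'I_l -> I,
  forall i j : 'I_l, (i < j)%N -> (s i < s j)%N & A = [set s j | j in 'I_l].
Proof.
move=> Al; pose s (j : 'I_l) := enum_val (cast_ord (esym Al) j).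
have sinc (i j : 'I_l) : (i < j)%N -> (s i < s j)%N.
  move=> ij; have srt : sorted ltn (map val (enum A)).
    have -> : enum A = [seq i <- enum I | i \in A] by rewrite enumT.
    rewrite sorted_map.
    apply: sorted_filter; first by move=> ? ? ?; exact: ltn_trans.
    by rewrite -sorted_map val_enum_ord iota_ltn_sorted.
  have sE (a : 'I_l) : nth 0%N (map val (enum A)) a = s a.
    rewrite (nth_map (s a)) ?[X in (_ < X)%N]size_enum -?cardE ?Al ?ltn_ord //.
    by rewrite [in RHS]/s (enum_val_nth (s a)).
  rewrite -!sE; apply: (sorted_ltn_nth ltn_trans) => //;
    by rewrite inE size_map -cardE Al ltn_ord.
exists s => //; apply/setP => i; apply/idP/imsetP => [iA|[j _ ->]]; last exact: enum_valP.
exists (cast_ord Al (enum_rank_in iA i)) => //.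
by rewrite /s cast_ordK enum_rankK_in.
Qed.

Lemma set_delta_extprod l A : #|A| = l -> exists2 s : 'I_l -> I,
  forall i j : 'I_l, (i < j)%N -> (s i < s j)%N &
  set_delta K A = extprod (fun j => ebasis K (s j)).
Proof.
by move=> /set_increasing_enum[s sinc ->]; exists s => //; rewrite extprod_ebasis.
Qed.

(** The formula of [form_wedge], applied to values of coefficient families. *)
Definition alt_prod k l (u : 'I_(k + l) -> I -> K) w h : K :=
  (k`! * l`!)%:R^-1 * \sum_(s : 'S_(k + l)) (-1) ^+ s *
    (ev (fun i => u (s (lshift l i))) w * ev (fun j => u (s (rshift k j))) h).

Lemma alt_prod_extprod k l (u : 'I_(k + l) -> I -> K) (g : 'I_k -> I -> K)
    (g' : 'I_l -> I -> K) :
  alt_prod u (extprod g) (extprod g') = ev u (extprod (stack g g')).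
Proof.
have f0 : (k`! * l`!)%:R != 0 :> K by rewrite pnatr_eq0 -lt0n muln_gt0 !fact_gt0.
apply: (mulfI f0); rewrite /alt_prod mulVKf // -det_ev -sum_det_blocks.
apply: eq_bigr => s _; congr (_ * (_ * _)); rewrite -det_ev; congr (\det _);
  by apply/matrixP => i j; rewrite !mxE ?stack_lshift ?stack_rshift.
Qed.

Lemma alt_prod_suml (J : finType) k l (u : 'I_(k + l) -> I -> K) (c : J -> K)
    (F : J -> fam) h :
  alt_prod u (\sum_j c j *: F j) h = \sum_j c j * alt_prod u (F j) h.
Proof.
rewrite /alt_prod; move: (_%:R^-1) => z; rewrite mulr_sumr.
under eq_bigr => s _ do rewrite linear_sum mulr_suml !mulr_sumr.
rewrite exchange_big /=; apply: eq_bigr => j _.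
rewrite !mulr_sumr; apply: eq_bigr => s _; rewrite linearZ /= -!mulrA.
by rewrite [RHS]mulrCA; congr (_ * _); rewrite mulrCA.
Qed.

Lemma alt_prod_sumr (J : finType) k l (u : 'I_(k + l) -> I -> K) (c : J -> K)
    (F : J -> fam) w :
  alt_prod u w (\sum_j c j *: F j) = \sum_j c j * alt_prod u w (F j).
Proof.
rewrite /alt_prod; move: (_%:R^-1) => z; rewrite mulr_sumr.
under eq_bigr => s _ do rewrite linear_sum !mulr_sumr.
rewrite exchange_big /=; apply: eq_bigr => j _.
rewrite !mulr_sumr; apply: eq_bigr => s _; rewrite linearZ /=.
by rewrite [RHS]mulrCA; congr (_ * _); rewrite [RHS]mulrCA; congr (_ * _); rewrite mulrCA.
Qed.

Lemma wdg_suml (J : finType) (c : J -> K) (F : J -> fam) h :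
  wdg (\sum_j c j *: F j) h = \sum_j c j *: wdg (F j) h.
Proof.
apply/funext => A; rewrite /wdg !fct_sumE.
under eq_bigr do rewrite mulr_sumr mulr_suml.
rewrite exchange_big /=; apply: eq_bigr => j _; rewrite !fctE /GRing.scale /= mulr_sumr.
by apply: eq_bigr => B _; rewrite ?fctE /GRing.scale /=; ring.
Qed.

Lemma wdg_sumr (J : finType) (c : J -> K) (F : J -> fam) w :
  wdg w (\sum_j c j *: F j) = \sum_j c j *: wdg w (F j).
Proof.
apply/funext => A; rewrite /wdg !fct_sumE.
under eq_bigr do rewrite mulr_sumr.
rewrite exchange_big /=; apply: eq_bigr => j _; rewrite !fctE /GRing.scale /= mulr_sumr.
by apply: eq_bigr => B _; rewrite ?fctE /GRing.scale /=; ring.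
Qed.

Lemma ctr_sum (J : finType) (c : J -> K) (F : J -> fam) a :
  ctr a (\sum_j c j *: F j) = \sum_j c j *: ctr a (F j).
Proof.
by rewrite (linear_sum (ctr a)); apply: eq_bigr => j _; rewrite linearZ.
Qed.

(** By bilinearity both factors may be taken to be products of basis covectors, where the identity
    is [sum_det_blocks]. *)
Lemma ev_wdg k l (u : 'I_(k + l) -> I -> K) w h : homog k w -> homog l h ->
  alt_prod u w h = ev u (wdg w h).
Proof.
move=> wk hl; rewrite (fam_sum_delta w) (fam_sum_delta h).
rewrite alt_prod_suml wdg_suml linear_sum; apply: eq_bigr => A _.
rewrite linearZ /=; have [Ak|Ak] := eqVneq #|A| k; last by rewrite wk // !mul0r.
congr (_ * _); rewrite alt_prod_sumr wdg_sumr linear_sum; apply: eq_bigr => B _.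
rewrite linearZ /=; have [Bl|Bl] := eqVneq #|B| l; last by rewrite hl // !mul0r.
congr (_ * _).
have [s _ ->] := set_delta_extprod Ak; have [s' _ ->] := set_delta_extprod Bl.
by rewrite alt_prod_extprod extprod_stack.
Qed.

End EvWedge.

(** * Homogeneous polynomial coefficients: Euler's identity, divisibility, Koszul exactness *)

Section Homogeneous.
Variables (R : realType) (M : nat).
Local Notation C := R[i].
Local Notation I := 'I_M.
Implicit Types (t v : I -> R) (s : int) (f g : (I -> R) -> C).

(* For s < 0, only the zero function satisfies hom s. *)
Inductive hom : int -> ((I -> R) -> C) -> Prop :=
| hom_cst c : hom 0 (fun=> c)
| hom0 s : hom s (fun=> 0)
| homX s i f : hom s f -> hom (s + 1) (fun t => (t i)%:C%C * f t)
| homD s f g : hom s f -> hom s g -> hom s (fun t => f t + g t).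

Lemma eq_hom s f g : hom s f -> (forall t, f t = g t) -> hom s g.
Proof. by move=> hf fg; have <- : f = g by exact/funext. Qed.

Lemma homZ s c f : hom s f -> hom s (fun t => c * f t).
Proof.
elim=> [c'|s'|s' i g _ IH|s' g h _ IHg _ IHh]; first exact: hom_cst.
- by apply: eq_hom (hom0 s') _ => t; rewrite mulr0.
- by apply: eq_hom (homX i IH) _ => t; ring.
- by apply: eq_hom (homD IHg IHh) _ => t; ring.
Qed.

Lemma homN s f : hom s f -> hom s (fun t => - f t).
Proof. by move=> /(homZ (-1)) h; apply: eq_hom h _ => t; rewrite mulN1r. Qed.

Lemma hom_sum (J : Type) (r : seq J) (P : pred J) s (F : J -> (I -> R) -> C) :
  (forall j, P j -> hom s (F j)) -> hom s (fun t => \sum_(j <- r | P j) F j t).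
Proof.
move=> hF; elim: r => [|j r IH].
  by apply: eq_hom (hom0 s) _ => t; rewrite big_nil.
have [Pj|Pj] := boolP (P j).
  by apply: eq_hom (homD (hF j Pj) IH) _ => t; rewrite big_cons Pj.
by apply: eq_hom IH _ => t; rewrite big_cons (negbTE Pj).
Qed.

Lemma hom_neg s f : hom s f -> s < 0 -> forall t, f t = 0.
Proof.
elim=> [c|s'|s' i g _ IH|s' g h _ IHg _ IHh] // s0 t; rewrite ?IH ?mulr0 //; first by lia.
by rewrite IHg // IHh // addr0.
Qed.

Lemma hom_conj s f : hom s f -> hom s (fun t => (f t)^*%C).
Proof.
elim=> [c'|s'|s' i g _ IH|s' g h _ IHg _ IHh]; first exact: hom_cst.
- by apply: eq_hom (hom0 s') _ => t; rewrite conjc0.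
- by apply: eq_hom (homX i IH) _ => t; rewrite rmorphM /= oppr0.
- by apply: eq_hom (homD IHg IHh) _ => t; rewrite rmorphD.
Qed.

Lemma homXs (r : seq I) s f :
  hom s f -> hom (s + (size r)%:Z) (fun t => \prod_(i <- r) (t i)%:C%C * f t).
Proof.
move=> hf; elim: r => [|i r IH].
  by rewrite addr0; apply: eq_hom hf _ => t; rewrite big_nil mul1r.
have -> : s + (size (i :: r))%:Z = s + (size r)%:Z + 1 by rewrite /=; lia.
by apply: eq_hom (homX i IH) _ => t; rewrite big_cons mulrA.
Qed.

Lemma hom_prod (B : {set I}) s f :
  hom s f -> hom (s + #|B|%:Z) (fun t => \prod_(i in B) (t i)%:C%C * f t).
Proof.
rewrite cardE => /(homXs (enum B)) h; apply: eq_hom h _ => t.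
by rewrite big_enum.
Qed.

Lemma hom_homogeneous (n : nat) f c t :
  hom n f -> f (fun i => c * t i) = c%:C%C ^+ n * f t.
Proof.
move=> hf; have [s sn hs] : exists2 s, s = n%:Z & hom s f by exists n.
elim: hs n sn {hf} => {s f} [c'|s|s i g hg IH|s g h _ IHg _ IHh] n sn.
- by case: sn => <-; rewrite expr0 mul1r.
- by rewrite mulr0.
- case: n sn => [|n] sn; last by rewrite (IH n) ?exprS ?rmorphM; [ring|lia].
  by rewrite !(hom_neg hg) ?mulr0 //; lia.
- by rewrite (IHg n) // (IHh n) // mulrDr.
Qed.

Lemma hom_line s f t v :
  hom s f -> exists p : {poly C}, forall x : R, f (fun i => t i + x * v i) = p.[x%:C%C].
Proof.
elim=> [c'|s'|s' i g _ [p IH]|s' g h _ [p IHg] _ [q IHh]].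
- by exists c'%:P => x; rewrite hornerC.
- by exists 0 => x; rewrite hornerC.
- exists (((t i)%:C%C%:P + (v i)%:C%C%:P * 'X) * p) => x.
  by rewrite !hornerE -IH rmorphD rmorphM [_ * (v i)%:C%C]mulrC.
- by exists (p + q) => x; rewrite IHg IHh hornerD.
Qed.

Lemma poly_eq0_pos (p : {poly C}) : (forall x : R, 0 < x -> p.[x%:C%C] = 0) -> p = 0.
Proof.
move=> p0; apply/eqP; apply: contraT => pn0.
pose rs := [seq (j.+1)%:R : C | j <- iota 0 (size p)].
have /(max_poly_roots pn0) : all (root p) rs.
  apply/allP => _ /mapP[j _ ->]; rewrite /root; apply/eqP.
  by rewrite -(p0 j.+1%:R) ?ltr0Sn // rmorph_nat.
rewrite size_map size_iota ltnn => -> //.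
by rewrite map_inj_uniq ?iota_uniq // => a b /eqP; rewrite eqr_nat eqSS => /eqP.
Qed.

Definition line t (i : I) (x : R) : I -> R := fun j => t j + x * (i == j)%:R.

(** Euler's identity with its partial derivatives. As [hom] is a predicate on functions, a
    derivative is tied to f through coordinate lines, on which f is a polynomial in one variable. *)
Lemma hom_grad s f : hom s f ->
  exists f' : I -> (I -> R) -> C,
  [/\ forall i, hom (s - 1) (f' i),
      forall t, \sum_i (t i)%:C%C * f' i t = s%:~R * f t
    & forall t i, exists2 p : {poly C},
        forall x : R, f (line t i x) = p.[x%:C%C] & p^`().[0] = f' i t].
Proof.
elim=> [c|s'|s' i g hg [g' [hg' Eg Dg]]|s' g h _ [g' [hg' Eg Dg]] _ [h' [hh' Eh Dh]]].
- exists (fun _ _ => 0); split=> [i|t|t i]; first exact: hom0.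
    by rewrite big1 ?mul0r // => i _; rewrite mulr0.
  by exists c%:P => [x|]; rewrite ?derivC hornerC.
- exists (fun _ _ => 0); split=> [i|t|t i]; first exact: hom0.
    by rewrite big1 ?mulr0 // => i _; rewrite mulr0.
  by exists 0 => [x|]; rewrite ?deriv0 hornerC.
- exists (fun j t => (i == j)%:R * g t + (t i)%:C%C * g' j t); split=> [j|t|t j].
  + have -> : s' + 1 - 1 = (s' - 1) + 1 by lia.
    apply: homD; last exact: homX.
    by rewrite subrK; apply: homZ.
  + under eq_bigr do rewrite mulrDr; rewrite big_split /=.
    rewrite (bigD1 i) //= eqxx mul1r big1 ?addr0 => [|j ji]; last first.
      by rewrite eq_sym (negbTE ji) mul0r mulr0.
    have -> : \sum_j (t j)%:C%C * ((t i)%:C%C * g' j t) = (t i)%:C%C * (s'%:~R * g t).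
      by rewrite -Eg mulr_sumr; apply: eq_bigr => j _; ring.
    by rewrite intrD; ring.
  + have [p pE p'E] := Dg t j.
    exists (((t i)%:C%C%:P + (j == i)%:R%:P * 'X) * p) => [x|].
      rewrite !hornerE -pE /line rmorphD rmorphM rmorph_nat [_ * (j == i)%:R]mulrC.
      by [].
    rewrite derivM derivD derivC derivM derivC derivX !hornerE -p'E.
    have -> : g t = p.[0].
      rewrite -[0](rmorph0 (real_complex R)) -pE; congr g; apply/funext => k.
      by rewrite /line mul0r addr0.
    by rewrite eq_sym; ring.
- exists (fun j t => g' j t + h' j t); split=> [j|t|t j]; first exact: homD.
    by under eq_bigr do rewrite mulrDr; rewrite big_split /= Eg Eh mulrDr.
  have [p pE p'E] := Dg t j; have [q qE q'E] := Dh t j.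
  by exists (p + q) => [x|]; rewrite ?derivD hornerD ?pE ?qE ?p'E ?q'E.
Qed.

Definition restr0 (i : I) t : I -> R := fun j => if j == i then 0 else t j.

Lemma hom_div1 s f i : hom s f ->
  exists2 g, hom (s - 1) g & forall t, f t = f (restr0 i t) + (t i)%:C%C * g t.
Proof.
elim=> [c|s'|s' j g hg [g' hg' Eg]|s' g h _ [g' hg' Eg] _ [h' hh' Eh]].
- by exists (fun=> 0) => [|t]; rewrite ?mulr0 ?addr0 //; exact: hom0.
- by exists (fun=> 0) => [|t]; rewrite ?mulr0 ?addr0 //; exact: hom0.
- have [<-|ji] := eqVneq j i.
    by exists g => [|t]; rewrite ?addrK // /restr0 eqxx mul0r add0r.
  exists (fun t => (t j)%:C%C * g' t) => [|t].
    by rewrite addrAC; exact: homX.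
  by rewrite /restr0 (negbTE ji) -/(restr0 i t) {1}Eg; ring.
- by exists (fun t => g' t + h' t) => [|t]; [exact: homD|rewrite {1}Eg {1}Eh; ring].
Qed.

(** The coordinates in B are divided off one at a time; the factorisation is claimed on the closed
    orthant only, where f is known to vanish. *)
Lemma hom_div (B : {set I}) s f : hom s f ->
  (forall t i, (forall j, 0 <= t j) -> i \in B -> t i = 0 -> f t = 0) ->
  exists2 g, hom (s - #|B|%:Z) g &
    forall t, (forall j, 0 <= t j) -> f t = \prod_(i in B) (t i)%:C%C * g t.
Proof.
move=> hf; have [n] := ubnP #|B|; elim: n B => // n IH B Bn fB.
have [->|[i iB]] := set_0Vmem B.
  by exists f => [|t _]; rewrite ?cards0 ?subr0 // big_set0 mul1r.
have [|t j t0 /setD1P[_ jB]|g hg gE] := IH (B :\ i); first by move: Bn; rewrite (cardsD1 i B) iB.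
  exact: fB.
have [g' hg' Eg] := hom_div1 i hg.
exists g' => [|t t0].
  have -> // : s - #|B|%:Z = s - #|B :\ i|%:Z - 1.
  by rewrite (cardsD1 i B) iB; lia.
rewrite (big_setD1 i) //= gE // {1}Eg mulrDr.
(* The remainder times the product already divided off is the value of f at [restr0 i t], so nothing
   has to be cancelled where coordinates vanish. *)
suff -> : \prod_(j in B :\ i) (t j)%:C%C * g (restr0 i t) = 0 by rewrite add0r; ring.
have r0 j : 0 <= restr0 i t j by rewrite /restr0; case: eqP.
rewrite -(fB _ _ r0 iB) ?gE //; last by rewrite /restr0 eqxx.
by congr (_ * _); apply: eq_bigr => j /setD1P[ji _]; rewrite /restr0 (negbTE ji).
Qed.

(** Scaling carries the vanishing from the facet to the cone over it. The degree is positive so that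
    f also vanishes at the origin. *)
Lemma hom_facet (n : nat) f i : hom n.+1 f ->
  (forall t, (forall j, 0 <= t j) -> \sum_j t j = 1 -> t i = 0 -> f t = 0) ->
  forall t, (forall j, 0 <= t j) -> t i = 0 -> f t = 0.
Proof.
move=> hf f0 t t0 ti; set c := \sum_j t j.
have c0 : 0 <= c by exact: sumr_ge0.
have [ce|cn] := eqVneq c 0.
  have -> : t = fun j => 0 * t j.
    apply/funext => j; rewrite mul0r; apply/eqP.
    by move/eqP: ce; rewrite psumr_eq0 // => /allP/(_ j (mem_index_enum _)).
  by rewrite (hom_homogeneous _ _ hf) rmorph0 expr0n mul0r.
have -> : t = fun j => c * (c^-1 * t j) by apply/funext => j; rewrite mulrA divff // mul1r.
rewrite (hom_homogeneous _ _ hf) f0 ?mulr0 // => [j||]; last by rewrite ti mulr0.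
  by rewrite mulr_ge0 // invr_ge0.
by rewrite -mulr_sumr mulVf.
Qed.

Lemma hom_eq0 s f : (0 < M)%N -> hom s f ->
  (forall t, (forall j, 0 < t j) -> \sum_j t j = 1 -> f t = 0) ->
  forall t, (forall j, 0 <= t j) -> f t = 0.
Proof.
move=> M0 hf f0.
have fpos t : (forall j, 0 < t j) -> f t = 0.
  move=> t0; case: s hf => n hf; last exact: (hom_neg hf).
  set c := \sum_j t j.
  have c0 : 0 < c.
    by rewrite /c (bigD1 (Ordinal M0)) //= ltr_pwDl // sumr_ge0 // => j _; exact: ltW.
  have -> : t = fun j => c * (c^-1 * t j).
    by apply/funext => j; rewrite mulrA divff ?mul1r // gt_eqF.
  rewrite (hom_homogeneous _ _ hf) f0 ?mulr0 // => [j|].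
    by rewrite mulr_gt0 // invr_gt0.
  by rewrite -mulr_sumr mulVf // gt_eqF.
(* A boundary point is reached along the direction (1, ..., 1): the line is in the open orthant for
   x > 0, so its polynomial has infinitely many roots. *)
move=> t t0; have [p pE] := hom_line t (fun=> 1) hf.
have p0 : p = 0.
  apply: poly_eq0_pos => x x0; rewrite -pE fpos // => j.
  by rewrite mulr1 ltr_wpDl.
have := pE 0; rewrite p0 horner0 => <-; congr f; apply/funext => j.
by rewrite mul0r addr0.
Qed.

Local Notation tfam := ((I -> R) -> {set I} -> C).
Implicit Types (q w : tfam) (A B : {set I}).

Definition toC t : I -> C := fun i => (t i)%:C%C.

Definition hform s (l : nat) q : Prop :=
  (forall A, hom s (fun t => q t A)) /\ (forall t, homog l (q t)).

Lemma hform_ctr s l q : hform s l.+1 q -> hform (s + 1) l (fun t => ctr (toC t) (q t)).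
Proof.
move=> [hq ql]; split=> [A|t]; last exact: homog_ctr (ql t).
rewrite /ctr; have h : hom (s + 1) (fun t => \sum_i (t i)%:C%C * (ctr1 i (q t) A)).
  apply: hom_sum => i _; apply: (@homX s); rewrite /ctr1.
  by case: (i \in A); [exact: (hom0 s)|exact: (homZ _ (hq _))].
by apply: eq_hom h _ => t; rewrite fct_sumE.
Qed.

Lemma hform_ext s l b q : hform s l q -> hform s l.+1 (fun t => ext b (q t)).
Proof.
move=> [hq ql]; split=> [A|t]; last exact: homog_ext (ql t).
rewrite /ext; have h : hom s (fun t => \sum_i b i * (ext1 i (q t) A)).
  apply: hom_sum => i _; apply: homZ; rewrite /ext1.
  by case: (i \in A); [exact: (homZ _ (hq _))|exact: hom0].
by apply: eq_hom h _ => t; rewrite fct_sumE.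
Qed.

Lemma hform_ctr1 s l i q : hform s l.+1 q -> hform s l (fun t => ctr1 i (q t)).
Proof.
move=> [hq ql]; split=> [A|t]; last exact: homog_ctr1 (ql t).
by rewrite /ctr1; case: (i \in A); [exact: hom0|exact: (homZ _ (hq _))].
Qed.

Lemma hform_conj s l q : hform s l q -> hform s l (fun t A => (q t A)^*%C).
Proof.
move=> [hq ql]; split=> [A|t A Al]; first exact: hom_conj.
by rewrite ql // conjc0.
Qed.

Lemma hformD s l q w : hform s l q -> hform s l w -> hform s l (fun t => q t + w t).
Proof.
move=> [hq ql] [hw wl]; split=> [A|t]; last exact: homogD.
exact: (homD (hq A) (hw A)).
Qed.

Lemma hformZ s l c q : hform s l q -> hform s l (fun t => c *: q t).
Proof.
move=> [hq ql]; split=> [A|t]; last exact: homogZ.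
exact: (homZ c (hq A)).
Qed.

Lemma hform0 s l : hform s l (fun=> 0).
Proof. by split=> [A|t A _ //]; exact: hom0. Qed.

Lemma hform_star s l k q : (k + l)%N = M -> hform s l q ->
  hform (s + l%:Z) k (fun t => star (toC t) (q t)).
Proof.
move=> klM [hq ql]; split=> [A|t]; last exact: homog_star (ql t).
have [Al|Al] := eqVneq #|~: A| l; last first.
  by apply: eq_hom (hom0 _) _ => t; rewrite /star ql ?mulr0.
rewrite /star -Al.
by apply: eq_hom (homZ (eps _ A) (hom_prod (~: A) (hq (~: A)))) _ => t; rewrite mulrA.
Qed.

(* d kappa + kappa d is multiplication by the total degree s + l. *)
Lemma koszul s l q : (0 < M)%N -> hform s l q -> s + l%:Z != 0 ->
  (forall t, (forall j, 0 < t j) -> ctr (toC t) (q t) = 0) ->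
  exists2 c, hform (s - 1) l.+1 c &
    forall t, (forall j, 0 <= t j) -> q t = ctr (toC t) (c t).
Proof.
move=> M0 [hq ql] sl q0.
have [D0 HD0] := choice (fun A => hom_grad (hq A)).
(* D i is the partial derivative of q in direction i; outside degree l it is set to zero outright
   instead of deriving this from the witnesses of [hom_grad]. *)
pose D i t A := if #|A| == l then D0 A i t else 0.
have hD i A : hom (s - 1) (fun t => D i t A).
  by rewrite /D; case: eqP => _; [have [] := HD0 A|exact: hom0].
have Dl i t : homog l (D i t) by move=> A /negbTE Al; rewrite /D Al.
have DE t : \sum_i (t i)%:C%C *: D i t = s%:~R *: q t.
  apply/funext => A; rewrite fct_sumE !fctE /GRing.scale /=.
  have [Al|Al] := eqVneq #|A| l; last first.
    by rewrite ql // mulr0 big1 // => i _; rewrite Dl // scaler0.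
  have [_ <- _] := HD0 A; apply: eq_bigr => i _.
  by rewrite /D Al eqxx.
have Dp t i A : exists2 p : {poly C},
    forall x : R, q (line t i x) A = p.[x%:C%C] & p^`().[0] = D i t A.
  rewrite /D; have [Al|Al] := eqVneq #|A| l; first by have [_ _] := HD0 A; apply.
  by exists 0 => [x|]; rewrite ?deriv0 horner0 // ql.
(* The derivative of kappa q = 0 in direction e_j. For x > 0 the line t + x e_j stays in the open
   orthant, so kappa q vanishes along it as a polynomial in x. *)
have Dctr t j : (forall j, 0 < t j) -> ctr (toC t) (D j t) = - ctr1 j (q t).
  move=> t0; apply/funext => A.
  have [p Hp] := choice (fun i => let: ex_intro2 p pE p'E := Dp t j (i |: A) in
    ex_intro (fun p : {poly C} => (forall x : R, q (line t j x) (i |: A) = p.[x%:C%C]) /\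
      p^`().[0] = D j t (i |: A)) p (conj pE p'E)).
  have [pE p'E] : (forall i (x : R), q (line t j x) (i |: A) = (p i).[x%:C%C]) /\
      (forall i, (p i)^`().[0] = D j t (i |: A)).
    by split=> i; have [] := Hp i.
  pose P : {poly C} := \sum_i (if i \in A then 0 else
    sg C i A *: (((t i)%:C%C%:P + (j == i)%:R%:P * 'X) * p i)).
  have P0 : P = 0.
    apply: poly_eq0_pos => x x0.
    transitivity (ctr (toC (line t j x)) (q (line t j x)) A).
      rewrite /ctr fct_sumE horner_sum; apply: eq_bigr => i _.
      rewrite !fctE /GRing.scale /= /ctr1; case: ifP => _; first by rewrite horner0 mulr0.
      rewrite !hornerE pE /toC /line rmorphD rmorphM rmorph_nat /=; ring.
    rewrite q0 // => i; rewrite /line ltr_wpDr //.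
    by rewrite mulr_ge0 ?ler0n // ltW.
  have line0 : line t j 0 = t by apply/funext => i; rewrite /line mul0r addr0.
  have : P^`().[0] = 0 by rewrite P0 deriv0 horner0.
  have -> : P^`().[0] = ctr (toC t) (D j t) A + ctr1 j (q t) A; last first.
    by move/eqP; rewrite addr_eq0 => /eqP.
  rewrite /P raddf_sum horner_sum -ebasis_ctr /ctr !fct_sumE -big_split.
  apply: eq_bigr => i _ /=; rewrite !fctE /GRing.scale /= /ctr1.
  case: ifP => _; first by rewrite deriv0 horner0 !mulr0 addr0.
  rewrite derivZ derivM derivD derivC derivM derivC derivX !hornerE p'E.
  have -> : (p i).[0] = q t (i |: A).
    by rewrite -[in RHS]line0 pE rmorph0.
  by rewrite /toC /ebasis /=; ring.
pose r : C := (s + l%:Z)%:~R.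
have rn0 : r != 0 by rewrite intr_eq0.
(* The homotopy: c is the exterior derivative of q divided by the total degree. *)
pose c t : {set I} -> C^o := r^-1 *: \sum_j ext1 j (D j t).
have hc : hform (s - 1) l.+1 c.
  split=> [A|t]; last by apply: homogZ; apply: homog_sum => i; exact: homog_ext1.
  have h : hom (s - 1) (fun t => r^-1 * \sum_j ext1 j (D j t) A).
    apply: homZ; apply: hom_sum => j _; rewrite /ext1.
    by case: (j \in A); [exact: (homZ _ (hD j _))|exact: hom0].
  by apply: eq_hom h _ => t; rewrite /c !fctE fct_sumE.
exists c => // t t0; apply/funext => A; apply/eqP; rewrite -subr_eq0; apply/eqP.
move: t t0; apply: (hom_eq0 (s := s)) => // [|t t0 _].
  apply: homD => //; apply: homN; have [h _] := hform_ctr hc.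
  by rewrite -[s](subrK 1).
rewrite /c linearZ linear_sum /=.
have -> : \sum_i ctr (toC t) (ext1 i (D i t)) = r *: q t.
  under eq_bigr do rewrite -ebasis_ext ctr_ext ebasis_pairr Dctr // linearN /= opprK ebasis_ext.
  by rewrite big_split /= DE (sum_ext1_ctr1 (ql t)) -scalerDl /r intrD.
by rewrite scalerA mulVf // scale1r subrr.
Qed.

End Homogeneous.
Arguments hom0 {R M} s.
Arguments hom_cst {R M} c.

(** * Top coefficients and the weighted Hodge star *)

Section TopEdges.
Variables (K : numFieldType).

(** The case of [ev_edges] in which all vertices occur: it identifies the integrand over a simplex
    with the top coefficient of S /\ Z. The equation on M accommodates (sdim F).+1 and (k + l).+1,
    which are not convertible. *)
Lemma ev_top_edges M d (u : 'I_d -> 'I_M -> K) (Z : {set 'I_M} -> K^o) : M = d.+1 ->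
  (forall j i, u j i = (val i == j.+1)%:R - (val i == 0%N)%:R) ->
  ev u Z = ext (fun=> 1) Z [set: 'I_M]%SET.
Proof.
move=> e; case: _ / (esym e) in u Z * => uE.
have -> : [set: 'I_d.+1]%SET = [set id i | i in 'I_d.+1]%SET.
  by apply/setP => i; rewrite inE; apply/esym/imsetP; exists i.
rewrite -ev_ebasis // ev_edges => [|j]; last by rewrite ebasis_pair.
apply: eq_ev => j i; rewrite uE /ebasis -!val_eqE /= /bump /= add1n.
by rewrite [j.+1 == _]eq_sym [0%N == _]eq_sym.
Qed.

Lemma ext1_star M (k : nat) (t : 'I_M -> K) (q : {set 'I_M} -> K^o) :
  homog k (star t q) -> ext (fun=> 1) (star t q) = (-1) ^+ k *: star t (ctr t q).
Proof.
move=> hs; apply/funext => A; rewrite fctE /GRing.scale /=.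
have := ext_star t q A.
have [Ak|Ak] := eqVneq #|A| k.+1.
  rewrite Ak => e; have -> : star t (ctr t q) A = - ((-1) ^+ k.+1 * ext (fun=> 1) (star t q) A).
    by rewrite e opprK.
  by rewrite exprS mulN1r mulNr opprK mulrA -expr2 sqrr_sign mul1r.
rewrite (homog_ext _ hs) // mulr0 => /esym/eqP; rewrite oppr_eq0 => /eqP ->.
by rewrite mulr0.
Qed.

Lemma ctr_star_homog M (k : nat) (t : 'I_M -> K) (q : {set 'I_M} -> K^o) :
  homog k.+1 (star t q) -> ctr t (star t q) = (-1) ^+ k *: star t (ext (fun=> 1) q).
Proof.
move=> hs; apply/funext => A; rewrite fctE /GRing.scale /= ctr_star.
have [-> //|Ak] := eqVneq #|A| k.
have := homog_ctr t hs Ak; rewrite ctr_star => /eqP.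
by rewrite mulf_eq0 signr_eq0 /= => /eqP ->; rewrite !mulr0.
Qed.

Lemma top_scale M c (w h : {set 'I_M} -> K^o) : top (c *: w) h = c * top w h.
Proof.
rewrite /top mulr_sumr; apply: eq_bigr => A _.
by rewrite fctE /GRing.scale /=; ring.
Qed.

Lemma star0 M (t : 'I_M -> K) : star t 0 = 0.
Proof. by apply/funext => A; rewrite /star mulr0. Qed.

Lemma star_eq0 M (t : 'I_M -> K) (q : {set 'I_M} -> K^o) :
  (forall i, t i != 0) -> star t q = 0 -> q = 0.
Proof.
move=> t0 sq; apply/funext => B; have : star t q (~: B) = 0 by rewrite sq.
rewrite /star setCK => /eqP; rewrite mulf_eq0 mulf_eq0 => /orP[/orP[]|/eqP //].
  move=> /eqP e; have := eps2 K (~: B); rewrite e mul0r => /esym/eqP.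
  by rewrite oner_eq0.
by rewrite prodf_seq_eq0 => /hasP[i _ /andP[_]]; rewrite (negbTE (t0 i)).
Qed.

End TopEdges.

Section Model.
Variables (R : realType) (M : nat).
Local Notation C := R[i].
Local Notation I := 'I_M.
Implicit Types (t : I -> R) (q w : (I -> R) -> {set I} -> C) (A B : {set I}).

Definition cj (q : {set I} -> C) : {set I} -> C := fun A => (q A)^*%C.

Lemma ctr_cj t (q : {set I} -> C) : ctr (toC t) (cj q) = cj (ctr (toC t) q).
Proof.
apply/funext => A; rewrite /cj (map_ctr (@conjc R)); congr (ctr _ _ _).
by apply/funext => i; rewrite /toC /= oppr0.
Qed.

Lemma ext_cj (q : {set I} -> C) : ext (fun=> 1) (cj q) = cj (ext (fun=> 1) q).
Proof.
apply/funext => A; rewrite /cj (map_ext (@conjc R)); congr (ext _ _ _).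
by apply/funext => i; rewrite /= oppr0.
Qed.

(** The coefficient at A is divisible by each missing t_i, hence by their product, which is the
    weight occurring in [star]; the quotients, with the signs [eps], form q. For n.+1 < l the degree
    of q is negative and q is zero. *)
Lemma star_div (n k l : nat) th : (k + l)%N = M -> hform n.+1 k th ->
  (forall i t, (forall j, 0 <= t j) -> \sum_j t j = 1 -> t i = 0 ->
     forall A : {set I}, i \notin A -> th t A = 0) ->
  exists2 q, hform (n.+1%:Z - l%:Z) l q &
    forall t, (forall j, 0 <= t j) -> th t = star (toC t) (q t).
Proof.
move=> klM [hth thk] th0.
have div A : exists g, hom (n.+1%:Z - #|~: A|%:Z) g /\
    forall t, (forall j, 0 <= t j) -> th t A = \prod_(i in ~: A) (t i)%:C%C * g t.
  have [|g hg gE] := hom_div (B := ~: A) (hth A); last by exists g.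
  move=> t i t0; rewrite inE => iA ti; move: t t0 ti.
  by apply: hom_facet (hth A) _ => t t0 t1 ti; exact: th0 iA.
have [g Hg] := choice div.
exists (fun t B => if #|B| == l then eps C (~: B) * g (~: B) t else 0).
  split=> [B|t B /negbTE -> //]; case: eqP => [Bl|_]; last exact: hom0.
  by apply: homZ; have := (Hg (~: B)).1; rewrite setCK Bl.
move=> t t0; apply/funext => A; rewrite /star setCK.
have cA : (#|~: A| == l) = (#|A| == k).
  have := cardsC A; rewrite card_ord -[RHS]klM => e.
  by apply/eqP/eqP => e'; move: e; rewrite e' => /eqP; rewrite ?eqn_add2r ?eqn_add2l => /eqP.
rewrite cA; case: eqP => [_|/eqP Ak]; last by rewrite thk // mulr0.
rewrite (Hg A).2 // /toC.
transitivity ((eps C A * eps C A) * (\prod_(i in ~: A) (t i)%:C%C * g A t)).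
  by rewrite eps2 mul1r.
ring.
Qed.

End Model.

End ExteriorAlgebra.
Import ExteriorAlgebra.

Local Open Scope classical_set_scope.
Local Open Scope ring_scope.

(** * Integrals of polynomials over a corner *)

Section CornerIntegral.
Import numFieldNormedType.Exports.
Variable R : realType.
Local Notation mu := (@lebesgue_measure R).
Implicit Types (p q P Q : {poly R}) (s t x : R) (f g : seq R -> R) (u : seq R).

Lemma ftc_poly q a b : a <= b ->
  \int[mu]_(t in `[a, b]) (q^`()).[t] = q.[b] - q.[a].
Proof.
rewrite le_eqVlt => /orP[/eqP<-|ab].
  by rewrite set_itv1 Rintegral_set1 subrr.
rewrite /Rintegral (@continuous_FTC2 _ _ (horner q)) //.
- by apply: continuous_subspaceT => x; exact: continuous_horner.
- split=> [x _||]; first exact: derivable_horner.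
  + by apply: cvg_at_right_filter; exact: continuous_horner.
  + by apply: cvg_at_left_filter; exact: continuous_horner.
- by move=> x _; rewrite derivE.
Qed.

Lemma antiderivative P : exists Q, Q^`() = P.
Proof.
exists (\poly_(i < (size P).+1) (P`_i.-1 / i%:R)); apply/polyP => i.
rewrite coef_deriv coef_poly ltnS; case: ltnP => [iP|/leq_sizeP Pi] /=.
  by rewrite -(mulr_natr (_ / _)) divfK // pnatr_eq0.
by rewrite mul0rn Pi.
Qed.

(** An antiderivative of P is monotone on [0, s] with equal end values, hence constant there, and so
    constant as a polynomial. *)
Lemma Rintegral_poly_eq0 P s : 0 < s ->
  (forall t, 0 <= t <= s -> 0 <= P.[t]) ->
  \int[mu]_(t in `[0, s]) P.[t] = 0 -> P = 0.
Proof.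
move=> s0 P0 intP; have [Q QP] := antiderivative P.
have Qx x : 0 <= x <= s -> Q.[x] = Q.[0].
  move=> /andP[x0 xs].
  have Q0s : Q.[s] - Q.[0] = 0 by rewrite -ftc_poly ?(le_trans x0 xs) // QP.
  have : 0 <= Q.[x] - Q.[0].
    rewrite -ftc_poly // QP; apply: Rintegral_ge0 => t /=; rewrite in_itv /= => /andP[? tx].
    by apply: P0; apply/andP; split=> //; exact: le_trans tx xs.
  have : 0 <= Q.[s] - Q.[x].
    rewrite -ftc_poly // QP; apply: Rintegral_ge0 => t /=; rewrite in_itv /= => /andP[xt ?].
    by apply: P0; apply/andP; split=> //; exact: le_trans x0 xt.
  lra.
have Q0 : Q - Q.[0]%:P = 0.
  set D := Q - _; apply/eqP; apply: contraT => Dn0.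
  (* These points of the interval are distinct and one more than the degree of D. *)
  pose rs := [seq s / (j.+1)%:R | j <- iota 0 (size D)].
  have /(max_poly_roots Dn0) : all (root D) rs.
    apply/allP => _ /mapP[j _ ->].
    have sj : 0 <= s / j.+1%:R <= s.
      apply/andP; split; first by rewrite divr_ge0 // ltW.
      by rewrite ler_pdivrMr ?ltr0Sn // ler_peMr ?ler1n // ltW.
    by rewrite /root /D hornerD hornerN hornerC Qx // subrr.
  rewrite size_map size_iota ltnn => -> //.
  rewrite map_inj_uniq ?iota_uniq // => a b /(mulfI (lt0r_neq0 s0)) /invr_inj /eqP.
  by rewrite eqr_nat eqSS => /eqP.
by rewrite -QP -[Q](subrK Q.[0]%:P) Q0 add0r derivC.
Qed.

(** The Beta integral, by integration by parts. Only its homogeneity in s is used later, so the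
    value of B is left implicit but B is chosen before s. *)
Lemma beta_poly (a b : nat) : exists B : R, forall s, exists q,
  q^`() = 'X^a * (s%:P - 'X) ^+ b /\ q.[s] - q.[0] = B * s ^+ (a + b).+1.
Proof.
elim: b a => [|b IH] a.
  exists (a.+1%:R^-1) => s; exists ((a.+1%:R^-1 : R) *: 'X^(a.+1)); split.
    by rewrite derivZ derivXn -(scaler_nat _ 'X^_) /= scalerA mulVf ?pnatr_eq0 // scale1r mulr1.
  by rewrite !hornerE expr0n mulr0 subr0 ?addn0.
have [B HB] := IH a.+1; exists (a.+1%:R^-1 * (b.+1%:R * B)) => s.
have [q [q'E qB]] := HB s.
exists ((a.+1%:R^-1 : R) *: ('X^(a.+1) * (s%:P - 'X) ^+ b.+1 + (b.+1%:R : R) *: q)); split.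
  rewrite derivZ derivD derivZ q'E derivM derivXn deriv_exp derivB derivC derivX sub0r /=.
  rewrite scaler_nat mulN1r mulNrn mulrN mulrnAr addrNK mulrnAl.
  by rewrite -(scaler_nat _ ('X^a * _)) scalerA mulVf ?pnatr_eq0 // scale1r.
rewrite !hornerE subrr !expr0n /= !(mulr0, mul0r) !add0r -mulrBr -mulrBr qB addSnnS.
by ring.
Qed.

(** Polynomial functions of the entries of a sequence of any length; an entry beyond the end counts
    as 0. *)
Inductive pfun : (seq R -> R) -> Prop :=
| pfun_cst c : pfun (fun=> c)
| pfun_coord i : pfun (fun u => u`_i)
| pfunD f g : pfun f -> pfun g -> pfun (fun u => f u + g u)
| pfunM f g : pfun f -> pfun g -> pfun (fun u => f u * g u).

Lemma pfun_cons t f : pfun f -> pfun (fun u => f (t :: u)).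
Proof.
elim=> [c|[|i]|g h _ IHg _ IHh|g h _ IHg _ IHh]; [exact: pfun_cst|exact: (pfun_cst t)| |exact: pfunD|exact: pfunM].
exact: (pfun_coord i).
Qed.

Definition mono_sum (J : finType) (c : J -> R) (a : J -> nat -> nat) m u :=
  \sum_j c j * \prod_(i < m) u`_i ^+ a j i.

Lemma pfun_mono m f : pfun f -> exists (J : finType) (c : J -> R) a,
  forall u, size u = m -> f u = mono_sum c a m u.
Proof.
elim=> [c|i|g h _ [J [c [a Eg]]] _ [J' [c' [a' Eh]]]|g h _ [J [c [a Eg]]] _ [J' [c' [a' Eh]]]].
- exists unit, (fun=> c), (fun _ _ => 0%N) => u _.
  by rewrite /mono_sum (bigD1 tt) //= !big1 ?mulr1 ?addr0 // => -[].
- exists unit, (fun=> (i < m)%:R), (fun _ k => (k == i : nat)) => u um.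
  rewrite /mono_sum (bigD1 tt) //= [X in _ + X]big1 ?addr0; last by case.
  case: ltnP => im; last by rewrite mul0r nth_default ?um.
  rewrite mul1r (bigD1 (Ordinal im)) //= eqxx big1 ?mulr1 // => k ki.
  by case: eqP => // e; case/eqP: ki; apply: val_inj.
- exists (J + J')%type, (fun j => match j with inl j => c j | inr j => c' j end),
    (fun j => match j with inl j => a j | inr j => a' j end) => u um.
  by rewrite /mono_sum big_sumType /= Eg // Eh.
- exists (J * J')%type, (fun j => c j.1 * c' j.2), (fun j i => (a j.1 i + a' j.2 i)%N) => u um.
  rewrite Eg // Eh // /mono_sum big_distrlr /= pair_big /=; apply: eq_bigr => -[j j'] _ /=.
  under [in RHS]eq_bigr do rewrite exprD.
  by rewrite big_split /=; ring.
Qed.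

Lemma mono_sum_cons (J : finType) (c : J -> R) a m t u :
  mono_sum c a m.+1 (t :: u) = mono_sum (fun j => c j * t ^+ a j 0%N) (fun j i => a j i.+1) m u.
Proof.
rewrite /mono_sum; apply: eq_bigr => j _.
by rewrite big_ord_recl /= mulrA.
Qed.

Definition corner m s u := [/\ size u = m, forall i, 0 <= u`_i & \sum_(x <- u) x <= s].

Lemma corner_cons m s t u : 0 <= t -> corner m (s - t) u -> corner m.+1 s (t :: u).
Proof.
move=> t0 [um u0 us]; split=> [|[|i]|] //=; first by rewrite um.
by rewrite big_cons -lerBrDl.
Qed.

Lemma eq_corner_integral m s f g : 0 <= s -> (forall u, corner m s u -> f u = g u) ->
  corner_integral m s f = corner_integral m s g.
Proof.
elim: m s f g => [|m IH] s f g s0 fg /=.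
  by apply: fg; split=> // [i|]; rewrite ?nth_nil // big_nil.
apply: eq_Rintegral => t /[!inE] /=; rewrite in_itv /= => /andP[t0 ts].
by apply: IH => [|u us]; [rewrite subr_ge0|apply: fg; exact: corner_cons].
Qed.

Lemma corner_integral_ge0 m s f : 0 <= s -> (forall u, corner m s u -> 0 <= f u) ->
  0 <= corner_integral m s f.
Proof.
elim: m s f => [|m IH] s f s0 f0 /=.
  by apply: f0; split=> // [i|]; rewrite ?nth_nil // big_nil.
apply: Rintegral_ge0 => t /=; rewrite in_itv /= => /andP[t0 ts].
by apply: IH => [|u us]; [rewrite subr_ge0|apply: f0; exact: corner_cons].
Qed.

(** Dirichlet's integral: the inner integral of a monomial is a multiple of a power of s - t, and a
    Beta integral remains. As k depends on the exponents only, linearity of the integral on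
    polynomials can be read off. *)
Lemma corner_integral_mono m : exists k : (nat -> nat) -> R,
  forall (J : finType) (c : J -> R) a s, 0 <= s ->
  corner_integral m s (mono_sum c a m) =
  \sum_j c j * (k (a j) * s ^+ (\sum_(i < m) a j i + m)).
Proof.
elim: m => [|m [k IH]].
  exists (fun=> 1) => J c a s s0 /=; rewrite /mono_sum; apply: eq_bigr => j _.
  by rewrite !big_ord0 expr0 !mulr1.
have [B HB] : exists B : (nat -> nat) -> R, forall a s, exists q,
    q^`() = 'X^(a 0%N) * (s%:P - 'X) ^+ (\sum_(i < m) a i.+1 + m) /\
    q.[s] - q.[0] = B a * s ^+ (\sum_(i < m.+1) a i + m.+1).
  have /choice[B HB] := fun a : nat -> nat => beta_poly (a 0%N) (\sum_(i < m) a i.+1 + m).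
  by exists B => a s; rewrite big_ord_recl addnS -addnA.
exists (fun a => B a * k (fun i => a i.+1)) => J c a s s0 /=.
have [q Hq] := choice (fun j => HB (a j) s).
pose Q := \sum_j (c j * k (fun i => a j i.+1)) *: q j.
transitivity (\int[mu]_(t in `[0, s]) (Q^`()).[t]).
  apply: eq_Rintegral => t /[!inE] /=; rewrite in_itv /= => /andP[t0 ts].
  have -> : (fun u => mono_sum c a m.+1 (t :: u)) =
     mono_sum (fun j => c j * t ^+ a j 0%N) (fun j i => a j i.+1) m.
    by apply/funext => u; exact: mono_sum_cons.
  rewrite IH ?subr_ge0 // /Q raddf_sum horner_sum; apply: eq_bigr => j _ /=.
  rewrite derivZ (Hq j).1 !hornerE /=; ring.
rewrite ftc_poly // /Q !horner_sum -sumrB; apply: eq_bigr => j _.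
by rewrite !hornerE -mulrBr (Hq j).2 /=; ring.
Qed.

Lemma corner_integral_lin m s a b f g : 0 <= s -> pfun f -> pfun g ->
  corner_integral m s (fun u => a * f u + b * g u) =
  a * corner_integral m s f + b * corner_integral m s g.
Proof.
move=> s0 /(@pfun_mono m) [J [c [e Ef]]] /(@pfun_mono m) [J' [c' [e' Eg]]].
have [k Hk] := corner_integral_mono m.
rewrite (eq_corner_integral (f := f) s0 (g := mono_sum c e m)) => [|u [um _ _]]; last exact: Ef.
rewrite Hk // (eq_corner_integral (f := g) s0 (g := mono_sum c' e' m)) => [|u [um _ _]]; last exact: Eg.
rewrite Hk //.
pose d j := match j with inl j => a * c j | inr j => b * c' j end.
pose h j := match j with inl j => e j | inr j => e' j end.
rewrite (eq_corner_integral s0 (g := mono_sum d h m)) => [|u [um _ _]]; last first.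
  rewrite Ef // Eg // /mono_sum big_sumType !mulr_sumr /=.
  by congr (_ + _); apply: eq_bigr => j _; rewrite mulrA.
rewrite Hk // big_sumType !mulr_sumr /=.
by congr (_ + _); apply: eq_bigr => j _; rewrite -mulrA.
Qed.

(** The inner integral is a nonnegative polynomial in the first coordinate with integral zero, hence
    identically zero, and induction applies to every slice. The strict inequality on the sum keeps
    each slice of positive size. *)
Lemma corner_integral_eq0 m s f : 0 < s -> pfun f ->
  (forall u, corner m s u -> 0 <= f u) -> corner_integral m s f = 0 ->
  forall u, corner m s u -> \sum_(x <- u) x < s -> f u = 0.
Proof.
elim: m s f => [|m IH] s f s0 pf f0 int0 u [um u0 us] us'.
  by rewrite (size0nil um).
case: u um u0 us us' => // t u [um] u0 us us'.
have t0 : 0 <= t := u0 0%N.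
have u0' i : 0 <= u`_i := u0 i.+1.
have ts : t < s.
  move: us'; rewrite big_cons; apply: le_lt_trans; rewrite lerDl.
  by rewrite big_seq sumr_ge0 // => x /(nthP 0)[i _ <-].
rewrite big_cons -lerBrDl in us; rewrite big_cons -ltrBrDl in us'.
apply: (IH (s - t) (fun u => f (t :: u))) => //; first by rewrite subr_gt0.
- exact: pfun_cons.
- by move=> v vs; apply: f0; exact: corner_cons.
have [J [c [a Ef]]] := @pfun_mono m.+1 f pf.
have [k Hk] := corner_integral_mono m.
pose P := \sum_j (c j * k (fun i => a j i.+1)) *:
  ('X^(a j 0%N) * (s%:P - 'X) ^+ (\sum_(i < m) a j i.+1 + m)).
have PE x : 0 <= x <= s -> corner_integral m (s - x) (fun u => f (x :: u)) = P.[x].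
  move=> /andP[x0 xs]; have xs0 : 0 <= s - x by rewrite subr_ge0.
  rewrite (eq_corner_integral xs0 (g :=
     mono_sum (fun j => c j * x ^+ a j 0%N) (fun j i => a j i.+1) m)).
    rewrite Hk // /P horner_sum; apply: eq_bigr => j _.
    rewrite !hornerE /=; ring.
  by move=> v [vm _ _]; rewrite Ef /= ?vm // mono_sum_cons.
rewrite PE ?t0 ?ltW //.
suff -> : P = 0 by rewrite horner0.
apply: (@Rintegral_poly_eq0 P s s0) => [x xs|].
  rewrite -PE //; have /andP[x0 xs'] := xs; apply: corner_integral_ge0; first by rewrite subr_ge0.
  by move=> v vs; apply: f0; exact: corner_cons.
rewrite -[RHS]int0 /=; apply: eq_Rintegral => x /[!inE] /=; rewrite in_itv /= => xs.
by rewrite PE.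
Qed.

End CornerIntegral.

(** * Barycentric coordinates and faces *)

Section Barycentric.
Variables (R : realType) (N : nat).
Local Notation E := 'rV[R]_N.
Local Notation simplex := (osimplex R N).
Implicit Types (F G T : simplex) (x p q : E).

Lemma size_simplex F : size F = (sdim F).+1.
Proof. by rewrite /sdim prednK //; case/andP: (valP F). Qed.

Lemma dbary_sum F i (J : finType) (c : J -> R) (w : J -> E) :
  dbary F i (\sum_j c j *: w j) = \sum_j c j * dbary F i (w j).
Proof.
rewrite /dbary; set P := pinvmx _.
have -> : row_mx (\sum_j c j *: w j) (0 : 'M[R]_1) = \sum_j c j *: row_mx (w j) 0.
  elim/big_rec2: _ => [|j y1 y2 _ <-]; first by rewrite row_mx0.
  by rewrite scale_row_mx scaler0 add_row_mx add0r.
rewrite mulmx_suml summxE; apply: eq_bigr => j _.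
by rewrite -scalemxAl mxE.
Qed.

Lemma dbaryB F i p q : dbary F i (p - q) = bary F i p - bary F i q.
Proof. by rewrite -[p in RHS](subrK q) [p - q + q]addrC baryD addrAC subrr add0r. Qed.

Lemma bary_sum F i (J : finType) (c : J -> R) (w : J -> E) :
  \sum_j c j = 1 -> bary F i (\sum_j c j *: w j) = \sum_j c j * bary F i (w j).
Proof.
move=> c1; have -> : \sum_j c j *: w j = F`_0 + \sum_j c j *: (w j - F`_0).
  under [X in _ = _ + X]eq_bigr do rewrite scalerBr.
  by rewrite sumrB -scaler_suml c1 scale1r addrC subrK.
rewrite baryD dbary_sum; under eq_bigr do rewrite dbaryB mulrBr.
by rewrite sumrB -mulr_suml c1 mul1r addrC subrK.
Qed.

Lemma bary_comb F (t : 'I_(sdim F).+1 -> R) i :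
  \sum_i t i = 1 -> bary F i (\sum_i t i *: F`_i) = t i.
Proof.
move=> t1; rewrite bary_sum // (bigD1 i) //= bary_vertex eqxx mulr1.
rewrite big1 ?addr0 // => j ji; by rewrite bary_vertex eq_sym (negbTE ji) mulr0.
Qed.

Lemma dbary_comb F (t : 'I_(sdim F).+1 -> R) i :
  \sum_i t i = 0 -> dbary F i (\sum_i t i *: F`_i) = t i.
Proof.
move=> t0.
have -> : \sum_i t i *: F`_i = \sum_i t i *: (F`_i - F`_0).
  under [RHS]eq_bigr do rewrite scalerBr.
  by rewrite sumrB -scaler_suml t0 scale0r subr0.
rewrite dbary_sum; under eq_bigr do rewrite dbaryB mulrBr.
rewrite sumrB -mulr_suml t0 mul0r subr0 (bigD1 i) //= bary_vertex eqxx mulr1.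
rewrite big1 ?addr0 // => j ji; by rewrite bary_vertex eq_sym (negbTE ji) mulr0.
Qed.

Lemma hullP F x : hull F x ->
  [/\ forall i, 0 <= bary F i x, \sum_i bary F i x = 1 & x = \sum_i bary F i x *: F`_i].
Proof.
move=> [t [t0 t1 ->]]; split=> [i||]; first by rewrite bary_comb.
  by rewrite -t1; apply: eq_bigr => i _; rewrite bary_comb // t1.
by apply: eq_bigr => i _; rewrite bary_comb.
Qed.

Lemma tangentP F v :
  tangent F v <-> exists2 c : 'I_(sdim F).+1 -> R, \sum_i c i = 0 & v = \sum_i c i *: F`_i.
Proof.
split.
  move=> /submxP[u ->].
  pose c i : R := if unlift ord0 i is Some j then u 0 j else - \sum_j u 0 j.
  have cl j : c (lift ord0 j) = u 0 j by rewrite /c liftK.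
  have c0 : c ord0 = - \sum_j u 0 j by rewrite /c unlift_none.
  exists c.
    by rewrite big_ord_recl c0 [X in _ + X](eq_bigr (u 0)) ?addNr // => j _; rewrite cl.
  rewrite big_ord_recl c0 [X in _ = _ + X](eq_bigr (fun j => u 0 j *: F`_(lift ord0 j))); last first.
    by move=> j _; rewrite cl.
  rewrite mulmx_sum_row scaleNr scaler_suml addrC -sumrB; apply: eq_bigr => j _.
  by rewrite rowK scalerBr.
move=> [c c0 ->].
have -> : \sum_i c i *: F`_i = \sum_i c i *: (F`_i - F`_0).
  under [RHS]eq_bigr do rewrite scalerBr.
  by rewrite sumrB -scaler_suml c0 scale0r subr0.
rewrite big_ord_recl subrr scaler0 add0r; apply: summx_sub => j _.
apply: scalemx_sub; have -> : F`_(lift ord0 j) - F`_0 = row j (edge_mx F) by rewrite rowK.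
exact: row_sub.
Qed.

Lemma tangent_sum F v : tangent F v ->
  \sum_i dbary F i v = 0 /\ v = \sum_i dbary F i v *: F`_i.
Proof.
move=> /tangentP[c c0 ->]; split; last by apply: eq_bigr => i _; rewrite dbary_comb.
by rewrite -[RHS]c0; apply: eq_bigr => i _; rewrite dbary_comb.
Qed.

Lemma hullB_tangent F p q : hull F p -> hull F q -> tangent F (p - q).
Proof.
move=> [t [_ t1 ->]] [t' [_ t'1 ->]]; apply/tangentP.
exists (fun i => t i - t' i); first by rewrite sumrB t1 t'1 subrr.
by rewrite -sumrB; apply: eq_bigr => i _; rewrite scalerBl.
Qed.

Lemma vertex_hull F (i : 'I_(sdim F).+1) : hull F F`_i.
Proof.
exists (fun j => (j == i)%:R); split=> [j||]; first by rewrite ler0n.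
  by rewrite (bigD1 i) //= eqxx big1 ?addr0 // => j /negbTE ->.
by rewrite (bigD1 i) //= eqxx scale1r big1 ?addr0 // => j /negbTE ->; rewrite scale0r.
Qed.

Lemma hull_tangent_sub F G v : hull F `<=` hull G -> tangent F v -> tangent G v.
Proof.
move=> FG Fv; apply: submx_trans Fv _; apply/row_subP => i; rewrite rowK.
apply: (hullB_tangent (F := G)); apply: FG.
  exact: (vertex_hull (lift ord0 i)).
exact: (vertex_hull ord0).
Qed.

Lemma trace_trace k F G (w : dform R N k) : hull F `<=` hull G ->
  trace F (trace G w) = trace F w.
Proof.
move=> FG; apply/funext => x; apply/funext => v; rewrite /trace.
case: asboolP => // -[Fx Fv]; case: asboolP => // -[]; split; first exact: FG.
by move=> i; apply: hull_tangent_sub (Fv i).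
Qed.

Lemma eq_trace k F (w w' : dform R N k) :
  (forall x v, hull F x -> (forall i, tangent F (v i)) -> w x v = w' x v) ->
  trace F w = trace F w'.
Proof.
move=> ww'; apply/funext => x; apply/funext => v; rewrite /trace.
by case: asboolP => // -[Fx Fv]; exact: ww'.
Qed.

Lemma trace0P k F (w : dform R N k) x v : trace F w = 0 ->
  hull F x -> (forall i, tangent F (v i)) -> w x v = 0.
Proof.
move=> w0 Fx Fv; have : trace F w x v = 0 by rewrite w0.
by rewrite /trace asboolT.
Qed.

Lemma traceE k F (w : dform R N k) x v :
  hull F x -> (forall i, tangent F (v i)) -> trace F w x v = w x v.
Proof. by move=> Fx Fv; rewrite /trace asboolT. Qed.

Lemma subseq_nth (T : eqType) (x0 : T) (s1 s2 : seq T) : subseq s1 s2 ->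
  exists f : nat -> nat, (forall a b, (a < b < size s1)%N -> (f a < f b)%N) /\
    (forall a, (a < size s1)%N -> (f a < size s2)%N /\ nth x0 s2 (f a) = nth x0 s1 a).
Proof.
elim: s2 s1 => [|y s2 IH] [|x s1] //=; try by exists id; split=> // a b; rewrite andbC.
case: eqP => [->|_] /IH[f [f1 f2]].
  exists (fun a => if a is a'.+1 then (f a').+1 else 0%N); split.
    by move=> [|a] [|b] //= ab; rewrite ltnS; apply: f1.
  by move=> [|a] //= /f2[].
exists (fun a => (f a).+1); split=> [a b ab|a /f2[]//].
by rewrite ltnS; apply: f1.
Qed.

Lemma subsimplexP G T : subsimplex G T ->
  exists2 j : 'I_(sdim G).+1 -> 'I_(sdim T).+1,
    (forall a b : 'I_(sdim G).+1, (a < b)%N -> (j a < j b)%N) & forall a, T`_(j a) = G`_a.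
Proof.
move=> /(subseq_nth 0)[f [f1 f2]].
have fb (a : 'I_(sdim G).+1) : (f a < (sdim T).+1)%N.
  by move: (f2 a); rewrite !size_simplex ltn_ord => /(_ isT)[].
exists (fun a => Ordinal (fb a)) => [a b ab|a] /=.
  by apply: f1; rewrite ab size_simplex ltn_ord.
by apply: (f2 a _).2; rewrite size_simplex ltn_ord.
Qed.

Lemma ord_inc_inj m n (j : 'I_m -> 'I_n) :
  (forall a b : 'I_m, (a < b)%N -> (j a < j b)%N) -> injective j.
Proof.
move=> jinc a b e; apply: val_inj; case: (ltngtP a b) => //= ab;
  by have := jinc _ _ ab; rewrite e ltnn.
Qed.

Lemma sum_push m n (j : 'I_m -> 'I_n) (V : lmodType R) (c : 'I_m -> R) (w : 'I_n -> V) :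
  \sum_i (\sum_(a | j a == i) c a) *: w i = \sum_a c a *: w (j a).
Proof.
under eq_bigr do rewrite scaler_suml big_mkcond.
rewrite exchange_big /=; apply: eq_bigr => a _.
rewrite (bigD1 (j a)) //= eqxx big1 ?addr0 // => i /negbTE.
by rewrite eq_sym => ->.
Qed.

Lemma sum_push1 m n (j : 'I_m -> 'I_n) (c : 'I_m -> R) :
  \sum_i (\sum_(a | j a == i) c a) = \sum_a c a.
Proof.
by rewrite (exchange_big_dep xpredT) //=; apply: eq_bigr => a _;
rewrite (big_pred1 (j a)) // => i; rewrite eq_sym.
Qed.

Lemma subsimplex_hull G T : subsimplex G T -> hull G `<=` hull T.
Proof.
move=> /subsimplexP[j _ jE] _ [t [t0 t1 ->]].
exists (fun i => \sum_(a | j a == i) t a); split=> [i||].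
- by apply: sumr_ge0 => a _; exact: t0.
- by rewrite sum_push1.
by rewrite sum_push; apply: eq_bigr => a _; rewrite jE.
Qed.

Section Embedding.
Variables (G T : simplex) (j : 'I_(sdim G).+1 -> 'I_(sdim T).+1).
Hypothesis jE : forall a, T`_(j a) = G`_a.

Lemma bary_push x i : hull G x -> bary T i x = \sum_(a | j a == i) bary G a x.
Proof.
move=> /hullP[_ G1 {1}->]; rewrite bary_sum // [RHS]big_mkcond.
apply: eq_bigr => a _; rewrite -jE bary_vertex eq_sym.
by case: eqP => _; rewrite ?mulr1 ?mulr0.
Qed.

Lemma dbary_push v i : tangent G v -> dbary T i v = \sum_(a | j a == i) dbary G a v.
Proof.
move=> /tangent_sum[G0 {1}->].
have -> : \sum_a dbary G a v *: G`_a = \sum_i0 (\sum_(a | j a == i0) dbary G a v) *: T`_i0.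
  by rewrite sum_push; apply: eq_bigr => a _; rewrite jE.
by rewrite dbary_comb // sum_push1.
Qed.

End Embedding.

(** A linear relation between the edges of s is tested with the differentials of the barycentric
    coordinates of F, each of which isolates one coefficient. *)
Lemma sub_is_osimplex F (s : seq E) : (0 < size s)%N -> subseq s F -> is_osimplex s.
Proof.
move=> s0 /(subseq_nth 0)[f [f1 f2]]; rewrite /is_osimplex s0 /=.
have fb (a : 'I_(size s)) : (f a < (sdim F).+1)%N.
  by rewrite -(size_simplex F); apply: (f2 a _).1.
pose j a := Ordinal (fb a).
have jE (a : 'I_(size s)) : s`_a = F`_(j a) by rewrite (f2 a _).2.
have j_inj : injective j by apply: ord_inc_inj => a b ab; apply: f1; rewrite ab ltn_ord.
apply: inj_row_free => u.
rewrite mulmx_sum_row => u0; apply/rowP => b; rewrite [RHS]mxE.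
pose o0 : 'I_(size s) := Ordinal s0.
have bS (a : 'I_(size s).-1) : (a.+1 < size s)%N by rewrite -[X in (_ < X)%N]prednK // ltnS ltn_ord.
pose S a : 'I_(size s) := Ordinal (bS a).
have : dbary F (j (S b)) (\sum_i u 0 i *: row i (edge_mx s)) = 0.
  rewrite u0 -[0](subrr F`_0) dbaryB; exact: subrr.
rewrite dbary_sum (bigD1 b) //= rowK.
rewrite -[s`_0]/(s`_o0) -[s`_b.+1]/(s`_(S b)) !jE dbaryB !bary_vertex eqxx.
have SN a : S a == o0 = false by apply/eqP => /(congr1 val).
rewrite (inj_eq j_inj) SN subr0 mulr1 big1 ?addr0 // => a ab.
rewrite rowK -[s`_0]/(s`_o0) -[s`_a.+1]/(s`_(S a)) !jE dbaryB !bary_vertex.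
rewrite !(inj_eq j_inj) SN subr0.
have -> : (S b == S a) = false; last by rewrite mulr0.
by apply/eqP => -[e]; case/eqP: ab; apply: val_inj.
Qed.

Lemma vertex_inj F : injective (fun i : 'I_(sdim F).+1 => F`_i).
Proof.
move=> i j /= e; have := bary_vertex i i; rewrite {1}e bary_vertex eqxx => /eqP.
by case: (i =P j) => // _; rewrite eq_sym oner_eq0.
Qed.

Lemma uniq_simplex F : uniq F.
Proof.
apply/(uniqP 0) => a b; rewrite !inE !size_simplex => aF bF e.
by have /(congr1 val) := vertex_inj (e : F`_(Ordinal aF) = F`_(Ordinal bF)).
Qed.

(** G is the facet opposite vertex i, obtained by deleting that vertex; positive dimension keeps it
    nonempty. *)
Lemma facetP F (i : 'I_(sdim F).+1) : (0 < sdim F)%N ->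
  exists G, [/\ subsimplex G F, G != F &
   forall t : 'I_(sdim F).+1 -> R, (forall j, 0 <= t j) -> \sum_j t j = 1 -> t i = 0 ->
    hull G (\sum_j t j *: F`_j)].
Proof.
move=> F0; have Fi : F`_i \in (F : seq E) by rewrite mem_nth // size_simplex.
have sz : size (rem F`_i F) = sdim F by rewrite size_rem // size_simplex.
have rF := rem_subseq F`_i F.
have os : is_osimplex (rem F`_i F) by apply: sub_is_osimplex rF; rewrite sz.
pose G : simplex := OSimplex os; exists G; split=> // [|t t0 t1 ti].
  apply/eqP => /(congr1 (fun F : simplex => size F)) /=.
  by rewrite sz size_simplex => /eqP; rewrite ltn_eqF.
have [j jinc jE] := subsimplexP (rF : subsimplex G F).
have j_inj := ord_inc_inj jinc.
have dG : (sdim G).+1 = sdim F by rewrite -size_simplex.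
have ji a : j a != i.
  apply/eqP => e; have : G`_a \in (G : seq E) by rewrite mem_nth // size_simplex.
  by rewrite /= mem_rem_uniq ?uniq_simplex // -jE e !inE eqxx.
have imj : [set j a | a in 'I_(sdim G).+1]%SET = [set~ i]%SET.
  have ci : (#|[set~ i]%SET| <= #|[set j a | a in 'I_(sdim G).+1]%SET|)%N.
    by rewrite cardsC1 card_ord card_imset // card_ord /= -dG.
  apply/eqP; rewrite eqEcard ci andbT.
  by apply/fintype.subsetP => _ /imsetP[a _ ->]; rewrite !inE.
have sumj (V : nmodType) (f : 'I_(sdim F).+1 -> V) : f i = 0 ->
    \sum_k f k = \sum_a f (j a).
  move=> fi; rewrite (bigD1 i) //= fi add0r.
  rewrite -(big_imset f (A := 'I_(sdim G).+1)) /=; last by move=> a b _ _ /j_inj.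
  by apply: eq_bigl => k; rewrite imj !inE.
exists (fun a => t (j a)); split=> [a||]; first exact: t0.
  by rewrite -sumj.
by rewrite sumj ?ti ?scale0r //; apply: eq_bigr => a _; rewrite jE.
Qed.

End Barycentric.

(** * Polynomial forms in barycentric coordinates *)

Local Arguments dlambda {R N} F {l} sigma.
Local Arguments whitney {R N} F {l} rho.
Local Arguments monomial {R N} F alpha x.

Section Monomials.
Variables (R : realType) (M : nat).
Local Notation C := R[i].

Lemma hom_monomials s (f : ('I_M -> R) -> C) : hom s f ->
  exists (J : finType) (c : J -> C) (al : J -> 'I_M -> nat),
    (forall j, multi_index s (al j)) /\
    forall t, f t = \sum_j c j * (\prod_i t i ^+ al j i)%:C%C.
Proof.
elim=> [c|s'|s' i g _ [J [c [al [als Eg]]]]|s' g h _ [J [c [al [als Eg]]]] _ [J' [c' [al' [als' Eh]]]]].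
- exists unit, (fun=> c), (fun _ _ => 0%N); split=> [_|t]; first by rewrite /multi_index big1.
  by rewrite (bigD1 tt) //= !big1 ?rmorph1 ?mulr1 ?addr0 // => -[].
- by exists 'I_0, (fun=> 0), (fun _ _ => 0%N); split=> [[]//|t]; rewrite big_ord0.
- exists J, c, (fun j k => al j k + (k == i))%N; split=> [j|t].
    rewrite /multi_index big_split /= PoszD als; congr (_ + _%:Z).
    by rewrite (bigD1 i) //= eqxx big1 // => k /negbTE ->.
  rewrite Eg mulr_sumr; apply: eq_bigr => j _.
  under [in RHS]eq_bigr do rewrite exprD.
  have ti : \prod_k t k ^+ (k == i) = t i.
    by rewrite (bigD1 i) //= eqxx expr1 big1 ?mulr1 // => k /negbTE ->.
  by rewrite big_split /= ti rmorphM /=; ring.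
- exists (J + J')%type, (fun j => match j with inl j => c j | inr j => c' j end),
    (fun j => match j with inl j => al j | inr j => al' j end); split=> [[]//|t].
  by rewrite big_sumType /= Eg Eh.
Qed.

Lemma hom_monomial (al : 'I_M -> nat) :
  hom (\sum_i al i)%N%:Z (fun t => (\prod_i t i ^+ al i)%:C%C : C).
Proof.
have step (r : seq 'I_M) : hom (\sum_(i <- r) al i)%N%:Z
    (fun t => (\prod_(i <- r) t i ^+ al i)%:C%C : C).
  elim: r => [|i r IH].
    by rewrite big_nil; apply: (eq_hom (hom_cst (1 : C))) => t; rewrite big_nil rmorph1.
  rewrite big_cons PoszD addrC.
  apply: eq_hom.
    have := homXs (nseq (al i) i) IH; rewrite size_nseq; exact.
  by move=> t /=; rewrite big_cons big_nseq iter_mulr_1 rmorphM rmorphXn.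
exact: step.
Qed.

End Monomials.

Section Push.
Variables (R : realType) (M M' : nat) (j : 'I_M -> 'I_M').
Local Notation C := R[i].
Hypothesis jinc : forall a b : 'I_M, (a < b)%N -> (j a < j b)%N.

(** For increasing j this is extension by zero, from the vertices of a face to those of the simplex;
    it serves points, tangent vectors and exponents alike. *)
Definition push (V : nmodType) (t : 'I_M -> V) : 'I_M' -> V := fun i => \sum_(a | j a == i) t a.

Lemma push_im (V : nmodType) (t : 'I_M -> V) a : push t (j a) = t a.
Proof.
rewrite /push (big_pred1 a) // => b; apply/eqP/eqP => [|-> //].
exact: (ord_inc_inj jinc).
Qed.

Lemma push_out (V : nmodType) (t : 'I_M -> V) i :
  i \notin [set j a | a in 'I_M]%SET -> push t i = 0.
Proof.
by move=> ni; apply: big1 => a /eqP e; case/negP: ni; apply/imsetP; exists a.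
Qed.

Lemma toC_push (t : 'I_M -> R) : toC (push t) = push (toC t).
Proof.
by apply/funext => i; rewrite /toC /push rmorph_sum.
Qed.

Lemma hom_push s (f : ('I_M' -> R) -> C) : hom s f -> hom s (fun t => f (push t)).
Proof.
elim=> [c|s'|s' i g _ IH|s' g h _ IHg _ IHh]; [exact: hom_cst|exact: hom0| |exact: homD].
have [/imsetP[a _ ->]|ni] := boolP (i \in [set j a | a in 'I_M]%SET).
  by apply: eq_hom (homX a IH) _ => t; rewrite push_im.
by apply: eq_hom (hom0 _) _ => t; rewrite push_out // mul0r.
Qed.

(** Restriction of a lifted form to a face: t_i and dt_i are set to zero for the vertices outside
    it. *)
Definition pull (w : ('I_M' -> R) -> {set 'I_M'} -> C) : ('I_M -> R) -> {set 'I_M} -> C :=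
  fun t A => w (push t) (j @: A).

Lemma hform_pull s l w : hform s l w -> hform s l (pull w).
Proof.
move=> [hw wl]; split=> [A|t A Al]; first exact: (hom_push (hw _)).
by rewrite /pull wl // (card_imset _ (ord_inc_inj jinc)).
Qed.

Lemma sg_push a (A : {set 'I_M}) : sg C (j a) (j @: A) = sg C a A.
Proof.
rewrite /sg big_imset /=; last by move=> b c _ _; exact: (ord_inc_inj jinc).
apply: eq_bigr => b _; congr (_ ^+ nat_of_bool _).
case: (ltngtP b a) => [/jinc //|/jinc|/val_inj ->]; last by rewrite ltnn.
by move=> ab; rewrite ltnNge ltnW.
Qed.

Lemma ctr_pull (a : 'I_M -> C) (w : {set 'I_M'} -> C) (A : {set 'I_M}) :
  ctr a (fun A => w (j @: A)) A = ctr (push a) w (j @: A).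
Proof.
have ji := ord_inc_inj jinc.
rewrite /ctr !fct_sumE.
transitivity (\sum_i \sum_(b | j b == i) a b * ctr1 i w (j @: A)); last first.
  by apply: eq_bigr => i _; rewrite -mulr_suml.
rewrite (exchange_big_dep xpredT) //=; apply: eq_bigr => b _.
rewrite (big_pred1 (j b)) => [|i]; last by rewrite eq_sym.
rewrite fctE /GRing.scale /=; congr (_ * _).
rewrite /ctr1 mem_imset // sg_push; case: ifP => // _.
by rewrite imsetU imset_set1.
Qed.

Lemma ev_pull l (u : 'I_l -> 'I_M -> C) (w : {set 'I_M'} -> C) :
  ev u (fun A => w (j @: A)) = ev (fun i => push (u i)) w.
Proof.
elim: l u w => [|l IH] u w; first by rewrite !ev0 imset0.
rewrite !evS -IH; congr ev; apply/funext => A; exact: ctr_pull.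
Qed.

End Push.

Section Forms.
Variables (R : realType) (N : nat).
Local Notation E := 'rV[R]_N.
Local Notation C := R[i].
Local Notation simplex := (osimplex R N).
Implicit Types (F G T : simplex) (x : E).

Lemma dform_sumE k (J : Type) (r : seq J) (P : pred J) (f : J -> dform R N k) x v :
  (\sum_(i <- r | P i) f i) x v = \sum_(i <- r | P i) f i x v.
Proof. by apply: (big_morph (fun f : dform R N k => f x v)). Qed.

(** Substitution of b_i for t_i and db_i for dt_i. The family b need not be all the coordinates of
    one simplex, so a form written for F can be placed on any simplex containing F. *)
Definition pform M l (b db : 'I_M -> E -> R) (w : ('I_M -> R) -> {set 'I_M} -> C) :
  dform R N l := fun x v => ev (fun a => toC (fun i => db i (v a))) (w (fun i => b i x)).

Definition fform F l w : dform R N l := pform (bary F) (dbary F) w.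
Arguments fform F {l} w.

Lemma dlambda_det F l (s : 'I_l -> 'I_(sdim F).+1) x v :
  dlambda F s x v = \det (\matrix_(i, a) (dbary F (s i) (v a))%:C%C).
Proof.
elim: l s v => [|l IH] s v /=; first by rewrite det_mx00.
rewrite /form_wedge; apply: (canLR (mulKf _)).
  by rewrite pnatr_eq0 -lt0n muln_gt0 !fact_gt0.
rewrite -(@sum_det_blocks _ 1 l (fun i a => (dbary F (s i) (v a))%:C%C)).
apply: eq_bigr => p _; congr (_ * (_ * _)); last first.
  rewrite IH; congr (\det _); apply/matrixP => i a; rewrite !mxE.
  by congr (dbary F (s _) _)%:C%C; apply: val_inj.
rewrite det_mx11 mxE /oneform; congr (dbary F (s _) _)%:C%C.
exact: val_inj.
Qed.

Lemma dlambdaE F M (j : 'I_M -> 'I_(sdim F).+1) l (s : 'I_l -> 'I_M) x v :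
  dlambda F (fun i => j (s i)) x v =
  ev (fun a => toC (fun i => dbary F (j i) (v a))) (extprod (fun i => ebasis C (s i))).
Proof.
rewrite dlambda_det -det_ev; congr (\det _); apply/matrixP => i a; rewrite !mxE.
by rewrite ebasis_pairr.
Qed.

(** By [ctr_extprod], once the sign epsilon is recognised as (-1)^i: moving the entry at position i
    to the front is a cycle of parity i. *)
Lemma whitneyE F M (j : 'I_M -> 'I_(sdim F).+1) l (s : 'I_l.+1 -> 'I_M) x v :
  whitney F (fun i => j (s i)) x v =
  ev (fun a => toC (fun i => dbary F (j i) (v a)))
     (ctr (toC (fun i => bary F (j i) x)) (extprod (fun i => ebasis C (s i)))).
Proof.
rewrite ctr_extprod linear_sum /whitney dform_sumE; apply: eq_bigr => i _.
rewrite linearZ /= ebasis_pairr -(dlambdaE j _ x).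
rewrite -[LHS]/((-1) ^+ _ * ((bary F (j (s i)) x)%:C%C * _)) mulrA; congr (_ * _ * _).
rewrite odd_lift_perm odd_perm1 addbF /=.
by rewrite signr_odd.
Qed.

Lemma form_wedge_pform M k l (b db : 'I_M -> E -> R) (w h : ('I_M -> R) -> {set 'I_M} -> C) x v :
  (forall t, homog k (w t)) -> (forall t, homog l (h t)) ->
  form_wedge (pform (l := k) b db w) (pform (l := l) b db h) x v =
  pform b db (fun t => wdg (w t) (h t)) x v.
Proof. by move=> wk hl; rewrite /pform -ev_wdg. Qed.

Lemma pform_sumE M l (b db : 'I_M -> E -> R) (w : ('I_M -> R) -> {set 'I_M} -> C) x v :
  pform (l := l) b db w x v = \sum_A w (fun i => b i x) A *
    ev (fun a => toC (fun i => db i (v a))) (set_delta C A).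
Proof.
rewrite /pform [in LHS](fam_sum_delta (w _)) linear_sum.
by apply: eq_bigr => A _; rewrite linearZ.
Qed.

Lemma monomial_push T M (j : 'I_M -> 'I_(sdim T).+1) (al : 'I_M -> nat) x :
  \prod_i bary T (j i) x ^+ al i = monomial T (push j al) x.
Proof.
rewrite /monomial (partition_big j predT) //=; apply: eq_bigr => i _.
rewrite /push expr_sum; apply: eq_bigr => a /eqP -> //.
Qed.

Lemma multi_index_push M M' (j : 'I_M -> 'I_M') s (al : 'I_M -> nat) :
  multi_index s al -> multi_index s (push j al).
Proof.
move=> <-; congr Posz; rewrite /push (exchange_big_dep xpredT) //=.
by apply: eq_bigr => a _; rewrite (big_pred1 (j a)) // => i; rewrite eq_sym.
Qed.

Lemma lspan_mem (V : lmodType C) (G : set V) v : G v -> v \in lspan G.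
Proof.
move=> Gv; apply/asboolP; exists 1%N, (fun=> 1), (fun=> v); split=> //.
by rewrite big_ord_recl big_ord0 addr0 scale1r.
Qed.

Section Members.
Variables (T : simplex) (M : nat) (j : 'I_M -> 'I_(sdim T).+1).
Hypothesis jinc : forall a b : 'I_M, (a < b)%N -> (j a < j b)%N.
Local Notation b := (fun i => bary T (j i)).
Local Notation db := (fun i => dbary T (j i)).

(** Stated for coordinates selected by j, so that it covers both the lift on T itself, for j the
    identity, and a test form of a face placed on T. *)
Lemma PLambda_mem s l (w : ('I_M -> R) -> {set 'I_M} -> C) : hform s l w ->
  trace T (pform b db w) \in PLambda s l T.
Proof.
move=> [hw wl].
have -> : trace T (pform (l := l) b db w) = \sum_A trace T (fun x v => w (fun i => b i x) A *
    ev (fun a => toC (fun i => db i (v a))) (set_delta C A)).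
  rewrite -linear_sum; apply: eq_trace => x v _ _; rewrite dform_sumE; exact: pform_sumE.
apply: rpred_sum => A _.
have [Al|Al] := eqVneq #|A| l; last first.
  rewrite (_ : (fun x v => _) = 0) ?linear0 ?rpred0 //.
  by apply/funext => x; apply/funext => v; rewrite wl // mul0r.
have [s' s'inc ->] := set_delta_extprod C Al.
have [J [c [al [als Ew]]]] := hom_monomials (hw A).
rewrite (_ : (fun x v => _) = \sum_i c i *:
    scale_form (monomial T (push j (al i))) (dlambda T (fun i => j (s' i)))).
  rewrite linear_sum; apply: rpred_sum => i _; rewrite linearZ; apply: rpredZ.
  apply: lspan_mem; exists (push j (al i)), (fun i => j (s' i)); split=> //.
    exact: multi_index_push.
  by move=> a a' aa'; apply/jinc/s'inc.
apply/funext => x; apply/funext => v; rewrite dform_sumE Ew mulr_suml.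
apply: eq_bigr => i _; rewrite -mulrA; congr (_ * _).
by rewrite /scale_form -monomial_push -(dlambdaE j _ x).
Qed.

Lemma PminusLambda_mem s l (c : ('I_M -> R) -> {set 'I_M} -> C) : hform (s - 1) l.+1 c ->
  trace T (pform b db (fun t => ctr (toC t) (c t))) \in PminusLambda s l T.
Proof.
move=> [hc cl].
have -> : trace T (pform (l := l) b db (fun t => ctr (toC t) (c t))) =
    \sum_A trace T (fun x v => c (fun i => b i x) A *
    ev (fun a => toC (fun i => db i (v a))) (ctr (toC (fun i => b i x)) (set_delta C A))).
  rewrite -linear_sum; apply: eq_trace => x v _ _; rewrite dform_sumE.
  rewrite /pform [in LHS](fam_sum_delta (c _)) ctr_sum linear_sum.
  by apply: eq_bigr => A _; rewrite linearZ.
apply: rpred_sum => A _.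
have [Al|Al] := eqVneq #|A| l.+1; last first.
  rewrite (_ : (fun x v => _) = 0) ?linear0 ?rpred0 //.
  by apply/funext => x; apply/funext => v; rewrite cl // mul0r.
have [s' s'inc ->] := set_delta_extprod C Al.
have [J [d [al [als Ew]]]] := hom_monomials (hc A).
rewrite (_ : (fun x v => _) = \sum_i d i *:
    scale_form (monomial T (push j (al i))) (whitney T (fun i => j (s' i)))).
  rewrite linear_sum; apply: rpred_sum => i _; rewrite linearZ; apply: rpredZ.
  apply: lspan_mem; exists (push j (al i)), (fun i => j (s' i)); split=> //.
    exact: multi_index_push.
  by move=> a a' aa'; apply/jinc/s'inc.
apply/funext => x; apply/funext => v; rewrite dform_sumE Ew mulr_suml.
apply: eq_bigr => i _; rewrite -mulrA; congr (_ * _).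
by rewrite /scale_form -monomial_push -whitneyE.
Qed.

End Members.

Lemma lspan_ind (V : lmodType C) (G : set V) (Q : V -> Prop) :
  Q 0 -> (forall a u v, Q u -> Q v -> Q (a *: u + v)) -> (forall v, G v -> Q v) ->
  forall v, v \in lspan G -> Q v.
Proof.
move=> Q0 QD QG v /asboolP[p [c [g [Gg ->]]]].
elim/big_rec: _ => // i u _; apply: QD; exact/QG.
Qed.

Lemma PLambda_rep s l F (w : dform R N l) : w \in PLambda s l F ->
  exists2 q, hform s l q & w = trace F (fform F q).
Proof.
move: w; apply: (@lspan_ind _ _ (fun w => exists2 q, hform s l q & w = trace F (fform F q))) => [|a _ _ [q hq ->] [q' hq' ->]|_ [al [sg [als sinc ->]]]].
- exists (fun=> 0); first exact: hform0.
  rewrite -[LHS](linear0 (trace F)); apply: eq_trace => x v _ _.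
  by rewrite /fform /pform linear0.
- exists (fun t => a *: q t + q' t); first by apply: hformD => //; exact: hformZ.
  rewrite -linearP; apply: eq_trace => x v _ _.
  by rewrite /fform /pform linearP.
- exists (fun t => (\prod_i t i ^+ al i)%:C%C *: extprod (fun i => ebasis C (sg i))).
    split=> [A|t]; last by apply: homogZ; exact: homog_extprod.
    rewrite -als; apply: eq_hom (homZ (extprod (fun i => ebasis C (sg i)) A) (hom_monomial R al)) _.
    by move=> t; rewrite mulrC.
  apply: eq_trace => x v _ _; rewrite /fform /pform linearZ /=.
  by rewrite /scale_form (@dlambdaE F _ id).
Qed.

Lemma PminusLambda_rep s l F (w : dform R N l) : w \in PminusLambda s l F ->
  exists2 c, hform (s - 1) l.+1 c & w = trace F (fform F (fun t => ctr (toC t) (c t))).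
Proof.
move: w; apply: (@lspan_ind _ _ (fun w => exists2 c, hform (s - 1) l.+1 c &
  w = trace F (fform F (fun t => ctr (toC t) (c t))))) => [|a _ _ [q hq ->] [q' hq' ->]|_ [al [sg [als sinc ->]]]].
- exists (fun=> 0); first exact: hform0.
  rewrite -[LHS](linear0 (trace F)); apply: eq_trace => x v _ _.
  by rewrite /fform /pform !linear0.
- exists (fun t => a *: q t + q' t); first by apply: hformD => //; exact: hformZ.
  rewrite -linearP; apply: eq_trace => x v _ _.
  by rewrite /fform /pform !linearP.
- exists (fun t => (\prod_i t i ^+ al i)%:C%C *: extprod (fun i => ebasis C (sg i))).
    split=> [A|t]; last by apply: homogZ; exact: homog_extprod.
    rewrite -als; apply: eq_hom (homZ (extprod (fun i => ebasis C (sg i)) A) (hom_monomial R al)) _.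
    by move=> t; rewrite mulrC.
  apply: eq_trace => x v _ _; rewrite /fform /pform !linearZ /=.
  by rewrite /scale_form (@whitneyE F _ id).
Qed.

Lemma trace_restr G T (j : 'I_(sdim G).+1 -> 'I_(sdim T).+1) l w :
  (forall a b : 'I_(sdim G).+1, (a < b)%N -> (j a < j b)%N) -> (forall a, T`_(j a) = G`_a) ->
  trace G (fform T w : dform R N l) = trace G (fform G (pull j w)).
Proof.
move=> jinc jE; apply: eq_trace => x v Gx Gv; rewrite /fform /pform /pull ev_pull //.
have -> : (fun i => bary T i x) = push j (fun i => bary G i x).
  by apply/funext => i; exact: (bary_push jE).
congr ev; apply/funext => a; rewrite -toC_push; congr toC; apply/funext => i.
exact: (dbary_push jE).
Qed.

End Forms.
Arguments fform {R N} F {l} w.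

(** * Duality on a simplex *)

Section ComplexCorner.
Variable R : realType.
Local Notation C := R[i].
Implicit Types (g h : seq R -> C).

Definition cpfun g := pfun (fun u => complex.Re (g u)) /\ pfun (fun u => complex.Im (g u)).

Lemma cpfun_cst c : cpfun (fun=> c). Proof. by split; exact: pfun_cst. Qed.

Lemma pfunN (f : seq R -> R) : pfun f -> pfun (fun u => - f u).
Proof.
move=> pf; have -> : (fun u => - f u) = (fun u => -1 * f u) by apply/funext => u; rewrite mulN1r.
by apply: pfunM => //; exact: pfun_cst.
Qed.

Lemma cpfunD g h : cpfun g -> cpfun h -> cpfun (fun u => g u + h u).
Proof.
move=> [g1 g2] [h1 h2]; split.
  have -> : (fun u => complex.Re (g u + h u)) = fun u => complex.Re (g u) + complex.Re (h u).
    by apply/funext => u; case: (g u) (h u) => ? ? [].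
  exact: pfunD.
have -> : (fun u => complex.Im (g u + h u)) = fun u => complex.Im (g u) + complex.Im (h u).
  by apply/funext => u; case: (g u) (h u) => ? ? [].
exact: pfunD.
Qed.

Lemma cpfunM g h : cpfun g -> cpfun h -> cpfun (fun u => g u * h u).
Proof.
move=> [g1 g2] [h1 h2]; split.
  have -> : (fun u => complex.Re (g u * h u)) = fun u =>
      complex.Re (g u) * complex.Re (h u) + - (complex.Im (g u) * complex.Im (h u)).
    by apply/funext => u; case: (g u) (h u) => ? ? [].
  by apply: pfunD; [exact: pfunM|apply: pfunN; exact: pfunM].
have -> : (fun u => complex.Im (g u * h u)) = fun u =>
    complex.Re (g u) * complex.Im (h u) + complex.Im (g u) * complex.Re (h u).
  by apply/funext => u; case: (g u) (h u) => ? ? [].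
by apply: pfunD; exact: pfunM.
Qed.

Lemma cpfun_real (f : seq R -> R) : pfun f -> cpfun (fun u => (f u)%:C%C).
Proof. by move=> pf; split=> //=; exact: pfun_cst. Qed.

Lemma cpfun_sum (J : Type) (r : seq J) (P : pred J) (F : J -> seq R -> C) :
  (forall i, cpfun (F i)) -> cpfun (fun u => \sum_(i <- r | P i) F i u).
Proof.
move=> pF; elim: r => [|i r IH].
  have -> : (fun u => \sum_(i <- [::] | P i) F i u) = fun=> 0 by apply/funext => u; rewrite big_nil.
  exact: cpfun_cst.
have -> : (fun u => \sum_(k <- i :: r | P k) F k u) =
    fun u => (if P i then F i u else 0) + \sum_(k <- r | P k) F k u.
  by apply/funext => u; rewrite big_cons; case: ifP; rewrite ?add0r.
by apply: cpfunD => //; case: (P i) => //; exact: cpfun_cst.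
Qed.

Definition corner_cintegral m g : C :=
  (corner_integral m 1 (fun u => complex.Re (g u)) +i*
   corner_integral m 1 (fun u => complex.Im (g u)))%C.

Lemma corner_cintegral_lin m a g h : cpfun g -> cpfun h ->
  corner_cintegral m (fun u => a * g u + h u) = a * corner_cintegral m g + corner_cintegral m h.
Proof.
move=> [g1 g2] [h1 h2]; case: a => a b; rewrite /corner_cintegral.
have lin2 x y f1 f2 f3 : pfun f1 -> pfun f2 -> pfun f3 ->
    corner_integral m 1 (fun u => (x * f1 u + y * f2 u : R) + f3 u) =
    x * corner_integral m 1 f1 + y * corner_integral m 1 f2 + corner_integral m 1 f3.
  move=> p1 p2 p3.
  have p12 : pfun (fun u => x * f1 u + y * f2 u).
    by apply: pfunD; apply: pfunM => //; exact: pfun_cst.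
  rewrite -(corner_integral_lin m x y ler01 p1 p2).
  have := corner_integral_lin m 1 1 ler01 p12 p3; rewrite !mul1r => <-.
  by congr corner_integral; apply/funext => u; rewrite !mul1r.
apply/eqP; rewrite eq_complex /=; apply/andP; split; apply/eqP.
  rewrite -mulNr -lin2 //; congr corner_integral; apply/funext => u.
  by case: (g u) (h u) => ? ? [? ?] /=; rewrite mulNr.
rewrite -lin2 //; congr corner_integral; apply/funext => u.
by case: (g u) (h u) => ? ? [].
Qed.

End ComplexCorner.

(** * The integral over a simplex in barycentric coordinates *)

Section SimplexIntegral.
Variables (R : realType) (N : nat).
Local Notation E := 'rV[R]_N.
Local Notation C := R[i].
Variable (F : osimplex R N).
Local Notation I := 'I_(sdim F).+1.
Implicit Types (u : seq R) (t : I -> R).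

Definition corner_bary u : I -> R := fun i =>
  if unlift ord0 i is Some j then u`_j else 1 - \sum_(j < sdim F) u`_j.

Definition corner_point u : E := F`_0 + \sum_(i < sdim F) u`_i *: (F`_i.+1 - F`_0).

Lemma corner_bary0 u : corner_bary u ord0 = 1 - \sum_(j < sdim F) u`_j.
Proof. by rewrite /corner_bary unlift_none. Qed.

Lemma corner_baryS u j : corner_bary u (lift ord0 j) = u`_j.
Proof. by rewrite /corner_bary liftK. Qed.

Lemma sum_corner_bary u : \sum_i corner_bary u i = 1.
Proof.
rewrite big_ord_recl corner_bary0 (eq_bigr _ (fun j _ => corner_baryS u j)).
by rewrite subrK.
Qed.

Lemma corner_pointE u : corner_point u = \sum_i corner_bary u i *: F`_i.
Proof.
rewrite big_ord_recl corner_bary0 /corner_point scalerBl scale1r -addrA; congr (_ + _).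
rewrite scaler_suml addrC -sumrB; apply: eq_bigr => j _.
by rewrite corner_baryS scalerBr.
Qed.

Lemma corner_bary_ge0 u i : corner (sdim F) 1 u -> 0 <= corner_bary u i.
Proof.
move=> [um u0 u1]; rewrite /corner_bary; case: unliftP => [j _|_]; first exact: u0.
by rewrite subr_ge0; move: u1; rewrite (big_nth 0) big_mkord um.
Qed.

Lemma corner_point_hull u : corner (sdim F) 1 u -> hull F (corner_point u).
Proof.
move=> uc; exists (corner_bary u); split; [move=> i; exact: corner_bary_ge0|exact: sum_corner_bary|exact: corner_pointE].
Qed.

Lemma bary_corner_point u : (fun i => bary F i (corner_point u)) = corner_bary u.
Proof.
by apply/funext => i; rewrite corner_pointE bary_comb // sum_corner_bary.
Qed.

Lemma edge_tangent i : (i < sdim F)%N -> tangent F (F`_i.+1 - F`_0).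
Proof.
move=> iF; apply: hullB_tangent; last exact: (vertex_hull ord0).
exact: (@vertex_hull _ _ F (Ordinal (iF : i.+1 < (sdim F).+1)%N)).
Qed.

Lemma pfun_corner_bary i : pfun (corner_bary^~ i).
Proof.
rewrite /corner_bary; case: unliftP => [j _|_]; first exact: pfun_coord.
apply: pfunD; [exact: pfun_cst|apply: pfunN].
elim: (sdim F) => [|n IH].
  have -> : (fun u => \sum_(j < 0) u`_j) = fun=> 0 by apply/funext => u; rewrite big_ord0.
  exact: pfun_cst.
have -> : (fun u => \sum_(j < n.+1) u`_j) = fun u => \sum_(j < n) u`_j + u`_n.
  by apply/funext => u; rewrite big_ord_recr.
by apply: pfunD => //; exact: pfun_coord.
Qed.

Lemma hom_cpfun s (f : (I -> R) -> C) : hom s f -> cpfun (fun u => f (corner_bary u)).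
Proof.
elim=> [c|s'|s' i g _ IH|s' g h _ IHg _ IHh]; [exact: cpfun_cst|exact: cpfun_cst| |exact: cpfunD].
by apply: cpfunM => //; apply: cpfun_real; exact: pfun_corner_bary.
Qed.

Definition edge_value d (w : dform R N d) u : C := w (corner_point u) (fun j => F`_j.+1 - F`_0).

(** Agreement with a polynomial is asked on the corner only, because a trace is zero off the
    simplex. *)
Definition integrable_form d (w : dform R N d) :=
  exists2 g, cpfun g & forall u, corner (sdim F) 1 u -> edge_value w u = g u.

Lemma integral_formE o d (w : dform R N d) g :
  (forall u, corner (sdim F) 1 u -> edge_value w u = g u) ->
  integral_form F o w = (-1) ^+ o * corner_cintegral (sdim F) g.
Proof.
move=> wg; rewrite /integral_form /corner_cintegral; congr (_ * Complex _ _);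
  by apply: eq_corner_integral => // u uc; rewrite -wg.
Qed.

Lemma integral_form_lin o d a (w w' : dform R N d) :
  integrable_form w -> integrable_form w' ->
  integral_form F o (a *: w + w') = a * integral_form F o w + integral_form F o w'.
Proof.
move=> [g pg wg] [g' pg' wg'].
rewrite (integral_formE _ wg) (integral_formE _ wg').
rewrite (integral_formE o (g := fun u => a * g u + g' u)) => [|u uc]; last first.
  by rewrite -wg // -wg'.
by rewrite corner_cintegral_lin //; ring.
Qed.

Section Pairing.
Variables (k l : nat).
Hypothesis klF : (k + l)%N = sdim F.
Implicit Types (w h : (I -> R) -> {set I} -> C).

Lemma form_wedge_trace (w : dform R N k) (h : dform R N l) x v :
  hull F x -> (forall i, tangent F (v i)) ->
  form_wedge (trace F w) (trace F h) x v = form_wedge w h x v.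
Proof.
move=> Fx Fv; rewrite /form_wedge; congr (_ * _); apply: eq_bigr => s _.
by rewrite !traceE.
Qed.

(** The edges at vertex 0 turn the value of w /\ h into the top coefficient of S /\ w /\ h, where S
    is absorbed into the first factor. *)
Lemma edge_value_wedge w h u : (forall t, homog k (w t)) -> (forall t, homog l (h t)) ->
  corner (sdim F) 1 u ->
  edge_value (form_wedge (trace F (fform F w : dform R N k)) (trace F (fform F h : dform R N l))) u =
  top (ext (fun=> 1) (w (corner_bary u))) (h (corner_bary u)).
Proof.
move=> wk hl uc; rewrite /edge_value form_wedge_trace; first last.
- by move=> i; apply: edge_tangent; rewrite -klF ltn_ord.
- exact: corner_point_hull.
rewrite form_wedge_pform // /pform bary_corner_point.
have e : (sdim F).+1 = (k + l).+1 by rewrite klF.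
rewrite (ev_top_edges _ e) => [|j i]; first by rewrite ext_wdg wdg_setT.
have jF : (j.+1 < (sdim F).+1)%N by rewrite e ltnS ltn_ord.
rewrite /toC dbaryB.
rewrite -[F`_j.+1]/(F`_(Ordinal jF)) -[F`_0]/(F`_(@ord0 (sdim F))) !bary_vertex.
by rewrite rmorphB !rmorph_nat.
Qed.

Lemma integrable_wedge s s' w h : hform s k w -> hform s' l h ->
  integrable_form (form_wedge (trace F (fform F w : dform R N k)) (trace F (fform F h : dform R N l))).
Proof.
move=> hw hh; exists (fun u => top (ext (fun=> 1) (w (corner_bary u))) (h (corner_bary u))).
  rewrite /top; apply: cpfun_sum => A; apply: cpfunM; last first.
    by have := hom_cpfun (hh.1 (~: A)).
  apply: cpfunM; first exact: cpfun_cst.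
  by have := hom_cpfun ((hform_ext (fun=> 1) hw).1 A).
by move=> u uc; rewrite edge_value_wedge //; [exact: hw.2|exact: hh.2].
Qed.

End Pairing.

(** Up to sign the integrand is the nonnegative polynomial sum_B t_B |q_B|^2. It vanishes inside the
    simplex, where all weights are positive, so q vanishes there, and by homogeneity on the closed
    orthant. *)
Lemma pos_pairing o d (n : nat) (w : dform R N d) s l q : hform s l q ->
  (forall u, corner (sdim F) 1 u -> edge_value w u = (-1) ^+ n *
     \sum_(B : {set I}) \prod_(i in B) toC (corner_bary u) i * (q (corner_bary u) B * (q (corner_bary u) B)^*%C)) ->
  integral_form F o w = 0 -> forall t, (forall i, 0 <= t i) -> q t = 0.
Proof.
move=> [hq ql] wq w0.
pose f u : R := \sum_(B : {set I}) \prod_(i in B) corner_bary u i *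
  (complex.Re (q (corner_bary u) B) ^+ 2 + complex.Im (q (corner_bary u) B) ^+ 2).
have fE u : (f u)%:C%C = \sum_(B : {set I}) \prod_(i in B) toC (corner_bary u) i *
    (q (corner_bary u) B * (q (corner_bary u) B)^*%C).
  rewrite rmorph_sum; apply: eq_bigr => B _; rewrite rmorphM rmorph_prod; congr (_ * _).
  case: (q _ B) => a b; simpc; rewrite !expr2; congr Complex; ring.
have pf : pfun f.
  have : cpfun (fun u => (f u)%:C%C).
    have -> : (fun u => (f u)%:C%C) = fun u => \sum_(B : {set I})
        (\prod_(i in B) (corner_bary u i)%:C%C * q (corner_bary u) B) * (q (corner_bary u) B)^*%C.
      by apply/funext => u; rewrite fE; apply: eq_bigr => B _; rewrite mulrA.
    apply: cpfun_sum => B; apply: cpfunM; first exact: (hom_cpfun (hom_prod B (hq B))).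
    exact: (hom_cpfun (hom_conj (hq B))).
  by case.
have f0 : corner_integral (sdim F) 1 f = 0.
  move/eqP: w0; rewrite (integral_formE _ wq) mulf_eq0 signr_eq0 /=.
  rewrite /corner_cintegral eq_complex => /andP[/eqP /= + _].
  have -> : (fun u => complex.Re ((-1) ^+ n * \sum_(B : {set I}) \prod_(i in B) toC (corner_bary u) i *
      (q (corner_bary u) B * (q (corner_bary u) B)^*%C))) = fun u => (-1) ^+ n * f u + 0 * f u.
    apply/funext => u; rewrite -fE mul0r addr0.
    rewrite -[in LHS]signr_odd -[in RHS]signr_odd.
    by case: (odd n); rewrite ?expr1 ?expr0 ?mulN1r ?mul1r.
  rewrite corner_integral_lin ?ler01 // mul0r addr0 => /eqP.
  by rewrite mulf_eq0 signr_eq0 => /eqP.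
have fge0 u : corner (sdim F) 1 u -> 0 <= f u.
  move=> uc; apply: sumr_ge0 => B _; apply: mulr_ge0.
    by apply: prodr_ge0 => i _; exact: corner_bary_ge0.
  by rewrite addr_ge0 // sqr_ge0.
move=> t t0; apply/funext => B; move: t t0.
apply: (hom_eq0 _ (hq B)) => // t tpos t1.
pose u := [seq t (lift ord0 i) | i <- enum 'I_(sdim F)].
have um : size u = sdim F by rewrite size_map size_enum_ord.
have uE (i : 'I_(sdim F)) : u`_i = t (lift ord0 i).
  by rewrite (nth_map i) ?size_enum_ord // nth_ord_enum.
have us : \sum_(x <- u) x = 1 - t ord0.
  by rewrite big_map big_enum /= -t1 [in RHS]big_ord_recl addrC addKr.
have tu : corner_bary u = t.
  apply/funext => i; rewrite /corner_bary; case: unliftP => [i' ->|->]; first exact: uE.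
  rewrite -t1 big_ord_recl; under [X in _ - X]eq_bigr do rewrite uE.
  by rewrite addrK.
have uc : corner (sdim F) 1 u.
  split=> // [i|]; last by rewrite us gerBl ltW.
  have [iF|iF] := ltnP i (sdim F); last by rewrite nth_default ?um.
  by rewrite (uE (Ordinal iF)) ltW.
have := corner_integral_eq0 ltr01 pf fge0 f0 uc.
rewrite us gtrBl => /(_ (tpos _)) /eqP; rewrite /f tu psumr_eq0 => [|A _]; last first.
  by rewrite mulr_ge0 ?addr_ge0 ?sqr_ge0 // prodr_ge0 // => i _; rewrite ltW.
move=> /allP/(_ B (mem_index_enum _))/=; rewrite mulf_eq0 => /orP[|].
  by rewrite prodf_seq_eq0 => /hasP[i _ /andP[_]]; rewrite gt_eqF.
rewrite paddr_eq0 ?sqr_ge0 // !sqrf_eq0 => /andP[/eqP a0 /eqP b0].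
by apply/eqP; rewrite eq_complex a0 b0 !eqxx.
Qed.

(** If S /\ W = 0, then W is S /\ (W contracted with e_0), as S takes the value 1 on e_0. And S
    vanishes on tangent vectors, because the dlambda_i sum to zero. *)
Lemma trace_fform_ext0 k (w : (I -> R) -> {set I} -> C) :
  (forall t, (forall i, 0 <= t i) -> ext (fun=> 1) (w t) = 0) ->
  trace F (fform F w : dform R N k) = 0.
Proof.
move=> w0; rewrite -(linear0 (trace F)); apply: eq_trace => x v Fx Fv.
have [b0 _ _] := hullP Fx; rewrite /fform /pform; set W := w _.
have -> : W = ext (fun=> 1) (ctr (ebasis C ord0) W).
  apply/eqP; rewrite -subr_eq0 -[W in W - _]scale1r.
  have := ctr_ext (ebasis C ord0) (fun=> 1) W; rewrite w0 // linear0.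
  by rewrite ebasis_pair => <-.
apply: ev_ext0 => a; under eq_bigr do rewrite mulr1.
by rewrite /toC -rmorph_sum (tangent_sum (Fv a)).1.
Qed.

End SimplexIntegral.

(** * Definiteness and vanishing on one simplex *)

Section LocalDuality.
Variables (R : realType) (N : nat).
Local Notation C := R[i].
Variables (F : osimplex R N) (o : bool) (k l : nat).
Hypothesis klF : (k + l)%N = sdim F.
Local Notation I := 'I_(sdim F).+1.
Local Notation tr w := (trace F (fform F w)).
Local Notation tfam := ((I -> R) -> {set I} -> C).
Implicit Types (w h q c : tfam) (t : I -> R).

Let kl1 : (k + l.+1)%N = (sdim F).+1. Proof. by rewrite addnS klF. Qed.
Let k1l : (k.+1 + l)%N = (sdim F).+1. Proof. by rewrite addSn klF. Qed.

(* The integrands of these against kappa c and a are, up to sign,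
   \sum_B t_B |(kappa c) B|^2 and \sum_B t_B |(S /\ a) B|^2. *)
Definition test_P c := fun t => star (toC t) (cj (c t)).
Definition test_Pminus (a : tfam) := fun t => ctr (toC t) (star (toC t) (cj (a t))).

Lemma hform_test_P s c : hform s l.+1 c -> hform (s + l.+1%:Z) k (test_P c).
Proof. by move=> /hform_conj; exact: hform_star. Qed.

Lemma hform_test_Pminus s (a : tfam) : hform s l a ->
  hform (s + l%:Z) k.+1 (fun t => star (toC t) (cj (a t))).
Proof. by move=> /hform_conj; exact: hform_star. Qed.

Lemma test_P_definite s c : hform s l.+1 c ->
  integral_form F o (form_wedge (tr (test_P c) : dform R N k)
    (tr (fun t => ctr (toC t) (c t)) : dform R N l)) = 0 ->
  tr (fun t => ctr (toC t) (c t)) = 0 :> dform R N l.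
Proof.
move=> hc int0; have hk := hform_ctr hc; have ht := hform_test_P hc.
have k0 := pos_pairing (n := k) hk _ int0.
apply: trace_fform_ext0 => t t0; rewrite k0 ?linear0 // => {t t0} u uc.
rewrite edge_value_wedge //; [|exact: ht.2|exact: hk.2].
rewrite /test_P (ext1_star (ht.2 _)) ctr_cj top_scale top_star; congr (_ * _).
by apply: eq_bigr => B _; rewrite /cj [_^*%C * _]mulrC.
Qed.

Lemma test_Pminus_definite s (a : tfam) : hform s l a ->
  integral_form F o (form_wedge (tr (test_Pminus a) : dform R N k)
    (tr a : dform R N l)) = 0 ->
  tr a = 0 :> dform R N l.
Proof.
move=> ha int0; have hs := hform_test_Pminus ha; have ht := hform_ctr hs.
have he := hform_ext (fun=> 1) ha.
(* One sign (-1)^k comes from carrying S across the test form, the other from rewriting kappa of a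
   star as the star of S /\ _. *)
have k0 := pos_pairing (n := k + k) he _ int0.
apply: trace_fform_ext0 => t t0; rewrite k0 // => {t t0} u uc.
rewrite edge_value_wedge //; [|exact: ht.2|exact: ha.2].
rewrite (top_ext _ _ (ht.2 _)) /test_Pminus (ctr_star_homog (hs.2 _)) ext_cj.
rewrite top_scale top_star mulrA -exprD; congr (_ * _).
by apply: eq_bigr => B _; rewrite /cj [_^*%C * _]mulrC.
Qed.

Section FacetVanishing.
Variable w : dform R N k.
Hypothesis w0 : forall G, subsimplex G F -> G != F -> trace G w = 0.

(** The facet opposite vertex i contains the given point and all other vertices, hence every segment
    needed to evaluate a coefficient at a set A without i. *)
Lemma facet_eval t (i : I) : (forall j, 0 <= t j) -> \sum_j t j = 1 -> t i = 0 ->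
  exists G, [/\ hull G (\sum_j t j *: F`_j), forall j : I, j != i -> hull G F`_j
    & trace G w = 0].
Proof.
move=> t0 t1 ti.
have F0 : (0 < sdim F)%N.
  rewrite lt0n; apply/eqP => F0; move/eqP: t1; rewrite (bigD1 i) //= ti add0r big1.
    by rewrite eq_sym oner_eq0.
  move=> j; case/eqP; apply: val_inj => /=; have := ltn_ord i; have := ltn_ord j; lia.
have [G [GF GnF Ghull]] := facetP i F0; exists G; split; [exact: Ghull| |exact: w0].
move=> j ji; have := Ghull (fun a => (a == j)%:R).
have -> : \sum_a (a == j)%:R *: F`_a = F`_j.
  rewrite (bigD1 j) //= eqxx scale1r big1 ?addr0 // => a /negbTE ->.
  by rewrite scale0r.
apply=> [a||]; first by rewrite ler0n.
  by rewrite (bigD1 j) //= eqxx big1 ?addr0 // => a /negbTE ->.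
by rewrite eq_sym (negbTE ji).
Qed.

End FacetVanishing.

(** The coefficient of S /\ w at A is the value of w on the edges joining the vertices in A, all of
    which are tangent to the facet opposite i. *)
Lemma ext1_facet0 w : (forall t, homog k (w t)) ->
  (forall G, subsimplex G F -> G != F -> trace G (fform F w : dform R N k) = 0) ->
  forall i t, (forall j, 0 <= t j) -> \sum_j t j = 1 -> t i = 0 ->
    forall A : {set I}, i \notin A -> ext (fun=> 1) (w t) A = 0.
Proof.
move=> wk w0 i t t0 t1 ti A iA.
have [Ak|Ak] := eqVneq #|A| k.+1; last by rewrite (homog_ext _ (wk t)).
have [s sinc As] := set_increasing_enum Ak.
have [G [Gx Gs Gw]] := facet_eval w0 t0 t1 ti.
have sA a : hull G F`_(s a).
  by apply: Gs; apply: contraNneq iA => <-; rewrite As; apply/imsetP; exists a.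
rewrite As -(ev_ebasis _ sinc) ev_edges => [|a]; last by rewrite ebasis_pair.
have := trace0P Gw Gx (v := fun a => F`_(s (lift ord0 a)) - F`_(s ord0)).
rewrite /fform /pform.
have -> : (fun j => bary F j (\sum_j t j *: F`_j)) = t.
  by apply/funext => j; rewrite bary_comb.
move=> <- => [|a]; last exact: hullB_tangent.
by apply: eq_ev => a j; rewrite /toC dbaryB !bary_vertex rmorphB !rmorph_nat /ebasis ![_ == j]eq_sym.
Qed.

(** Since kappa w = 0, each vertex of A may be replaced by the segment from the point to that
    vertex, which is tangent to the facet opposite i. *)
Lemma ctr_facet0 w : (forall t, homog k (w t)) -> (forall t, ctr (toC t) (w t) = 0) ->
  (forall G, subsimplex G F -> G != F -> trace G (fform F w : dform R N k) = 0) ->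
  forall i t, (forall j, 0 <= t j) -> \sum_j t j = 1 -> t i = 0 ->
    forall A : {set I}, i \notin A -> w t A = 0.
Proof.
move=> wk kw w0 i t t0 t1 ti A iA.
have [Ak|Ak] := eqVneq #|A| k; last by rewrite wk.
have [s sinc As] := set_increasing_enum Ak.
have [G [Gx Gs Gw]] := facet_eval w0 t0 t1 ti.
have sA a : hull G F`_(s a).
  by apply: Gs; apply: contraNneq iA => <-; rewrite As; apply/imsetP; exists a.
rewrite As -(ev_ebasis _ sinc) -(ev_shear _ (fun=> -1) (kw t)).
have := trace0P Gw Gx (v := fun a => F`_(s a) - \sum_j t j *: F`_j).
rewrite /fform /pform.
have tE : (fun j => bary F j (\sum_j t j *: F`_j)) = t.
  by apply/funext => j; rewrite bary_comb.
rewrite tE; move=> <- => [|a]; last exact: hullB_tangent.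
apply: eq_ev => a j; rewrite /toC dbaryB bary_vertex bary_comb // rmorphB rmorph_nat /ebasis.
by rewrite mulN1r eq_sym.
Qed.

(** Positivity of r makes S /\ w vanish at the origin, as the division by coordinates requires, and
    makes the total degree in [koszul] nonzero. It excludes a constant at a vertex, against which
    only c of degree -1, hence 0, could be tested. *)
Lemma trace_P_eq0 (r : nat) w : (0 < r)%N -> hform r k w ->
  (forall G, subsimplex G F -> G != F -> trace G (fform F w : dform R N k) = 0) ->
  (forall c, hform (r%:Z - l%:Z - 1) l.+1 c ->
     integral_form F o (form_wedge (tr w : dform R N k)
       (tr (fun t => ctr (toC t) (c t)) : dform R N l)) = 0) ->
  tr w = 0 :> dform R N k.
Proof.
case: r => // n _ hw w0 int0.
have ht := hform_ext (fun=> 1) hw.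
have [q hq qE] := star_div k1l ht (ext1_facet0 hw.2 w0).
have kq0 t : (forall j, 0 < t j) -> ctr (toC t) (q t) = 0.
  move=> t0; apply: (star_eq0 (t := toC t)).
    by move=> i; rewrite /toC -(rmorph0 (real_complex R)) (inj_eq (@complexI R)) gt_eqF.
  have hs : homog k.+1 (star (toC t) (q t)) by rewrite -qE; [exact: ht.2|move=> j; exact: ltW].
  have := ext1_star hs; rewrite -qE ?extK => [/esym/eqP|j]; last exact: ltW.
  by rewrite scaler_eq0 signr_eq0 => /eqP.
(* The total degree of q is r, whatever l is. *)
have sl : n.+1%:Z - l%:Z + l%:Z != 0 by rewrite subrK.
have [c hc cE] := koszul (ltn0Sn _) hq sl kq0.
have hcc := hform_conj hc.
have q0 := pos_pairing (n := 0) hq _ (int0 _ hcc).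
apply: trace_fform_ext0 => t t0; rewrite qE // q0 ?star0 // => {t t0} u uc.
have u0 (i : I) : 0 <= corner_bary u i by exact: corner_bary_ge0 uc.
rewrite (edge_value_wedge klF) //; [|exact: hw.2|exact: (hform_ctr hcc).2].
rewrite qE // -/(cj (c _)) ctr_cj -cE // top_star mul1r.
by [].
Qed.

Lemma trace_Pminus_eq0 (r : nat) c : hform (r%:Z - 1) k.+1 c ->
  (forall G, subsimplex G F -> G != F ->
    trace G (fform F (fun t => ctr (toC t) (c t)) : dform R N k) = 0) ->
  (forall a : tfam, hform (r%:Z - l%:Z - 1) l a ->
     integral_form F o (form_wedge (tr (fun t => ctr (toC t) (c t)) : dform R N k)
       (tr a : dform R N l)) = 0) ->
  tr (fun t => ctr (toC t) (c t)) = 0 :> dform R N k.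
Proof.
case: r => [|n] hc w0 int0.
  (* For r = 0 the coefficients of c have degree -1, so c is zero. *)
  apply: trace_fform_ext0 => t _; suff -> : c t = 0 by rewrite !linear0.
  by apply/funext => A; apply: (hom_neg (hc.1 A)).
have hw := hform_ctr hc; rewrite subrK in hw.
have kw t : ctr (toC t) (ctr (toC t) (c t)) = 0 by exact: ctrK.
have [q hq qE] := star_div kl1 hw (ctr_facet0 hw.2 kw w0).
have sq0 t : (forall j, 0 <= t j) -> ext (fun=> 1) (q t) = 0.
  move=> t0; apply/funext => A; move: t t0.
  apply: (hom_eq0 _ ((hform_ext (fun=> 1) hq).1 A)) => // t t0 _.
  suff -> : ext (fun=> 1) (q t) = 0 by [].
  apply: (star_eq0 (t := toC t)).
    by move=> i; rewrite /toC -(rmorph0 (real_complex R)) (inj_eq (@complexI R)) gt_eqF.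
  have t0' j : 0 <= t j by exact: ltW.
  have hs : homog k (star (toC t) (q t)) by rewrite -qE //; exact: hw.2.
  apply/funext => B; have := ctr_star (toC t) (q t) B; rewrite -qE // kw => /esym/eqP.
  by rewrite mulf_eq0 signr_eq0 /= => /eqP.
(* Exactness of S /\ _ needs no derivative: contraction with any vector on which S is 1 inverts it
   on its kernel, without changing the polynomial degree. *)
pose a : tfam := fun t => ctr1 ord0 (q t).
have ha : hform (n.+1%:Z - l%:Z - 1) l a.
  by have := hform_ctr1 ord0 hq; congr hform; lia.
have aE t : (forall j, 0 <= t j) -> q t = ext (fun=> 1) (a t).
  move=> t0; have := ctr_ext (ebasis C ord0) (fun=> 1) (q t).
  rewrite sq0 // linear0 ebasis_pair scale1r ebasis_ctr => /esym/eqP.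
  by rewrite subr_eq0 => /eqP.
have hac := hform_conj ha.
have q0 := pos_pairing (n := k) hq _ (int0 _ hac).
rewrite -(linear0 (trace F)); apply: eq_trace => x v Fx Fv.
have [b0 _ _] := hullP Fx; rewrite /fform /pform qE // q0 ?star0 ?linear0 //.
move=> {x v Fx Fv b0} u uc.
have u0 (i : I) : 0 <= corner_bary u i by exact: corner_bary_ge0 uc.
rewrite (edge_value_wedge klF) //; [|exact: hw.2|exact: hac.2].
rewrite (top_ext _ _ (hw.2 _)) qE // -/(cj (a _)) ext_cj -aE // top_star.
by [].
Qed.

End LocalDuality.

(** * Global forms *)

Section FormWedgeLinear.
Variables (R : realType) (N k l : nat).
Local Notation C := R[i].
Implicit Types (w : dform R N k) (h : dform R N l).

Lemma form_wedge_linl a w w' h :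
  form_wedge (a *: w + w') h = a *: form_wedge w h + form_wedge w' h.
Proof.
apply/funext => x; apply/funext => v.
rewrite -[RHS]/(a * form_wedge w h x v + form_wedge w' h x v) /form_wedge.
set z := _^-1; rewrite [in RHS]mulrCA -mulrDr [in RHS]mulr_sumr -big_split; congr (_ * _).
apply: eq_bigr => s _ /=; rewrite -[(a *: w + w') _ _]/(a * w _ _ + w' _ _).
by rewrite mulrDl mulrDr -mulrA [in RHS]mulrCA.
Qed.

Lemma form_wedge_linr a w h h' :
  form_wedge w (a *: h + h') = a *: form_wedge w h + form_wedge w h'.
Proof.
apply/funext => x; apply/funext => v.
rewrite -[RHS]/(a * form_wedge w h x v + form_wedge w h' x v) /form_wedge.
set z := _^-1; rewrite [in RHS]mulrCA -mulrDr [in RHS]mulr_sumr -big_split; congr (_ * _).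
apply: eq_bigr => s _ /=; rewrite -[(a *: h + h') _ _]/(a * h _ _ + h' _ _).
by rewrite mulrDr mulrDr [w _ _ * (a * _)]mulrCA [in RHS]mulrCA.
Qed.

Lemma form_wedge0l h : form_wedge (0 : dform R N k) h = 0.
Proof. by have := form_wedge_linl (-1) 0 0 h; rewrite scaleN1r oppr0 addr0 scaleN1r addNr. Qed.

Lemma form_wedge0r w : form_wedge w (0 : dform R N l) = 0.
Proof. by have := form_wedge_linr (-1) w 0 0; rewrite scaleN1r oppr0 addr0 scaleN1r addNr. Qed.

End FormWedgeLinear.

Section DualSpan.
Variables (K : fieldType) (V : lmodType K).

Definition is_linear_form (f : V -> K) := forall a u v, f (a *: u + v) = a * f u + f v.

(** Induction on the number of functionals, with no assumption on the dimension of V. If the first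
    functional is not redundant, some v0 killed by the others has phi v0 != 0, and it determines the
    coefficient c0. *)
Lemma dual_span (n : nat) (f : 'I_n -> V -> K) (phi : V -> K) :
  (forall i, is_linear_form (f i)) -> is_linear_form phi ->
  (forall v, (forall i, f i v = 0) -> phi v = 0) ->
  exists c : 'I_n -> K, forall v, phi v = \sum_i c i * f i v.
Proof.
elim: n f phi => [|n IH] f phi fL phiL ker.
  by exists (fun=> 0) => v; rewrite big_ord0; apply: ker => -[].
have [H|H] := pselect (forall v, (forall i, f (lift ord0 i) v = 0) -> phi v = 0).
  have [c cE] := IH _ _ (fun i => fL (lift ord0 i)) phiL H.
  exists (fun i => if unlift ord0 i is Some j then c j else 0) => v.
  rewrite big_ord_recl unlift_none mul0r add0r cE.
  by apply: eq_bigr => i _; rewrite liftK.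
have [v0 f0 phi0] : exists2 v0, forall i, f (lift ord0 i) v0 = 0 & phi v0 != 0.
  apply: contrapT => H'; apply: H => v fv; apply/eqP; apply: contrapT => pv.
  by apply: H'; exists v => //; apply/negP.
have fv0 : f ord0 v0 != 0.
  apply: contraNneq phi0 => e; apply/eqP/ker => i.
  by case: (unliftP ord0 i) => [j ->|->].
pose c0 := phi v0 / f ord0 v0.
have [||v fv|c cE] := IH (fun i => f (lift ord0 i)) (fun v => phi v - c0 * f ord0 v).
- by move=> i; exact: fL.
- by move=> a u v; rewrite phiL fL; ring.
(* v is corrected along v0 so that the first functional vanishes as well. *)
- have := ker (- (f ord0 v / f ord0 v0) *: v0 + v).
  rewrite phiL /c0 => e; rewrite -[RHS]e; first by ring.
  move=> i; rewrite fL; case: (unliftP ord0 i) => [j ->|->].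
    by rewrite f0 fv mulr0 addr0.
  by rewrite mulNr divfK // addNr.
exists (fun i => if unlift ord0 i is Some j then c j else c0) => v.
rewrite big_ord_recl unlift_none (eq_bigr (fun i => c i * f (lift ord0 i) v)).
  by rewrite -cE addrC subrK.
by move=> i _; rewrite liftK.
Qed.

Lemma dual_span_fin (J : finType) (f : J -> V -> K) (phi : V -> K) :
  (forall i, is_linear_form (f i)) -> is_linear_form phi ->
  (forall v, (forall i, f i v = 0) -> phi v = 0) ->
  exists c : J -> K, forall v, phi v = \sum_i c i * f i v.
Proof.
move=> fL phiL ker.
have [|v fv|c cE] := @dual_span #|J| (fun i => f (enum_val i)) phi _ phiL.
- by move=> i; exact: fL.
- by apply: ker => i; rewrite -(enum_rankK i).
exists (fun i => c (enum_rank i)) => v; rewrite cE (reindex (@enum_rank J)) /=.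
  by apply: eq_bigr => i _; rewrite enum_rankK.
exact/onW_bij/enum_rank_bij.
Qed.

End DualSpan.

Section VanishingForms.
Variables (R : realType) (N : nat).
Local Notation C := R[i].

(** Every term carries t_i or dt_i for each i, so the form vanishes on each simplex that misses a
    vertex. *)
Definition full_support M (w : ('I_M -> R) -> {set 'I_M} -> C) :=
  forall t (A : {set 'I_M}) i, t i = 0 -> i \notin A -> w t A = 0.

Lemma ev_vanish M l (u : 'I_l -> 'I_M -> C) (W : {set 'I_M} -> C) i :
  (forall A : {set 'I_M}, i \notin A -> W A = 0) -> (forall a, u a i = 0) -> ev u W = 0.
Proof.
elim: l u W => [|l IH] u W W0 u0; first by rewrite ev0 W0 // inE.
rewrite evS; apply: IH => // A iA; rewrite /ctr fct_sumE big1 // => b _.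
rewrite fctE; have [->|bi] := eqVneq b i; first by rewrite u0 scale0r.
rewrite /ctr1; case: ifP => _; first by rewrite scaler0.
by rewrite W0 ?mulr0 ?scaler0 // !inE negb_or eq_sym bi.
Qed.

Lemma pform_vanish M l (b db : 'I_M -> 'rV[R]_N -> R) w i : full_support w ->
  (forall x, b i x = 0) -> (forall x, db i x = 0) -> pform (l := l) b db w = 0.
Proof.
move=> wf b0 db0; apply/funext => x; apply/funext => v.
rewrite /pform; apply: (@ev_vanish _ _ _ _ i) => [A iA|a]; first exact: wf iA.
by rewrite /toC db0.
Qed.

Variables (T : osimplex R N).

(** Coordinates indexed by points instead of positions, zero at a point that is no vertex of T: one
    formula then makes sense on all simplices and is compatible with restriction. *)
Definition bary_at (p x : 'rV[R]_N) : R := \sum_(i < (sdim T).+1) (T`_i == p)%:R * bary T i x.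
Definition dbary_at (p v : 'rV[R]_N) : R := \sum_(i < (sdim T).+1) (T`_i == p)%:R * dbary T i v.

Lemma bary_at_vertex (i : 'I_(sdim T).+1) x : bary_at T`_i x = bary T i x.
Proof.
rewrite /bary_at (bigD1 i) //= eqxx mul1r big1 ?addr0 // => j ji.
by rewrite (inj_eq (@vertex_inj _ _ T)) (negbTE ji) mul0r.
Qed.

Lemma dbary_at_vertex (i : 'I_(sdim T).+1) x : dbary_at T`_i x = dbary T i x.
Proof.
rewrite /dbary_at (bigD1 i) //= eqxx mul1r big1 ?addr0 // => j ji.
by rewrite (inj_eq (@vertex_inj _ _ T)) (negbTE ji) mul0r.
Qed.

Lemma bary_at_out p x : p \notin (T : seq _) -> bary_at p x = 0.
Proof.
move=> pT; apply: big1 => i _; case: eqP => [e|_]; last by rewrite mul0r.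
by case/negP: pT; rewrite -e mem_nth // size_simplex.
Qed.

Lemma dbary_at_out p x : p \notin (T : seq _) -> dbary_at p x = 0.
Proof.
move=> pT; apply: big1 => i _; case: eqP => [e|_]; last by rewrite mul0r.
by case/negP: pT; rewrite -e mem_nth // size_simplex.
Qed.

End VanishingForms.

Section BaryAtRestr.
Variables (R : realType) (N : nat) (G T : osimplex R N).
Hypothesis GT : subsimplex G T.

Lemma bary_at_restr p x : hull G x -> bary_at T p x = bary_at G p x.
Proof.
have [j jinc jE] := subsimplexP GT => Gx; rewrite /bary_at.
under eq_bigr do rewrite (bary_push jE _ Gx) mulr_sumr.
rewrite (exchange_big_dep xpredT) //=; apply: eq_bigr => a _.
by rewrite (big_pred1 (j a)) ?jE // => i; rewrite eq_sym.
Qed.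

Lemma dbary_at_restr p v : tangent G v -> dbary_at T p v = dbary_at G p v.
Proof.
have [j jinc jE] := subsimplexP GT => Gv; rewrite /dbary_at.
under eq_bigr do rewrite (dbary_push jE _ Gv) mulr_sumr.
rewrite (exchange_big_dep xpredT) //=; apply: eq_bigr => a _.
by rewrite (big_pred1 (j a)) ?jE // => i; rewrite eq_sym.
Qed.

End BaryAtRestr.

(** * Test forms, directness and spanning on the triangulation *)

Section GlobalForms.
Variables (R : realType) (N n k : nat) (Tri : {fset osimplex R N}).
Local Notation C := R[i].
Local Notation simplex := (osimplex R N).
Hypothesis Tri_sub : forall T F : simplex, T \in Tri -> subsimplex F T -> F \in Tri.
Hypothesis Tri_cap : forall T T' : simplex, T \in Tri -> T' \in Tri ->
     hull T `&` hull T' = set0 \/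
     exists F : simplex, [/\ F \in Tri, subsimplex F T, subsimplex F T' &
                                  hull F = hull T `&` hull T'].
Hypothesis Tri_dim : forall T : simplex, T \in Tri -> (sdim T <= n)%N.

Lemma subsimplex_trans (F G H : simplex) : subsimplex F G -> subsimplex G H -> subsimplex F H.
Proof. exact: subseq_trans. Qed.

Lemma subsimplex_dim (F G : simplex) : subsimplex F G -> (sdim F <= sdim G)%N.
Proof. by move=> /size_subseq; rewrite !size_simplex. Qed.

Lemma subsimplex_eq (F G : simplex) : subsimplex F G -> (sdim G <= sdim F)%N -> F = G.
Proof.
move=> FG GF; apply: val_inj; apply/eqP.
by rewrite -(size_subseq_leqif FG) !size_simplex eqSS eqn_leq subsimplex_dim.
Qed.

Lemma Tri_cap_hull (H T T' : simplex) : T \in Tri -> T' \in Tri ->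
  hull H `<=` hull T -> hull H `<=` hull T' ->
  exists G : simplex, [/\ subsimplex G T, subsimplex G T', hull G = hull T `&` hull T' &
    hull H `<=` hull G].
Proof.
move=> TT TT' HT HT'; have [e|[G [_ GT GT' Ge]]] := Tri_cap TT TT'.
  have : (hull T `&` hull T') H`_0 by split; [apply: HT|apply: HT']; exact: (vertex_hull ord0).
  by rewrite e.
by exists G; split=> //; rewrite Ge => x Hx; split; [exact: HT|exact: HT'].
Qed.

(* subsimplex also compares vertex orders, but by Tri_cap two simplices of Tri
   order their common vertices in the same way. *)
Lemma missing_vertex (F T : simplex) : F \in Tri -> T \in Tri -> ~~ subsimplex F T ->
  exists i : 'I_(sdim F).+1, F`_i \notin (T : seq _).
Proof.
move=> FF TT FT; apply: contrapT => FT'; case/negP: FT.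
have FinT (i : 'I_(sdim F).+1) : F`_i \in (T : seq _).
  by apply: contrapT => /negP h; apply: FT'; exists i.
have ib (i : 'I_(sdim F).+1) : (index (F`_i)%R T < (sdim T).+1)%N.
  by rewrite -(size_simplex T) index_mem.
have FhT : hull F `<=` hull T.
  move=> _ [t [t0 t1 ->]]; exists (fun i => \sum_(a | Ordinal (ib a) == i) t a); split=> [i||].
  - by apply: sumr_ge0 => a _; exact: t0.
  - by rewrite sum_push1.
  by rewrite sum_push; apply: eq_bigr => a _; rewrite /= nth_index.
have [H [HF HT Hh FH]] := Tri_cap_hull FF TT (fun x => id) FhT.
have [j jinc jE] := subsimplexP HF.
suff FleH : (sdim F <= sdim H)%N by rewrite -(subsimplex_eq HF FleH).
rewrite -ltnS -[X in (X <= _)%N](card_ord (sdim F).+1) -[X in (_ <= X)%N](card_ord (sdim H).+1).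
rewrite -(card_codom (ord_inc_inj jinc)) subset_leq_card //.
(* A vertex of F that is not a vertex of H has a coordinate vanishing on all of H, although H
   contains that vertex and the coordinate is 1 there. *)
apply/fintype.subsetP => i _; apply: contrapT => /negP ij.
have := bary_push jE i (FH _ (vertex_hull i)); rewrite bary_vertex eqxx big1.
  by move/eqP; rewrite oner_eq0.
by move=> a /eqP e; case/negP: ij; rewrite -e codom_f.
Qed.

Variable X : simplex -> submodClosed (dform R N k).
Local Notation gform := (global_form Tri n X).

Lemma global_formP (w : gform) : [/\ forall T, T \in Tri -> sdim T = n -> w T \in X T,
  forall T, ~~ ((T \in Tri) && (sdim T == n)) -> w T = 0 & single_valued Tri n w].
Proof. by have /asboolP := valP w. Qed.

(** The definition takes the first suitable simplex T'. The traces from T and T' agree on their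
    intersection, and F lies in it. *)
Lemma global_traceE (F T : simplex) (w : gform) : T \in Tri -> sdim T = n ->
  subsimplex F T -> global_trace F w = trace F (w T).
Proof.
move=> TT dT FT; rewrite /global_trace; set s := [seq _ <- _ | _].
have : T \in s by rewrite mem_filter dT eqxx FT TT.
have : {subset s <= [pred T' | (T' \in Tri) && ((sdim T' == n) && subsimplex F T')]}.
  by move=> T'; rewrite mem_filter inE andbC.
case: s => [//|T' s] /(_ T' (mem_head _ _)) /and3P[TT' /eqP dT' FT'] _ /=.
have [H [HT HT' He FH]] := Tri_cap_hull TT TT' (subsimplex_hull FT) (subsimplex_hull FT').
have [_ _ /(_ T T' H TT TT' dT dT' He) e] := global_formP w.
by rewrite -(trace_trace (w T') FH) -e trace_trace.
Qed.

Lemma global_trace0 (F : simplex) (w : gform) :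
  (forall T, T \in Tri -> sdim T = n -> ~~ subsimplex F T) -> global_trace F w = 0.
Proof.
move=> FT; rewrite /global_trace; set s := [seq _ <- _ | _].
have : {subset s <= [pred T' | (T' \in Tri) && ((sdim T' == n) && subsimplex F T')]}.
  by move=> T'; rewrite mem_filter inE andbC.
case: s => [//|T' s] /(_ T' (mem_head _ _)) /and3P[TT' /eqP dT' FT'].
by have := FT _ TT' dT'; rewrite FT'.
Qed.

Lemma global_traceP (F : simplex) : (forall w : gform, global_trace F w = 0) \/
  exists T, [/\ T \in Tri, sdim T = n & subsimplex F T].
Proof.
have [[T HT]|H] := pselect (exists T, [/\ T \in Tri, sdim T = n & subsimplex F T]).
  by right; exists T.
by left => w; apply: global_trace0 => T TT dT; apply/negP => FT; apply: H; exists T.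
Qed.

Lemma global_trace_linear (F : simplex) a (w w' : gform) :
  global_trace F (a *: w + w') = a *: global_trace F w + global_trace F w'.
Proof.
have [H|[T [TT dT FT]]] := global_traceP F; first by rewrite !H scaler0 addr0.
by rewrite !(global_traceE _ TT dT FT) -linearP.
Qed.

Section TestForm.
Variables (F : simplex) (w : ('I_(sdim F).+1 -> R) -> {set 'I_(sdim F).+1} -> C).
Hypothesis FF : F \in Tri.
Hypothesis w_full : full_support w.
Hypothesis w_mem : forall (T : simplex) (j : 'I_(sdim F).+1 -> 'I_(sdim T).+1),
  (forall a b : 'I_(sdim F).+1, (a < b)%N -> (j a < j b)%N) ->
  trace T (pform (fun i => bary T (j i)) (fun i => dbary T (j i)) w) \in X T.

Definition extension (T : simplex) : dform R N k :=
  pform (fun i : 'I_(sdim F).+1 => bary_at T F`_i) (fun i => dbary_at T F`_i) w.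

Lemma extension_out T : T \in Tri -> ~~ subsimplex F T -> extension T = 0.
Proof.
move=> TT FT; have [i iT] := missing_vertex FF TT FT.
apply: (@pform_vanish _ _ _ _ _ _ _ i) => // x; first exact: (bary_at_out _ iT).
exact: (dbary_at_out _ iT).
Qed.

Lemma extension_mem T : T \in Tri -> trace T (extension T) \in X T.
Proof.
move=> TT; have [FT|FT] := boolP (subsimplex F T); last first.
  by rewrite extension_out // linear0 rpred0.
have [j jinc jE] := subsimplexP FT.
rewrite /extension.
have -> : (fun i : 'I_(sdim F).+1 => bary_at T F`_i) = fun i => bary T (j i).
  by apply/funext => i; apply/funext => x; rewrite -jE bary_at_vertex.
have -> : (fun i : 'I_(sdim F).+1 => dbary_at T F`_i) = fun i => dbary T (j i).
  by apply/funext => i; apply/funext => x; rewrite -jE dbary_at_vertex.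
exact: w_mem.
Qed.

Lemma extension_restr G T : subsimplex G T -> trace G (extension T) = trace G (extension G).
Proof.
move=> GT; apply: eq_trace => x v Gx Gv; rewrite /extension /pform.
have -> : (fun i : 'I_(sdim F).+1 => bary_at T F`_i x) = fun i => bary_at G F`_i x.
  by apply/funext => i; rewrite (bary_at_restr GT).
by apply: eq_ev => a i; rewrite /toC (dbary_at_restr GT).
Qed.

Lemma extension_self : extension F = fform F w.
Proof.
rewrite /extension /fform.
have -> : (fun i : 'I_(sdim F).+1 => bary_at F F`_i) = bary F.
  by apply/funext => i; apply/funext => x; exact: bary_at_vertex.
have -> // : (fun i : 'I_(sdim F).+1 => dbary_at F F`_i) = dbary F.
by apply/funext => i; apply/funext => x; exact: dbary_at_vertex.
Qed.

Definition global_extension (T : simplex) : dform R N k :=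
  if (T \in Tri) && (sdim T == n) then trace T (extension T) else 0.

Lemma global_extension_pred : global_extension \in global_form_pred Tri n X.
Proof.
apply/asboolP; split=> [T TT dT|T /negbTE TN|T T' H TT TT' dT dT' He].
- by rewrite /global_extension TT dT eqxx; exact: extension_mem.
- by rewrite /global_extension TN.
have [HT HT'] : hull H `<=` hull T /\ hull H `<=` hull T'.
  by rewrite He; split=> x [].
(* [single_valued] allows any simplex H with the hull of the intersection; G is a common face of T
   and T', to which both extensions restrict as the extension on G. *)
have [G [GT GT' _ HG]] := Tri_cap_hull TT TT' HT HT'.
rewrite /global_extension TT TT' dT dT' eqxx /= !trace_trace //.
rewrite -(trace_trace (extension T) HG) (extension_restr GT).
by rewrite -(trace_trace (extension T') HG) (extension_restr GT').
Qed.

Definition test_form : gform := GlobalForm global_extension_pred.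

Lemma global_trace_test G : G \in Tri -> ~~ subsimplex F G -> global_trace G test_form = 0.
Proof.
move=> GG FG; have [->//|[T [TT dT GT]]] := global_traceP G.
rewrite (global_traceE _ TT dT GT) /= /global_extension TT dT eqxx /=.
rewrite trace_trace ?(extension_restr GT) ?extension_out ?linear0 //.
exact: subsimplex_hull.
Qed.

Lemma global_trace_test_self T : T \in Tri -> sdim T = n -> subsimplex F T ->
  global_trace F test_form = trace F (fform F w).
Proof.
move=> TT dT FT; rewrite (global_traceE _ TT dT FT) /= /global_extension TT dT eqxx /=.
rewrite trace_trace ?(extension_restr FT) ?extension_self //.
exact: subsimplex_hull.
Qed.

End TestForm.

Variable Y : forall F : simplex, submodClosed (dform R N (sdim F - k)).
Variable o : simplex -> bool.

Lemma local_functional0 (F : simplex) d : integral_form F (o F) (0 : dform R N d) = 0.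
Proof.
rewrite (integral_formE _ (g := fun=> 0)) // /corner_cintegral.
have z : corner_integral (sdim F) 1 (fun=> 0 : R) = 0.
  have := corner_integral_lin (sdim F) 0 0 (@ler01 R) (pfun_cst 0) (pfun_cst 0).
  by rewrite !mul0r addr0; congr (_ = _); congr corner_integral; apply/funext => u; rewrite mul0r addr0.
by rewrite z mulr0.
Qed.

Hypothesis definite : forall F, (k <= sdim F)%N -> forall eta, eta \in Y F ->
  exists w : ('I_(sdim F).+1 -> R) -> {set 'I_(sdim F).+1} -> C,
  [/\ full_support w,
      forall (T : simplex) (j : 'I_(sdim F).+1 -> 'I_(sdim T).+1),
        (forall a b : 'I_(sdim F).+1, (a < b)%N -> (j a < j b)%N) ->
        trace T (pform (fun i => bary T (j i)) (fun i => dbary T (j i)) w) \in X T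
    & integral_form F (o F) (form_wedge (trace F (fform F w : dform R N k)) eta) = 0 -> eta = 0].

(** At the test form of F only the term of F survives: simplices of larger dimension are settled by
    induction, and another simplex of dimension at most that of F cannot contain F. *)
Theorem functional_sum_direct_of_definite :
  functional_sum_direct (fun F => @local_functionals R N Tri n k X (o F) F (Y F)).
Proof.
move=> psi psiW sum0.
suff H d : forall F, (n - sdim F < d)%N -> F \in Tri -> (k <= sdim F)%N -> forall w, psi F w = 0.
  by move=> F FF kF w; apply: (H (n - sdim F).+1).
elim: d => // d IH F Fd FF kF w.
have [eta etaY psiE] := psiW F FF kF.
(* If F lies in no n-dimensional simplex, its global trace is zero by convention and so is the
   functional. *)
have [H0|[T [TT dT FT]]] := global_traceP F.
  by rewrite psiE H0 form_wedge0l local_functional0.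
suff e0 : eta = 0 by rewrite psiE e0 form_wedge0r local_functional0.
have [q [q_full q_mem]] := definite kF etaY; apply.
rewrite -(global_trace_test_self FF q_full q_mem TT dT FT) -psiE.
set Om := test_form _ _ _.
have := sum0 Om; rewrite big_mkcond (bigD1_seq F) ?fset_uniq //= kF big1_seq ?addr0 //.
move=> G /andP[GF GG]; case: ifP => // kG.
have [GleF|FltG] := leqP (sdim G) (sdim F); last first.
  apply: IH => //; rewrite -ltnS; apply: leq_trans Fd; rewrite ltnS ltn_sub2l //.
  exact: leq_trans FltG (Tri_dim GG).
have [eta' _ ->] := psiW G GG kG.
rewrite global_trace_test ?form_wedge0l ?local_functional0 //.
by apply: contra GF => FG; rewrite (subsimplex_eq FG GleF).
Qed.

Hypothesis X_trace : forall (G T : simplex) w, subsimplex G T -> w \in X T -> trace G w \in X G.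
Hypothesis X_fix : forall T w, w \in X T -> trace T w = w.
Hypothesis X_low : forall F, (sdim F < k)%N -> forall w, w \in X F -> w = 0.
Hypothesis X_determined : forall F, (k <= sdim F)%N -> forall w, w \in X F ->
  (forall G, subsimplex G F -> G != F -> trace G w = 0) ->
  (forall eta, eta \in Y F -> integral_form F (o F) (form_wedge w eta) = 0) -> w = 0.
Hypothesis XY_integrable : forall F, (k <= sdim F)%N -> forall w eta, w \in X F -> eta \in Y F ->
  integrable_form F (form_wedge w eta).
Hypothesis Y_fin : forall F, exists2 gs : seq (dform R N (sdim F - k)),
  forall g, g \in gs -> g \in Y F &
  forall eta, eta \in Y F -> exists c : nat -> C, eta = \sum_(j < size gs) c j *: gs`_j.

Lemma global_trace_mem F (w : gform) : global_trace F w \in X F.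
Proof.
have [->|[T [TT dT FT]]] := global_traceP F; first exact: rpred0.
rewrite (global_traceE _ TT dT FT); apply: (X_trace FT).
by have [h _ _] := global_formP w; exact: h.
Qed.

Let lf (F : simplex) eta (w : gform) : C :=
  integral_form F (o F) (form_wedge (global_trace F w) (eta : dform R N (sdim F - k))).

Lemma lf_linear F eta : (k <= sdim F)%N -> eta \in Y F -> is_linear_form (lf (F := F) eta).
Proof.
move=> kF etaY a u v; rewrite /lf global_trace_linear form_wedge_linl.
by rewrite integral_form_lin //; apply: XY_integrable => //; exact: global_trace_mem.
Qed.

Lemma lf_sum F p (c : 'I_p -> C) (g : 'I_p -> dform R N (sdim F - k)) w :
  (k <= sdim F)%N -> (forall j, g j \in Y F) ->
  lf (\sum_j c j *: g j) w = \sum_j c j * lf (g j) w.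
Proof.
move=> kF gY; have : \sum_j c j *: g j \in Y F /\
    lf (\sum_j c j *: g j) w = \sum_j c j * lf (g j) w; last by case.
elim/big_rec2: _ => [|j y1 y2 _ [y2Y <-]].
  by rewrite rpred0 /lf form_wedge0r local_functional0.
split; first by rewrite rpredD ?rpredZ.
rewrite /lf form_wedge_linr integral_form_lin //; apply: XY_integrable => //;
  exact: global_trace_mem.
Qed.

Lemma dual_of_linear_form (f : gform -> C) : is_linear_form f ->
  exists phi : dual_space Tri n X, forall w, phi w = f w.
Proof.
move=> fL; pose L := GRing.isLinear.Build C gform C *:%R f fL.
by exists (HB.pack f L : {linear gform -> C}).
Qed.

Lemma global_trace_eq0 (w : gform) :
  (forall F, F \in Tri -> (k <= sdim F)%N -> forall eta, eta \in Y F -> lf eta w = 0) ->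
  forall F, F \in Tri -> global_trace F w = 0.
Proof.
move=> w0; suff H d : forall F, (sdim F < d)%N -> F \in Tri -> global_trace F w = 0.
  by move=> F; apply: H (leqnn _).
elim: d => // d IH F Fd FF.
have [->//|[T [TT dT FT]]] := global_traceP F.
have [kF|kF] := leqP k (sdim F); last exact: (X_low kF (global_trace_mem F w)).
apply: (X_determined kF (global_trace_mem F w)) => [G GF GnF|eta etaY]; last exact: (w0 F FF kF eta etaY).
have GT := subsimplex_trans GF FT.
rewrite (global_traceE _ TT dT FT) trace_trace; last exact: subsimplex_hull.
rewrite -(global_traceE _ TT dT GT); apply: IH; last exact: Tri_sub GF.
apply: leq_trans (Fd : (sdim F <= d)%N); rewrite ltnNge; apply: contra GnF => FG.
by rewrite (subsimplex_eq GF FG).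
Qed.

Lemma global_form_eq0 (w : gform) :
  (forall F, F \in Tri -> (k <= sdim F)%N -> forall eta, eta \in Y F -> lf eta w = 0) -> w = 0.
Proof.
move=> w0; apply: val_inj; apply/funext => T /=.
have [wX wout _] := global_formP w.
have [/andP[TT /eqP dT]|TN] := boolP ((T \in Tri) && (sdim T == n)); last exact: wout.
rewrite -(X_fix (wX T TT dT)) -(global_traceE w TT dT (subseq_refl _)).
exact: global_trace_eq0.
Qed.

(** Finitely many generators of the spaces Y F give functionals with zero common kernel;
    [dual_span_fin] expresses phi by them, and the terms are then grouped by simplex. *)
Theorem functional_sum_of_determined :
  functional_sum (fun F => @local_functionals R N Tri n k X (o F) F (Y F)) = setT.
Proof.
apply/seteqP; split=> // phi _.
have [gs gsY gsE] : exists2 gs : forall F, seq (dform R N (sdim F - k)),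
    forall F g, g \in gs F -> g \in Y F & forall F eta, eta \in Y F ->
      exists c : nat -> C, eta = \sum_(j < size (gs F)) c j *: (gs F)`_j.
  by exists (fun F => s2val (cid2 (Y_fin F))) => F; case: (cid2 _).
have gsjY F j : (gs F)`_j \in Y F.
  have [jg|jg] := ltnP j (size (gs F)); first exact/gsY/mem_nth.
  by rewrite nth_default // rpred0.
(* A common bound on the numbers of generators gives a finite index type; indices past the end read
   the form 0, which lies in Y F. *)
pose P := \max_(F <- Tri) size (gs F).
pose f (x : Tri * 'I_P) (w : gform) : C :=
  if (k <= sdim (val x.1))%N then lf (gs (val x.1))`_x.2 w else 0.
have [x||w fw|c cE] := @dual_span_fin _ _ _ f phi.
- rewrite /f; case kF: (k <= sdim (val x.1))%N; first exact: (lf_linear kF (gsjY _ _)).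
  by move=> a u v; rewrite mulr0 addr0.
- by move=> a u v; rewrite linearP.
- suff -> : w = 0 by rewrite linear0.
  apply: global_form_eq0 => F FF kF eta /gsE[d ->].
  rewrite lf_sum => [||j]; [|by []|exact: gsjY]; rewrite big1 // => j _.
  have jP : (j < P)%N by apply: leq_trans (ltn_ord j) _; exact: leq_bigmax_seq.
  by have := fw ([` FF]%fset, Ordinal jP); rewrite /f /= kF => ->; rewrite mulr0.
pose d F (j : 'I_P) : C := if insub F is Some F' then c (F', j) else 0.
pose eta F := \sum_j d F j *: (gs F)`_j.
have etaY F : eta F \in Y F by apply: rpred_sum => j _; apply: rpredZ; exact: gsjY.
have /choice[psi psiE] : forall F, exists q : dual_space Tri n X,
    (k <= sdim F)%N -> forall w, q w = lf (eta F) w.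
  move=> F; have [kF|kF] := leqP k (sdim F); last by exists phi.
  have [psi psiE] := dual_of_linear_form (lf_linear kF (etaY F)).
  by exists psi.
exists psi => [F FF kF|w]; first by exists (eta F); [exact: etaY|move=> w; exact: psiE].
transitivity (\sum_F \sum_j c (F, j) * f (F, j) w).
  by rewrite cE pair_bigA; apply: eq_bigr => -[].
rewrite [RHS]big_mkcond [RHS]big_seq_fsetE /=; apply: eq_bigr => F _; rewrite /f /=; case: ifP => kF; last first.
  by rewrite big1 // => j _; rewrite mulr0.
rewrite psiE // lf_sum => [||j]; [|by []|exact: gsjY]; apply: eq_bigr => j _; congr (_ * _).
by rewrite /d valK.
Qed.

End GlobalForms.

(** * The two families of polynomial spaces meet the abstract requirements *)

Section PolynomialForms.
Variables (R : realType) (N : nat).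
Local Notation C := R[i].
Implicit Types (F G T : osimplex R N).

Lemma fform_PLambda s l F w : hform s l w -> trace F (fform F w : dform R N l) \in PLambda s l F.
Proof. by move=> hw; have := @PLambda_mem R N F _ id (fun _ _ => id) s l w hw. Qed.

Lemma fform_PminusLambda s l F c : hform (s - 1) l.+1 c ->
  trace F (fform F (fun t => ctr (toC t) (c t)) : dform R N l) \in PminusLambda s l F.
Proof. by move=> hc; have := @PminusLambda_mem R N F _ id (fun _ _ => id) s l c hc. Qed.

Lemma PLambda_trace s l G T (w : dform R N l) : subsimplex G T ->
  w \in PLambda s l T -> trace G w \in PLambda s l G.
Proof.
move=> GT /PLambda_rep[q hq ->].
have [j jinc jE] := subsimplexP GT.
rewrite trace_trace; last exact: subsimplex_hull.
rewrite (trace_restr _ _ jinc jE).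
exact: fform_PLambda (hform_pull jinc hq).
Qed.

Lemma PminusLambda_trace s l G T (w : dform R N l) : subsimplex G T ->
  w \in PminusLambda s l T -> trace G w \in PminusLambda s l G.
Proof.
move=> GT /PminusLambda_rep[c hc ->].
have [j jinc jE] := subsimplexP GT.
rewrite trace_trace; last exact: subsimplex_hull.
rewrite (trace_restr _ _ jinc jE).
have -> : pull j (fun t => ctr (toC t) (c t)) = fun t => ctr (toC t) (pull j c t).
  apply/funext => t; apply/funext => A.
  by rewrite /pull (ctr_pull jinc) toC_push.
exact: fform_PminusLambda (hform_pull jinc hc).
Qed.

Lemma PLambda_fix s l F (w : dform R N l) : w \in PLambda s l F -> trace F w = w.
Proof. by move=> /PLambda_rep[q _ ->]; rewrite trace_trace. Qed.

Lemma PminusLambda_fix s l F (w : dform R N l) : w \in PminusLambda s l F -> trace F w = w.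
Proof. by move=> /PminusLambda_rep[q _ ->]; rewrite trace_trace. Qed.

(** S /\ w has degree l + 1, which exceeds the number of vertices, so it vanishes. *)
Lemma trace_fform_low F l (w : ('I_(sdim F).+1 -> R) -> {set 'I_(sdim F).+1} -> C) :
  (sdim F < l)%N -> (forall t, homog l (w t)) -> trace F (fform F w : dform R N l) = 0.
Proof.
move=> Fl wl; apply: trace_fform_ext0 => t _; apply/funext => A.
apply: (homog_ext _ (wl t)); rewrite ltn_eqF // ltnS.
by apply: leq_trans Fl; rewrite -[X in (_ <= X)%N](card_ord (sdim F).+1) max_card.
Qed.

Lemma PLambda_low s l F (w : dform R N l) : (sdim F < l)%N -> w \in PLambda s l F -> w = 0.
Proof. by move=> Fl /PLambda_rep[q hq ->]; apply: trace_fform_low hq.2. Qed.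

Lemma PminusLambda_low s l F (w : dform R N l) :
  (sdim F < l)%N -> w \in PminusLambda s l F -> w = 0.
Proof.
by move=> Fl /PminusLambda_rep[q hq ->]; apply: trace_fform_low (hform_ctr hq).2.
Qed.

Lemma integrable_P_Pminus F k l s s' (w : dform R N k) (h : dform R N l) : (k + l)%N = sdim F ->
  w \in PLambda s k F -> h \in PminusLambda s' l F -> integrable_form F (form_wedge w h).
Proof.
move=> klF /PLambda_rep[q hq ->] /PminusLambda_rep[c hc ->].
exact: (integrable_wedge klF hq (hform_ctr hc)).
Qed.

Lemma integrable_Pminus_P F k l s s' (w : dform R N k) (h : dform R N l) : (k + l)%N = sdim F ->
  w \in PminusLambda s k F -> h \in PLambda s' l F -> integrable_form F (form_wedge w h).
Proof.
move=> klF /PminusLambda_rep[c hc ->] /PLambda_rep[q hq ->].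
exact: (integrable_wedge klF (hform_ctr hc) hq).
Qed.

Lemma lspan_fin (V : lmodType C) (G : set V) (gs : seq V) :
  (forall v, G v -> v \in gs) ->
  forall v, v \in lspan G -> exists c : nat -> C, v = \sum_(j < size gs) c j *: gs`_j.
Proof.
move=> Ggs; apply: lspan_ind => [|a _ _ [c ->] [d ->]|v /Ggs vg].
- by exists (fun=> 0); rewrite big1 // => j _; rewrite scale0r.
- exists (fun j => a * c j + d j); rewrite scaler_sumr -big_split; apply: eq_bigr => j _ /=.
  by rewrite scalerDl scalerA.
have ig : (index v gs < size gs)%N by rewrite index_mem.
exists (fun j => (j == index v gs)%:R); rewrite (bigD1 (Ordinal ig)) //= eqxx scale1r.
rewrite nth_index // big1 ?addr0 // => j ji; case: eqP => [e|_]; last by rewrite scale0r.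
by case/eqP: ji; apply: val_inj.
Qed.

(** Entries of a multi-index of sum s are at most |s|, so a finite box suffices; for negative s the
    filter leaves nothing. *)
Definition multi_indices (s : int) m : seq {ffun 'I_m -> 'I_(absz s).+1} :=
  [seq al : {ffun 'I_m -> 'I_(absz s).+1} <- enum {ffun 'I_m -> 'I_(absz s).+1} |
    (\sum_i (al i : nat))%N%:Z == s].

Lemma multi_indicesP (s : int) m (al : 'I_m -> nat) : multi_index s al ->
  exists2 be, be \in multi_indices s m & al = fun i => be i : nat.
Proof.
move=> als; have alb i : (al i < (absz s).+1)%N.
  by rewrite ltnS -als /= (bigD1 i) //= leq_addr.
exists [ffun i => Ordinal (alb i)]; last by apply/funext => i; rewrite ffunE.
rewrite mem_filter mem_enum andbT; apply/eqP; rewrite -[RHS]als; congr Posz.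
by apply: eq_bigr => i _; rewrite ffunE.
Qed.

Lemma multi_indices_multi (s : int) m be : be \in multi_indices s m ->
  multi_index s (fun i => be i : nat).
Proof. by rewrite mem_filter => /andP[/eqP]. Qed.

Definition inc_maps l m : seq {ffun 'I_l -> 'I_m} :=
  [seq sg : {ffun 'I_l -> 'I_m} <- enum {ffun 'I_l -> 'I_m} | `[< strict_inc sg >]].

Lemma inc_mapsP l m (sg : 'I_l -> 'I_m) : strict_inc sg ->
  exists2 be, be \in inc_maps l m & sg = be.
Proof.
move=> sinc; exists (finfun sg); last by apply/funext => i; rewrite ffunE.
by rewrite mem_filter mem_enum andbT; apply/asboolP => i j ij; rewrite !ffunE; exact: sinc.
Qed.

Lemma PLambda_fin s l F : exists2 gs : seq (dform R N l),
  forall g, g \in gs -> g \in PLambda s l F &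
  forall eta, eta \in PLambda s l F -> exists c : nat -> C, eta = \sum_(j < size gs) c j *: gs`_j.
Proof.
exists [seq trace F (scale_form (monomial F (fun i => al i : nat)) (dlambda F (fun i => sg i)))
  | al : {ffun 'I_(sdim F).+1 -> 'I_(absz s).+1} <- multi_indices s _, sg : {ffun 'I_l -> 'I_(sdim F).+1} <- inc_maps l _].
  move=> _ /allpairsP[[al sg] /= [/multi_indices_multi als sgm ->]].
  apply: lspan_mem; exists (fun i => al i : nat), sg; split=> //.
  by move: sgm; rewrite mem_filter => /andP[/asboolP].
apply: lspan_fin => _ [al [sg [/multi_indicesP[be bem ->] /inc_mapsP[si sim ->] ->]]].
by apply/allpairsP; exists (be, si).
Qed.

Lemma PminusLambda_fin s l F : exists2 gs : seq (dform R N l),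
  forall g, g \in gs -> g \in PminusLambda s l F &
  forall eta, eta \in PminusLambda s l F ->
    exists c : nat -> C, eta = \sum_(j < size gs) c j *: gs`_j.
Proof.
exists [seq trace F (scale_form (monomial F (fun i => al i : nat)) (whitney F (fun i => sg i)))
  | al : {ffun 'I_(sdim F).+1 -> 'I_(absz (s - 1)).+1} <- multi_indices (s - 1) _,
    sg : {ffun 'I_l.+1 -> 'I_(sdim F).+1} <- inc_maps l.+1 _].
  move=> _ /allpairsP[[al sg] /= [/multi_indices_multi als sgm ->]].
  apply: lspan_mem; exists (fun i => al i : nat), sg; split=> //.
  by move: sgm; rewrite mem_filter => /andP[/asboolP].
apply: lspan_fin => _ [al [sg [/multi_indicesP[be bem ->] /inc_mapsP[si sim ->] ->]]].
by apply/allpairsP; exists (be, si).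
Qed.

Lemma test_P_full F c : full_support (@test_P R N F c).
Proof.
move=> t A i ti iA; rewrite /test_P /star (bigD1 i) /=; last by rewrite inE.
by rewrite /toC ti !(mul0r, mulr0).
Qed.

Lemma test_Pminus_full F k l s (a : ('I_(sdim F).+1 -> R) -> {set 'I_(sdim F).+1} -> C) :
  (k + l)%N = sdim F -> hform s l a -> full_support (@test_Pminus R N F a).
Proof.
move=> klF ha t A i ti iA; have hs := hform_test_Pminus klF ha.
rewrite /test_Pminus (ctr_star_homog (hs.2 t)) fctE /star (bigD1 i) /=; last by rewrite inE.
by rewrite /toC ti !(mul0r, mulr0) scaler0.
Qed.

End PolynomialForms.

Section Conclusion.
Variables (R : realType) (N n : nat) (Tri : {fset osimplex R N}).
Hypothesis Tri_sub : forall T F : osimplex R N,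
     T \in Tri -> subsimplex F T -> F \in Tri.
Hypothesis Tri_cap : forall T T' : osimplex R N, T \in Tri -> T' \in Tri ->
     hull T `&` hull T' = set0 \/
     exists F : osimplex R N, [/\ F \in Tri, subsimplex F T, subsimplex F T' &
                                  hull F = hull T `&` hull T'].
Hypothesis Tri_dim : forall T : osimplex R N, T \in Tri -> (sdim T <= n)%N.
Variables (o : osimplex R N -> bool) (r k : nat).

Lemma W_direct : functional_sum_direct (@W_local R N Tri n k r o).
Proof.
apply: (functional_sum_direct_of_definite Tri_cap Tri_dim) => F kF eta /PminusLambda_rep[c hc ->].
have klF : (k + (sdim F - k))%N = sdim F by rewrite subnKC.
exists (@test_P R N F c); split; first exact: test_P_full.
  move=> T j jinc; apply: PLambda_mem => //.
  (* With m = sdim F, c has degree r + k - m - 1 and its star adds m - k + 1, which gives r. *)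
  by have := hform_test_P klF hc; congr hform; lia.
exact: (test_P_definite klF hc).
Qed.

Lemma Wminus_direct : functional_sum_direct (@Wminus_local R N Tri n k r o).
Proof.
apply: (functional_sum_direct_of_definite Tri_cap Tri_dim) => F kF eta /PLambda_rep[a ha ->].
have klF : (k + (sdim F - k))%N = sdim F by rewrite subnKC.
exists (@test_Pminus R N F a); split; first exact: (test_Pminus_full klF ha).
  move=> T j jinc; apply: (@PminusLambda_mem _ _ _ _ _ jinc).
  by have := hform_test_Pminus klF ha; congr hform; lia.
exact: (test_Pminus_definite klF ha).
Qed.

(** The condition on r cannot be dropped: for r = 0 every space of eta has multi-indices of negative
    sum and is zero, while for k = 0 the constants are nonzero global forms as soon as [Tri] has an
    n-dimensional simplex. *)
Lemma W_span : (0 < r)%N -> functional_sum (@W_local R N Tri n k r o) = setT.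
Proof.
move=> r0; apply: (@functional_sum_of_determined R N n k Tri Tri_sub Tri_cap (PLambda r%:Z k)
  (fun F => PminusLambda (r%:Z + k%:Z - (sdim F)%:Z) (sdim F - k) F) o).
- by move=> G T w; exact: PLambda_trace.
- by move=> T w; exact: PLambda_fix.
- by move=> F Fk w; exact: PLambda_low.
- move=> F kF w /PLambda_rep[q hq ->] w0 int0.
  have klF : (k + (sdim F - k))%N = sdim F by rewrite subnKC.
  apply: (trace_P_eq0 klF r0 hq) => [G GF GnF|c hc].
    by rewrite -(w0 G GF GnF) trace_trace //; exact: subsimplex_hull.
  apply: int0; apply: fform_PminusLambda.
  by move: hc; congr hform; lia.
- move=> F kF w eta; apply: integrable_P_Pminus; exact: subnKC.
- by move=> F; exact: PminusLambda_fin.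
Qed.

Lemma Wminus_span : functional_sum (@Wminus_local R N Tri n k r o) = setT.
Proof.
apply: (@functional_sum_of_determined R N n k Tri Tri_sub Tri_cap (PminusLambda r%:Z k)
  (fun F => PLambda (r%:Z + k%:Z - (sdim F)%:Z - 1) (sdim F - k) F) o).
- by move=> G T w; exact: PminusLambda_trace.
- by move=> T w; exact: PminusLambda_fix.
- by move=> F Fk w; exact: PminusLambda_low.
- move=> F kF w /PminusLambda_rep[q hq ->] w0 int0.
  have klF : (k + (sdim F - k))%N = sdim F by rewrite subnKC.
  apply: (trace_Pminus_eq0 klF hq) => [G GF GnF|a ha].
    by rewrite -(w0 G GF GnF) trace_trace //; exact: subsimplex_hull.
  apply: int0; apply: fform_PLambda.
  by move: ha; congr hform; lia.
- move=> F kF w eta; apply: integrable_Pminus_P; exact: subnKC.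
- by move=> F; exact: PLambda_fin.
Qed.

End Conclusion.

Unset Implicit Arguments.

Theorem theorem7p5 (R : realType) (N n : nat) (Tri : {fset osimplex R N})
  (Tri_sub : forall T F : osimplex R N,
     T \in Tri -> subsimplex F T -> F \in Tri)
  (Tri_cap : forall T T' : osimplex R N, T \in Tri -> T' \in Tri ->
     hull T `&` hull T' = set0 \/
     exists F : osimplex R N, [/\ F \in Tri, subsimplex F T, subsimplex F T' &
                                  hull F = hull T `&` hull T'])
  (Tri_dim : forall T : osimplex R N, T \in Tri -> (sdim T <= n)%N)
  (o : osimplex R N -> bool) (r k : nat) (hk : (k <= n)%N) :
  [/\ functional_sum_direct (@W_local R N Tri n k r o),
      (0 < r)%N -> functional_sum (@W_local R N Tri n k r o) = setT,
      functional_sum_direct (@Wminus_local R N Tri n k r o) &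
      functional_sum (@Wminus_local R N Tri n k r o) = setT].
Proof.
split.
- exact: W_direct.
- exact: W_span.
- exact: Wminus_direct.
- exact: Wminus_span.
Qed.
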